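(* Let $B>0$ and $x,b\in[0,B]$, let $\xi(x,t)$ be the oscillating compound Poisson process with switching level $b$ (defined in the context), started from $x$, and let $s\ge0$. Let $\chi_x(b)$ be its first exit time from $[0,B]$ and $T(x)$ the overshoot at this time, with Laplace transforms $\underline V_x(s)$, $\overline V_x(s)$, $\overline V_x(z,s)$ as defined in the context. Then $$\underline V_x(s)=\frac{K_{b-x}^s(B-b)}{K_b^s(B-b)},\qquad \overline V_x(s)=\mathfrak{K}_{b-x}^{B-b}(s)-\frac{K_{b-x}^s(B-b)}{K_b^s(B-b)}\,\mathfrak{K}_b^{B-b}(s),$$ where, for $y\in\mathbb{R}$, $u\ge0$, $$\mathfrak{K}_y^u(s)=1+s\int_0^yR_1^s(v)\,dv+s\int_0^uK_y^s(v)\,dv;$$ and, for $\Re(z)\ge0$, $$\overline V_x(z,s)=\mathfrak{K}_{b-x}^{B-b}(z,s)-\frac{K_{b-x}^s(B-b)}{K_b^s(B-b)}\,\mathfrak{K}_b^{B-b}(z,s),$$ where, for $y\in\mathbb{R}$, $u\ge0$, $$\mathfrak{K}_y^u(z,s)=e^{uz}\left(C_1^y(z,s)-(k_2(z)-s)\int_0^ue^{-vz}K_y^s(v)\,dv\right).$$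
   Context: Underlying processes. For $i=1,2$ let $\xi_i(t)=\sum_{k=0}^{N_i(t)}\xi^i_k-a_it$, $t\ge0$, where $a_i>0$, $\xi^i_0=0$, $(\xi^i_k)_{k\ge1}$ are i.i.d. strictly positive random variables with distribution function $F_i$, and $N_i$ is a Poisson process of rate $\lambda_i$, $N_i(0)=0$, independent of $(\xi^i_k)$. Then $\mathbf{E}e^{-z\xi_i(t)}=e^{tk_i(z)}$ with $$k_i(z)=a_iz+\lambda_i\int_0^\infty(e^{-xz}-1)\,dF_i(x),$$ and $k_i$ is used for all $\Re(z)\ge0$. For $s>0$, $c_i(s)>0$ is the unique root of $k_i(z)=s$ in $\Re(z)>0$; $c_i(0)=\lim_{s\downarrow0}c_i(s)$. The resolvent $R_i^s$ is given by $\int_0^\infty e^{-xz}R_i^s(x)\,dx=(k_i(z)-s)^{-1}$ for $\Re(z)>c_i(s)$ (right-continuous version, $R_i^s(0)=a_i^{-1}$), and $R_i^s(x)=0$ for $x<0$ (so $\int_0^yR_1^s(v)\,dv=0$ for $y<0$). Passage times. $\inf\emptyset=\infty$. $\tau_i^-(x)=\inf\{t:\xi_i(t)\le-x\}$; $\tau_i^+(x)=\inf\{t:\xi_i(t)>x\}$, $T_i^+(x)=\xi_i(\tau_i^+(x))-x$, for $x\ge0$. Oscillating process. For fixed $b\ge0$ and $x\in\mathbb{R}$, $\xi(x,t)$, $t\ge0$, $\xi(x,0)=x$, is defined recursively. If $x>b$: $\xi(x,t)=x+\xi_2(t)$ for $0\le t<\tau_2^-(x-b)$ and $\xi(x,t)=\xi(b,t-\tau_2^-(x-b))$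 for $t\ge\tau_2^-(x-b)$. If $x\le b$: $\xi(x,t)=x+\xi_1(t)$ for $0\le t<\tau_1^+(b-x)$ and $\xi(x,t)=\xi(b+T_1^+(b-x),t-\tau_1^+(b-x))$ for $t\ge\tau_1^+(b-x)$. At each switching time the process restarts afresh from its current position, independently of the past given that position (strong Markov property), so it moves like $\xi_2$ when above $b$ until it hits $b$, and like $\xi_1$ when at or below $b$ until it jumps above $b$. Exit functionals. $\chi_x(b)=\inf\{t:\xi(x,t)\notin[0,B]\}$; $\overline A=\{\xi(x,\chi_x(b))>B\}$ (exit through the upper boundary); $\underline A=\{\xi(x,\chi_x(b))\le0\}$ (exit through the lower boundary); $T(x)=\xi(x,\chi_x(b))-B$ on $\overline A$ and $T(x)=0$ on $\underline A$. Moreover $\underline V_x(s)=\mathbf{E}[e^{-s\chi_x(b)};\underline A]$, $\overline V_x(s)=\mathbf{E}[e^{-s\chi_x(b)};\overline A]$, $\overline V_x(z,s)=\mathbf{E}[e^{-s\chi_x(b)-zT(x)};\overline A]$ for $\Re(z)\ge0$. Auxiliary functions. $C_1^y(z,s)=e^{zy}$ for $y<0$, and $C_1^y(z,s)=e^{zy}\left(1-(k_1(z)-s)\int_0^ye^{-uz}R_1^s(u)\,du\right)$ for $y\ge0$. For $y\in\mathbb{R}$, $K_y^s(u)$, $u\ge0$, is the right-continuous function with Laplace transform $$\int_0^\infty e^{-uz}K_y^s(u)\,du=\frac{k_1(z)-s}{k_2(z)-s}\int_0^\infty e^{-uz}R_1^s(y+u)\,du,\quad \Re(z)>\max\{c_1(s),c_2(s)\};$$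 in particular $K_y^s(u)=R_2^s(y+u)$ for $y\le0$. *)

(* Defs.v *)
From HB Require Import structures.
From mathcomp Require Import all_boot all_order all_algebra.
From mathcomp Require Import complex.
From mathcomp Require Import all_classical all_reals all_analysis.
Import Order.TTheory GRing.Theory Num.Theory.
Import numFieldNormedType.Exports.

Set Implicit Arguments.
Unset Strict Implicit.
Unset Printing Implicit Defensive.

Local Open Scope classical_set_scope.
Local Open Scope complex_scope.
Local Open Scope ring_scope.

Definition cexp (R : realType) (z : R[i]) : R[i] :=
  (expR (complex.Re z) * cos (complex.Im z))
    +i* (expR (complex.Re z) * sin (complex.Im z)).

Definition Cintegral d (T : measurableType d) (R : realType)
    (mu : {measure set T -> \bar R}) (D : set T) (f : T -> R[i]) : R[i] :=
  (\int[mu]_(x in D) complex.Re (f x)) +i* (\int[mu]_(x in D) complex.Im (f x)).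

Section laplace.
Context (R : realType).
Implicit Types (f : R -> R) (z : R[i]).
Local Notation mu := (@lebesgue_measure R).

(* Absolute convergence at z; it is required next to every equation about
   [laplace f z], since a Lebesgue integral that diverges has a junk value. *)
Definition laplace_cvg f z : Prop :=
  mu.-integrable `[0, +oo[ (fun u => (expR (- (u * complex.Re z)) * f u)%:E).

Definition laplace f z : R[i] :=
  Cintegral mu `[0, +oo[ (fun u => cexp (- (u%:C * z)) * (f u)%:C).

Definition laplace_upto (y : R) f z : R[i] :=
  Cintegral mu `[0, y] (fun u => cexp (- (u%:C * z)) * (f u)%:C).

End laplace.

Section scale_functions.
Context (R : realType).
Implicit Types (r c : R -> R) (Kf : R -> R -> R) (z : R[i]).

(* F is the law of a jump, i.e. the Stieltjes measure dF. *)
Definition cumulant (a lam : R) (F : probability (measurableTypeR R) R) z : R[i] :=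
  a%:C * z + lam%:C * Cintegral F `]0, +oo[ (fun x => cexp (- (x%:C * z)) - 1).

Definition is_root_function (k : R[i] -> R[i]) c : Prop :=
  (forall s, 0 < s ->
    [/\ 0 < c s, k (c s)%:C = s%:C &
        forall z, 0 < complex.Re z -> k z = s%:C -> z = (c s)%:C]) /\
  c s @[s --> 0^'+] --> c 0.

Definition is_resolvent (k : R[i] -> R[i]) (a cs s : R) r : Prop :=
  [/\ forall z, cs < complex.Re z ->
        laplace_cvg r z /\ laplace r z = (k z - s%:C)^-1,
      forall x, 0 <= x -> r t @[t --> x^'+] --> r x,
      r 0 = a^-1 &
      forall x, x < 0 -> r x = 0].

Definition is_Kfun (k1 k2 : R[i] -> R[i]) (c1s c2s s : R) (r1 : R -> R) Kf : Prop :=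
  forall y,
    (forall z, Num.max c1s c2s < complex.Re z ->
      laplace_cvg (Kf y) z /\
      laplace (Kf y) z =
        (k1 z - s%:C) / (k2 z - s%:C) * laplace (fun u => r1 (y + u)) z) /\
    (forall u, 0 <= u -> Kf y v @[v --> u^'+] --> Kf y u).

Definition C1 (k1 : R[i] -> R[i]) (r1 : R -> R) (s y : R) z : R[i] :=
  if y < 0 then cexp (z * y%:C)
  else cexp (z * y%:C) * (1 - (k1 z - s%:C) * laplace_upto y r1 z).

(* The domain `[0, y] is empty when y < 0, so that the first integral is then 0. *)
Definition frakK (r1 : R -> R) Kf (s y u : R) : R :=
  1 + s * (\int[lebesgue_measure]_(v in `[0, y]) r1 v)
    + s * (\int[lebesgue_measure]_(v in `[0, u]) Kf y v).

Definition frakKz (k1 k2 : R[i] -> R[i]) (r1 : R -> R) Kf (s y u : R) z : R[i] :=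
  cexp (u%:C * z) *
    (C1 k1 r1 s y z - (k2 z - s%:C) * laplace_upto u (Kf y) z).

End scale_functions.

Section paths.
Context (R : realType).
Implicit Types (q : R -> R) (x b t B : R).
Local Open Scope ereal_scope.

Definition tau_minus q x : \bar R :=
  ereal_inf [set t%:E | t in [set t | (0 <= t)%R /\ (q t <= - x)%R]].

Definition tau_plus q x : \bar R :=
  ereal_inf [set t%:E | t in [set t | (0 <= t)%R /\ (x < q t)%R]].

Definition T_plus q x : R := (q (fine (tau_plus q x)) - x)%R.

(* The oscillating path started from x at level b, driven by the paths q1 n,
   q2 n, q1 n.+1, q2 n.+1, ...: every switching passes to the next pair of
   paths. At most m - 1 switchings are followed; the value is 0 when more are
   needed before time t. *)
Fixpoint osc_upto b (q1 q2 : nat -> R -> R) (m n : nat) x t : R :=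
  if m is m'.+1 then
    if (b < x)%R then
      let tau := tau_minus (q2 n) (x - b)%R in
      if t%:E < tau then (x + q2 n t)%R
      else osc_upto b q1 q2 m' n.+1 b (t - fine tau)%R
    else
      let tau := tau_plus (q1 n) (b - x)%R in
      if t%:E < tau then (x + q1 n t)%R
      else osc_upto b q1 q2 m' n.+1 (b + T_plus (q1 n) (b - x))%R
             (t - fine tau)%R
  else 0%R.

(* In m, [osc_upto] is 0 up to some rank and constant afterwards. *)
Definition osc b (q1 q2 : nat -> R -> R) (n : nat) x t : R :=
  limn (fun m => osc_upto b q1 q2 m n x t).

Lemma oscE b (q1 q2 : nat -> R -> R) n x t : osc b q1 q2 n x t =
  if (b < x)%R then
    let tau := tau_minus (q2 n) (x - b)%R in
    if t%:E < tau then (x + q2 n t)%R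
    else osc b q1 q2 n.+1 b (t - fine tau)%R
  else
    let tau := tau_plus (q1 n) (b - x)%R in
    if t%:E < tau then (x + q1 n t)%R
    else osc b q1 q2 n.+1 (b + T_plus (q1 n) (b - x))%R (t - fine tau)%R.
Proof.
have shift (u : nat -> R) : limn u = limn (fun m => u m.+1).
  rewrite /lim; congr (get _); apply/funext => l; apply/propext.
  by rewrite -(cvg_shiftS u).
rewrite [LHS]shift /=; case: ifP => _; case: ifP => _ //.
- exact: lim_cst.
- exact: lim_cst.
Qed.

Definition exit_time B q : \bar R :=
  ereal_inf [set t%:E | t in [set t | (0 <= t)%R /\ ~~ (0 <= q t <= B)%R]].

Definition exit_overshoot B q : R :=
  let e := q (fine (exit_time B q)) in if (B < e)%R then (e - B)%R else 0%R.

End paths.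

Section probability.
Context d (T : measurableType d) (R : realType) (P : probability T R).

Definition mutually_independent (I : choiceType) (X : I -> {RV P >-> R}) : Prop :=
  forall (A : I -> set R) (s : seq I), uniq s ->
    (forall i, measurable (A i)) ->
    P (\big[setI/setT]_(i <- s) (X i @^-1` A i)) =
      (\prod_(i <- s) P (X i @^-1` A i))%E.

Definition has_law (X : {RV P >-> R}) (Q : set (measurableTypeR R) -> \bar R) : Prop :=
  forall A, measurable A -> distribution P X A = Q A.

(* N(t) for the Poisson process with inter-arrival times W 0, W 1, ...; it is 0
   on the null event that the arrival times stay below t. *)
Definition poisson_process (W : nat -> T -> R) (t : R) (w : T) : nat :=
  xget 0%N [set n |
    (forall m, (m < n)%N -> \sum_(k < m.+1) W k w <= t) /\
    t < \sum_(k < n.+1) W k w].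

Definition compound_poisson (a : R) (W J : nat -> T -> R) (t : R) (w : T) : R :=
  \sum_(k < poisson_process W t w) J k w - a * t.

(* Inter-arrival times and jumps of countably many independent copies, numbered
   by the first argument, of the two compound Poisson processes. *)
Definition driving_copies (lam1 lam2 : R)
    (F1 F2 : probability (measurableTypeR R) R)
    (W1 J1 W2 J2 : nat -> nat -> {RV P >-> R}) : Prop :=
  [/\ forall n k, has_law (W1 n k) (exponential_prob lam1) /\
                  has_law (W2 n k) (exponential_prob lam2),
      forall n k, has_law (J1 n k) F1 /\ has_law (J2 n k) F2 &
      mutually_independent
        (fun i : (nat * nat) * (bool * bool) =>
           (match i.2 with
            | (false, false) => W1 | (false, true) => J1
            | (true, false) => W2 | (true, true) => J2
            end) i.1.1 i.1.2)].

(* The fresh copy used at each switching realizes the restart of the process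
   independently of its past. *)
Definition oscillating (a1 a2 b : R) (W1 J1 W2 J2 : nat -> nat -> T -> R)
    (x : R) (w : T) (t : R) : R :=
  osc b (fun n t' => compound_poisson a1 (W1 n) (J1 n) t' w)
        (fun n t' => compound_poisson a2 (W2 n) (J2 n) t' w) 0 x t.

Section exit_functionals.
Context (B : R) (X : T -> R -> R).

Definition exit_above : set T :=
  [set w | (exit_time B (X w) < +oo)%E /\ B < X w (fine (exit_time B (X w)))].

Definition exit_below : set T :=
  [set w | (exit_time B (X w) < +oo)%E /\ X w (fine (exit_time B (X w))) <= 0].

Definition Vlower (s : R) : R :=
  \int[P]_(w in exit_below) expR (- (s * fine (exit_time B (X w)))).

Definition Vupper (s : R) : R :=
  \int[P]_(w in exit_above) expR (- (s * fine (exit_time B (X w)))).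

Definition Vupperz (s : R) (z : R[i]) : R[i] :=
  Cintegral P exit_above
    (fun w => cexp (- (s * fine (exit_time B (X w)))%:C
                    - z * (exit_overshoot B (X w))%:C)).

End exit_functionals.
End probability.

(* Main.v *)
Require Import Defs.
From HB Require Import structures.
From mathcomp Require Import all_boot all_order all_algebra.
From mathcomp Require Import complex ring lra.
From mathcomp Require Import all_classical all_reals all_analysis.
From mathcomp Require Import measurable_realfun.
Import Order.TTheory GRing.Theory Num.Theory.
Import numFieldNormedType.Exports.

Set Implicit Arguments.
Unset Strict Implicit.
Unset Printing Implicit Defensive.

Local Open Scope classical_set_scope.
Local Open Scope complex_scope.
Local Open Scope ring_scope.

(** The transforms are found by optional stopping. Call a bounded function h on
    the line, zero on the negative half-line, harmonic if a single step leaves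
    it unchanged in the mean. A step from a level x in ]0, B] follows the
    process that is active at x up to its next jump, or up to the time at which
    it creeps to the floor of its zone (b if x > b, otherwise 0) if this comes
    first, and it discounts at rate s; [Qop] is the mean of a step. A
    harmonic function satisfies
<<
      h(x) = E [ exp(- s chi) h(X(chi)) ],    X(chi) = 0 or X(chi) > B,
>>
    where chi is the exit time ([exit_identity]). So all that is needed are
    harmonic functions with known values at 0 and above B, and two of them are
    enough:
    - h(x) = K_{b-x}(B - b) vanishes above B ([hit_fun]), which gives
      h(x) = h(0) V(s), V being the transform for the lower boundary. Here h(0)
      is not 0: otherwise h = 0, whereas h(B) = 1 / a2.
    - e(x) = Re (w K_{b-x}(z, s)), with the gothic K of the statement taken at
      u = B - b, equals Re (w exp(- z (x - B))) above B ([exit_fun]). The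
      combination e - (e(0) / h(0)) h vanishes at 0 and gives the transform
      for the upper boundary: w = 1 and w = -i yield its real and imaginary
      parts, and z = 0 the transform of the time alone.

    Why these functions are harmonic. The Laplace transform of a resolvent r
    says that r solves a renewal equation ([resolvent_eq]), and this equation is
    one step of the process, read along a path that moves down: the function
    r(c - x) of x is harmonic, except for a defect when the path passes the
    level c ([Qop_resolvent]). The exponential function exp(- z x) has
    the defect k(z) - s, spread over the levels passed ([Qop_exp_fun]). It is
    compensated by a mixture of resolvents over all levels up to B, and the
    result is the function C1. As for K, the quotient (k1 - s) / (k2 - s) is
    a constant plus a Laplace transform, so K_{b-x}(v) is a mixture of
    resolvents of the first process at levels above b ([K_representation]),
    which is harmonic below b; and for x >= b it is the resolvent of the second
    process at level b + v ([K_nonpos]), harmonic above b if v = B - b.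
    Identities between transforms become identities between functions by a
    uniqueness theorem for real arguments ([lap_inj]).

    Why harmonic functions give the means at exit. The path, observed at jumps
    and at creeping times, is a chain that reads one inter-arrival time and one
    jump in each step ([chain]). All of these clocks are independent, so those
    used in a step can be integrated out with the later ones frozen ([freeze]),
    and the mean of the chain after N steps is the N-fold iterate of the
    one-step operator ([Rintegral_chain]); it is constant in N for a harmonic
    function. In each step a long inter-arrival time brings the path to its
    floor with a probability bounded away from 0, so that the chain is absorbed
    almost surely ([ae_exit]). From then on its value is the discounted payoff
    at the exit of the path, for almost every path ([payoff_chain]), and
    dominated convergence concludes. *)

(** * Lebesgue integrals of real functions *)

Section affine_change.
Context {R : realType}.
Local Notation mu := (@lebesgue_measure R).
Local Open Scope ereal_scope.

Lemma measurable_affine (al be : R) :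
  measurable_fun [set: measurableTypeR R]
    ((fun x => al * x + be)%R : measurableTypeR R -> measurableTypeR R).
Proof. by apply: measurable_funD => //; apply: measurable_funM. Qed.

(** Both sides are measures in A, so that it is enough to compare them on
    half-open intervals; the sign of the slope decides which end of the
    preimage is open, and uniqueness of the Lebesgue measure is therefore used
    with the scaled pushforward. *)
Lemma lebesgue_measure_affine (al be : R) (A : set R) : al != 0%R ->
  measurable A ->
  mu ((fun x => al * x + be)%R @^-1` A) = (`|al|^-1)%:E * mu A.
Proof.
move=> al0 mA.
have nal0 : (0 <= `|al|)%R by [].
pose phi : measurableTypeR R -> measurableTypeR R := (fun x => al * x + be)%R.
have mphi : measurable_fun setT phi by exact: measurable_affine.
pose nu := mscale (NngNum nal0) (pushforward mu phi).
suff -> : mu A = nu mphi A.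
  by rewrite /nu /mscale/= muleA -EFinM mulVf ?normr_eq0// mul1e.
apply: lebesgue_measure_unique => //= _ [[a b]] _ <-.
rewrite /nu /mscale /= -[pushforward mu phi _]/(mu (phi @^-1` `]a, b]%classic)).
have [al_gt0|al_lt0|al_eq0] := ltgtP al 0%R; last by rewrite al_eq0 eqxx in al0.
- have -> : phi @^-1` `]a, b]%classic = `[((b - be) / al)%R, ((a - be) / al)%R[%classic.
    apply/seteqP; split => x /=; rewrite !in_itv/= /phi.
      rewrite ler_ndivrMr// ltr_ndivlMr// lerBrDr ltrBlDr (mulrC x).
      by rewrite andbC.
    rewrite ler_ndivrMr// ltr_ndivlMr// lerBrDr ltrBlDr (mulrC x).
    by rewrite andbC.
  rewrite !lebesgue_measure_itv/= !lte_fin ltr_nM2r ?invr_lt0//.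
  rewrite ltrD2r; case: ifPn; rewrite ?mule0// => ab.
  rewrite -!EFinB -EFinM; congr EFin; rewrite ltr0_norm//.
  by field.
- have -> : phi @^-1` `]a, b]%classic = `]((a - be) / al)%R, ((b - be) / al)%R]%classic.
    apply/seteqP; split => x /=; rewrite !in_itv/= /phi.
      by rewrite ltr_pdivrMr// ler_pdivlMr// ltrBlDr lerBrDr (mulrC x).
    by rewrite ltr_pdivrMr// ler_pdivlMr// ltrBlDr lerBrDr (mulrC x).
  rewrite !lebesgue_measure_itv/= !lte_fin ltr_pM2r ?invr_gt0//.
  rewrite ltrD2r; case: ifPn; rewrite ?mule0// => ab.
  rewrite -!EFinB -EFinM; congr EFin; rewrite gtr0_norm//.
  by field.
Qed.

Lemma ge0_integral_affine (al be : R) (f : R -> \bar R) : al != 0%R ->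
  measurable_fun setT f -> (forall x, 0 <= f x) ->
  \int[mu]_x f (al * x + be)%R = (`|al|^-1)%:E * \int[mu]_x f x.
Proof.
move=> al0 mf f0.
have nal0 : (0 <= `|al|^-1)%R by rewrite invr_ge0.
transitivity (\int[pushforward mu
    ((fun x => al * x + be)%R : measurableTypeR R -> measurableTypeR R)]_x f x).
  by rewrite ge0_integral_pushforward//; exact: measurable_affine.
rewrite (eq_measure_integral (mscale (NngNum nal0) mu)).
  by rewrite ge0_integral_mscale.
  exact: measurable_affine.
by move=> ? A mA _; exact: lebesgue_measure_affine.
Qed.

Lemma integrable_affine (al be : R) (f : R -> R) : al != 0%R ->
  mu.-integrable setT (EFin \o f) ->
  mu.-integrable setT (EFin \o (fun x => f (al * x + be)%R)).
Proof.
move=> al0 /integrableP[mf foo]; apply/integrableP; split.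
  apply: (measurableT_comp mf).
  exact: measurable_affine.
have := @ge0_integral_affine al be (abse \o (EFin \o f)) al0.
rewrite /= => -> //; last exact: measurableT_comp.
by rewrite lte_mul_pinfty// lee_fin invr_ge0.
Qed.

(** The nonzero factor preserves the cases in which the integral of the positive
    or of the negative part is infinite, whence the identity holds for every
    measurable f. *)
Lemma Rintegral_affine (al be : R) (f : R -> R) : al != 0%R ->
  measurable_fun setT f ->
  (\int[mu]_x f (al * x + be) = `|al|^-1 * \int[mu]_x f x)%R.
Proof.
move=> al0 mf; rewrite /Rintegral integralE [in RHS]integralE.
have e g : measurable_fun setT g -> (forall x, 0 <= g x) ->
  \int[mu]_x g (al * x + be)%R = (`|al|^-1)%:E * \int[mu]_x g x.
  exact: ge0_integral_affine.
have mfp : measurable_fun setT ((EFin \o f)^\+) by exact/measurable_funepos/measurable_EFinP.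
have mfn : measurable_fun setT ((EFin \o f)^\-) by exact/measurable_funeneg/measurable_EFinP.
have ep := e _ mfp (fun x => funepos_ge0 _ x).
have en := e _ mfn (fun x => funeneg_ge0 _ x).
pose X := \int[mu]_x ((EFin \o f)^\+) x; pose Y := \int[mu]_x ((EFin \o f)^\-) x.
transitivity (fine ((`|al|^-1)%:E * X - (`|al|^-1)%:E * Y)).
  rewrite /X /Y -ep -en; congr (fine (_ - _)).
    by apply: eq_integral => x _; rewrite !funeposE.
  by apply: eq_integral => x _; rewrite !funenegE.
transitivity (`|al|^-1 * fine (X - Y))%R; last by [].
have al0' : (0 < `|al|^-1)%R by rewrite invr_gt0 normr_gt0.
have : 0 <= X by apply: integral_ge0 => x _; exact: funepos_ge0.
have : 0 <= Y by apply: integral_ge0 => x _; exact: funeneg_ge0.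
case: Y => [y||//] y0; case: X => [x||//] x0 //=;
  rewrite ?gt0_muley ?lte_fin//= ?mulr0//.
by rewrite mulrBr.
Qed.

End affine_change.

Section integrable_EFin.
Context d (T : measurableType d) (R : realType).
Variables (mu : {measure set T -> \bar R}) (D : set T) (mD : measurable D).

Lemma integrable_scale (c : R) (f : T -> R) :
  mu.-integrable D (EFin \o f) -> mu.-integrable D (EFin \o (fun x => c * f x)).
Proof.
move=> fi; apply: (@eq_integrable _ _ _ mu D mD _ _ _ (integrableZl mD c fi)).
by move=> x _ /=; rewrite EFinM.
Qed.

Lemma integrable_add (f g : T -> R) :
  mu.-integrable D (EFin \o f) -> mu.-integrable D (EFin \o g) ->
  mu.-integrable D (EFin \o (fun x => f x + g x)).
Proof.
move=> fi gi; apply: (@eq_integrable _ _ _ mu D mD _ _ _ (integrableD mD fi gi)).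
by move=> x _ /=; rewrite EFinD.
Qed.

Lemma integrable_sub (f g : T -> R) :
  mu.-integrable D (EFin \o f) -> mu.-integrable D (EFin \o g) ->
  mu.-integrable D (EFin \o (fun x => f x - g x)).
Proof.
move=> fi gi; apply: (@eq_integrable _ _ _ mu D mD _ _ _ (integrableB mD fi gi)).
by move=> x _ /=; rewrite EFinB.
Qed.

Lemma integrable_dominated (f g : T -> R) : measurable_fun D f ->
  (forall x, D x -> `|f x| <= g x) -> mu.-integrable D (EFin \o g) ->
  mu.-integrable D (EFin \o f).
Proof.
move=> mf fg gi; apply: le_integrable gi => //; first exact/measurable_EFinP.
by move=> x Dx /=; rewrite lee_fin (le_trans (fg _ Dx))// ler_norm.
Qed.

Lemma integrable_measurable (f : T -> R) :
  mu.-integrable D (EFin \o f) -> measurable_fun D f.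
Proof. by move=> fi; apply/measurable_EFinP; exact: measurable_int fi. Qed.

End integrable_EFin.

Section real_fubini.
Context {R : realType} d1 d2 (T1 : measurableType d1) (T2 : measurableType d2).
Variables (m1 : {sigma_finite_measure set T1 -> \bar R}).
Variables (m2 : {sigma_finite_measure set T2 -> \bar R}).

(** The form in which the hypothesis of Fubini's theorem is checked throughout:
    a kernel dominated by a product of integrable functions. *)
Lemma integrable_product (p : T1 -> R) (q : T2 -> R) (f : T1 * T2 -> R) :
  m1.-integrable setT (EFin \o p) -> m2.-integrable setT (EFin \o q) ->
  measurable_fun setT f ->
  (forall x y, `|f (x, y)| <= p x * q y) ->
  (m1 \x m2)%E.-integrable setT (EFin \o f).
Proof.
move=> ip iq mf fpq; apply/integrable12ltyP; first exact/measurable_EFinP.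
have /measurable_EFinP mp := measurable_int _ ip.
have /measurable_EFinP mq := measurable_int _ iq.
have mE : measurable_fun setT (EFin \o f) by exact/measurable_EFinP.
apply: (@le_lt_trans _ _
    (\int[m1]_x (`|p x|%:E * \int[m2]_y `|(q y)%:E|))%E).
  apply: ge0_le_integral => //.
  - by move=> x _; exact: integral_ge0.
  - apply: (@measurable_fun_fubini_tonelli_F _ _ _ _ _ m2 (abse \o (EFin \o f))) => //=.
    by apply: measurableT_comp.
  - apply: emeasurable_funM => //.
    by apply/measurable_EFinP; apply: measurableT_comp.
  - move=> x _; rewrite -ge0_integralZl//; last by apply/measurable_EFinP; do 2 apply: measurableT_comp => //.
    apply: ge0_le_integral => //.
    + apply: measurableT_comp => //.
      by apply: (measurableT_comp mE); exact: measurable_pair1.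
    + apply: emeasurable_funM => //.
      by apply/measurable_EFinP; apply: measurableT_comp.
    + move=> y _; rewrite -EFinM lee_fin -normrM.
      by rewrite (le_trans (fpq _ _))// ler_norm.
rewrite ge0_integralZr//; last by apply: integral_ge0.
  move/integrableP : ip => [_ ip]; move/integrableP : iq => [_ iq].
  by apply: lte_mul_pinfty => //; rewrite ?integral_ge0// ge0_fin_numE ?integral_ge0.
by apply/measurable_EFinP; apply: measurableT_comp.
Qed.

Variable f : T1 * T2 -> R.
Hypothesis intf : (m1 \x m2)%E.-integrable setT (EFin \o f).

Let mF : measurable_fun setT (fun x => \int[m2]_y f (x, y)).
Proof.
apply: (measurableT_comp (@fine_measurable R setT measurableT)).
have := measurable_fubini_F intf; exact.
Qed.

Lemma integrable_Rintegral1 :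
  m1.-integrable setT (EFin \o (fun x => \int[m2]_y f (x, y))).
Proof.
apply: (le_integrable _ _ _ (integrable_fubini_F intf)) => //.
  exact/measurable_EFinP.
move=> x _ /=; rewrite /fubini_F /Rintegral /=.
by case: (\int[m2]_y _)%E => //= *; rewrite ?normr0 ?leey.
Qed.

Lemma Rintegral12 :
  \int[m1]_x \int[m2]_y f (x, y) = \int[(m1 \x m2)%E]_z f z.
Proof.
rewrite /Rintegral; congr fine.
rewrite -(integral12_prod_meas1 intf) /fubini_F.
apply: ae_eq_integral => //.
- exact/measurable_EFinP.
- exact: measurable_fubini_F intf.
have := integrable_ae measurableT (integrable_fubini_F intf).
apply: filterS => x xfin _ /=.
by rewrite fineK//; exact: xfin.
Qed.

Let mG : measurable_fun setT (fun y => \int[m1]_x f (x, y)).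
Proof.
apply: (measurableT_comp (@fine_measurable R setT measurableT)).
have := measurable_fubini_G intf; exact.
Qed.

Let integrable_fubini_G : m2.-integrable setT (fubini_G m1 (EFin \o f)).
Proof.
have mf := measurable_int _ intf.
apply/integrableP; split; first exact: measurable_fubini_G intf.
apply: (@le_lt_trans _ _ (\int[m2]_y \int[m1]_x `|(f (x, y))%:E|)%E); last first.
  have [+ _] := @integrable21ltyP _ _ _ _ _ m1 m2 _ mf.
  exact.
have ma : measurable_fun setT (abse \o (EFin \o f)) by exact: measurableT_comp.
apply: ge0_le_integral => //.
- by apply: measurableT_comp => //; exact: measurable_fubini_G intf.
- by apply: (measurable_fun_fubini_tonelli_G (m1:=m1) (abse \o (EFin \o f))) => //=.
- move=> y _; apply: le_abse_integral => //.
  by apply: (measurableT_comp mf); exact: measurable_pair2.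
Qed.

Lemma Rintegral21 :
  \int[m2]_y \int[m1]_x f (x, y) = \int[(m1 \x m2)%E]_z f z.
Proof.
rewrite /Rintegral; congr fine.
rewrite -(integral21_prod_meas1 intf) /fubini_G.
apply: ae_eq_integral => //.
- exact/measurable_EFinP.
- exact: measurable_fubini_G intf.
have := integrable_ae measurableT integrable_fubini_G.
apply: filterS => x xfin _ /=.
by rewrite fineK//; exact: xfin.
Qed.

Lemma Rintegral_exchange :
  \int[m1]_x \int[m2]_y f (x, y) = \int[m2]_y \int[m1]_x f (x, y).
Proof. by rewrite Rintegral12 Rintegral21. Qed.

End real_fubini.


Lemma integrable_bounded d (T : measurableType d) (R : realType)
    (m : {finite_measure set T -> \bar R}) (f : T -> R) (C : R) :
  measurable_fun setT f -> (forall x, `|f x| <= C) ->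
  m.-integrable setT (EFin \o f).
Proof.
move=> mf fC.
have := finite_measure_integrable_cst m C measurableT.
apply: le_integrable => //; first exact/measurable_EFinP.
by move=> x _ /=; rewrite lee_fin (le_trans (fC x))// ler_norm.
Qed.

Section density.
Context {R : realType} d (T : measurableType d).
Variables (nu m : {measure set T -> \bar R}) (g : T -> R).
Hypothesis g0 : forall x, 0 <= g x.
Hypothesis mg : measurable_fun setT g.
Hypothesis nuE : forall A, measurable A -> nu A = (\int[m]_(x in A) (g x)%:E)%E.
Local Open Scope ereal_scope.
Import HBNNSimple.

(** The law of an exponential variable is known only through its values on
    sets; this is the passage from sets to functions, by approximation with
    simple functions. *)
Lemma ge0_integral_density (f : T -> \bar R) : measurable_fun setT f ->
  (forall x, 0 <= f x) -> \int[nu]_x f x = \int[m]_x (f x * (g x)%:E).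
Proof.
move=> mf f0; pose f_ := nnsfun_approx measurableT mf.
have mge : measurable_fun setT (EFin \o g) by exact/measurable_EFinP.
have sf (h : {nnsfun T >-> R}) :
    \int[nu]_x (h x)%:E = \int[m]_x ((h x)%:E * (g x)%:E).
  under eq_integral do rewrite fimfunE -fsumEFin//.
  rewrite ge0_integral_fsum//; last 2 first.
  - by move=> y; exact/measurable_EFinP/measurable_funM.
  - by move=> y x _; rewrite nnfun_muleindic_ge0.
  under [RHS]eq_integral.
    move=> x _; rewrite fimfunE -fsumEFin// ge0_mule_fsuml; last first.
      by move=> r; rewrite nnfun_muleindic_ge0.
    over.
  rewrite [RHS]ge0_integral_fsum//; last 2 first.
  - by move=> y; apply: emeasurable_funM => //; exact/measurable_EFinP/measurable_funM.
  - move=> y x _; apply: mule_ge0; last by rewrite lee_fin.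
    by rewrite EFinM nnfun_muleindic_ge0.
  apply: eq_fsbigr => r _; rewrite integralZl_indic_nnsfun// integral_indic//= setIT.
  rewrite nuE//.
  have [r0|r0] := ltP r 0%R.
    rewrite preimage_nnfun0//.
    under [RHS]eq_integral do rewrite indic0 mulr0 mul0e.
    by rewrite integral0 integral_set0 mule0.
  under [RHS]eq_integral do rewrite EFinM -muleA.
  rewrite ge0_integralZl//.
  - congr (_ * _); rewrite [LHS]integral_mkcond; apply: eq_integral => x _.
    rewrite epatch_indic/= muleC//.
  - by apply: emeasurable_funM => //; exact/measurable_EFinP.
  - by move=> x _; rewrite mule_ge0// lee_fin.
transitivity (limn (fun n => \int[nu]_x (f_ n x)%:E)).
  rewrite -monotone_convergence//.
  - apply: eq_integral => y _; apply/esym/cvg_lim => //.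
    by apply: cvg_nnsfun_approx.
  - by move=> n; exact/measurable_EFinP/measurable_funP.
  - by move=> n y _; rewrite lee_fin.
  - by move=> y _ m' n mn; rewrite lee_fin; exact/lefP/nd_nnsfun_approx.
under eq_fun do rewrite sf.
rewrite -monotone_convergence//.
- apply: eq_integral => y _; apply/cvg_lim => //.
  by apply: cvgeZr => //; exact: cvg_nnsfun_approx.
- by move=> n; apply: emeasurable_funM => //; exact/measurable_EFinP/measurable_funP.
- by move=> n y _; rewrite mule_ge0 ?lee_fin.
- move=> y _ m' n mn; rewrite lee_wpmul2r ?lee_fin//.
  exact/lefP/nd_nnsfun_approx.
Qed.

Lemma Rintegral_density (f : T -> R) : measurable_fun setT f ->
  (\int[nu]_x f x = \int[m]_x (f x * g x))%R.
Proof.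
move=> mf; rewrite /Rintegral; congr fine.
rewrite integralE [RHS]integralE; congr (_ - _).
  rewrite ge0_integral_density//.
  - apply: eq_integral => x _; rewrite !funeposE -!EFin_max -EFinM.
    by rewrite maxr_pMl// mul0r.
  - exact/measurable_funepos/measurable_EFinP.
rewrite ge0_integral_density//.
- apply: eq_integral => x _; rewrite !funenegE -!EFinN -!EFin_max -EFinM.
  by rewrite maxr_pMl// mul0r mulNr.
- exact/measurable_funeneg/measurable_EFinP.
Qed.
End density.

Section Rdominated.
Context d (T : measurableType d) (R : realType).
Variables (mu : {measure set T -> \bar R}) (D : set T) (mD : measurable D).
Variables (f_ : nat -> T -> R) (f g : T -> R).
Hypothesis mf_ : forall n, measurable_fun D (f_ n).
Hypothesis f_f : forall x, D x -> f_ ^~ x @ \oo --> f x.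
Hypothesis ig : mu.-integrable D (EFin \o g).
Hypothesis f_g : forall n x, D x -> `|f_ n x| <= g x.

Lemma Rdominated_convergence :
  mu.-integrable D (EFin \o f) /\
  (fun n => \int[mu]_(x in D) f_ n x) @ \oo --> \int[mu]_(x in D) f x.
Proof.
have [|||||] := @dominated_convergence _ _ _ mu D mD (fun n => EFin \o f_ n)
  (EFin \o f) (EFin \o g).
- by move=> n; exact/measurable_EFinP.
- by apply/measurable_EFinP; exact: measurable_fun_cvg mf_ f_f.
- apply/aeW => x Dx; apply: cvg_EFin; first by apply: nearW.
  exact: f_f.
- exact: ig.
- by apply/aeW => x n Dx /=; rewrite lee_fin f_g.
move=> intf _ h; split => //.
have ifin := integrable_fin_num mD intf.
by apply: fine_cvg; rewrite fineK.
Qed.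
End Rdominated.

(** The payoff of a path is a function on the probability space that is not
    known to be measurable. The integral of an arbitrary function is a supremum
    over simple functions below it, and cutting a simple function off on a null
    set does not change its integral; hence null sets can be ignored for such
    functions too. *)
Section null_sets.
Context {R : realType} d (T : measurableType d) (mu : {measure set T -> \bar R}).
Variables (N : set T) (mN : measurable N) (N0 : mu N = 0%E).
Import HBNNSimple.

Let sup_le (f g : T -> \bar R) : (forall x, 0 <= g x)%E ->
  (forall x, ~ N x -> f x = g x) ->
  (ereal_sup [set sintegral mu h |
     h in [set h : {nnsfun T >-> R} | forall x, (h x)%:E <= f x]] <=
   ereal_sup [set sintegral mu h |
     h in [set h : {nnsfun T >-> R} | forall x, (h x)%:E <= g x]])%E.
Proof.
move=> g0 fg; apply: ge_ereal_sup => _ [h /= hf <-].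
have mCN := measurableC mN; apply: ereal_sup_ubound; exists (proj_nnsfun h mCN).
  move=> x /=; rewrite mindicE; have [Nx|Nx] := pselect (N x).
    by rewrite memNset ?mulr0// => /(_ Nx).
  by rewrite mem_set ?mulr1// -fg.
rewrite -!integralT_nnsfun; apply: ae_eq_integral => //.
- by apply/measurable_EFinP; exact: measurable_funP.
- by apply/measurable_EFinP; exact: measurable_funP.
exists N; split => // x /= hx; apply: contrapT => Nx; apply: hx => _ /=.
by rewrite mindicE mem_set ?mulr1.
Qed.

Lemma null_set_integral (f g : T -> \bar R) : (forall x, ~ N x -> f x = g x) ->
  (\int[mu]_x f x = \int[mu]_x g x)%E.
Proof.
move=> fg; rewrite /integral; congr (_ - _)%E; apply/eqP; rewrite eq_le;
  apply/andP; split; apply: sup_le => // x Nx;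
  by rewrite ?(funepos_ge0, funeneg_ge0)// ?funeposE ?funenegE !patchE in_setT fg.
Qed.

Lemma null_set_Rintegral (f g : T -> R) : (forall x, ~ N x -> f x = g x) ->
  \int[mu]_x f x = \int[mu]_x g x.
Proof.
by move=> fg; congr fine; apply: null_set_integral => x Nx; rewrite fg.
Qed.
End null_sets.

(** How the mean of a payoff is computed: outside a null set it is the eventual
    value of a bounded sequence of measurable functions, and dominated
    convergence applies to that sequence. *)
Lemma Rintegral_eventually_eq {R : realType} d (T : measurableType d)
    (P : probability T R) (N : set T) (f_ : nat -> T -> R) (f : T -> R) (C I : R) :
  measurable N -> P N = 0%E ->
  (forall n, measurable_fun setT (f_ n)) -> (forall n x, `|f_ n x| <= C) ->
  (forall x, ~ N x -> \forall n \near \oo, f_ n x = f x) ->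
  \int[P]_x f_ n x @[n --> \oo] --> I -> \int[P]_x f x = I.
Proof.
move=> mN N0 mf fC fE fI.
pose g_ n := f_ n \_ (~` N); pose g := f \_ (~` N).
have gg x : g_ n x @[n --> \oo] --> g x.
  rewrite /g_ /g /patch; case: ifPn => [/set_mem Nx|_]; last exact: cvg_cst.
  by apply: cvg_near_cst; apply: filterS (fE x Nx) => n ->.
have mCN := measurableC mN.
have mg n : measurable_fun setT (g_ n).
  by apply: (proj1 (measurable_restrictT _ mCN)); exact: measurable_funTS.
have gC n x : `|g_ n x| <= C.
  rewrite /g_ /patch; case: ifP => _ //; rewrite normr0.
  exact: le_trans (fC n x).
have iC : P.-integrable setT (EFin \o cst C) by exact: finite_measure_integrable_cst.
have [_ gI] := Rdominated_convergence measurableT (fun n => measurable_funTS (mg n))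
  (fun x _ => gg x) iC (fun n x _ => gC n x).
rewrite (null_set_Rintegral mN N0 (g := g)); last first.
  by move=> x Nx; rewrite /g patchE mem_set.
apply: (cvg_unique _ gI) => //.
suff -> : (fun n => \int[P]_x g_ n x) = (fun n => \int[P]_x f_ n x) by [].
apply/funext => n; apply: (null_set_Rintegral mN N0) => x Nx.
by rewrite /g_ patchE mem_set.
Qed.

(** * Uniqueness of Laplace transforms *)

(** Let the integrals of exp(-k u) h(u) vanish for all natural numbers k. For
    integers m the function exp(-exp(m (t - u))) of u is a power series in
    exp(-m u), whence its integral against h vanishes too. As m grows, it tends
    to the indicator function of the half-line above t. Thus all the integrals
    of h over intervals vanish, and right continuity gives h = 0. The section
    proves the inequality h <= 0, from which the other one follows by
    symmetry. *)
Section laplace_uniqueness.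
Context {R : realType}.
Local Notation mu := (@lebesgue_measure R).
Local Notation D := (`[0, +oo[%classic : set R).

Let mD : measurable D. Proof. exact: measurable_itv. Qed.

Let kern (m : nat) (t u : R) : R := expR (- expR (m%:R * (t - u))).

Let lim_kern (t u : R) : R :=
  if t < u then 1 else if u == t then expR (- 1) else 0.

Let kern_cvg t u : kern m t u @[m --> \oo] --> lim_kern t u.
Proof.
rewrite /kern /lim_kern; have [tu|ut|->] := ltgtP t u.
- rewrite -[X in _ --> X]expR0 -oppr0.
  apply: continuous_cvg; first exact: continuous_expR.
  apply: cvgN.
  have -> : (fun m : nat => expR (m%:R * (t - u))) = (fun m => expR (t - u) ^+ m).
    by apply/funext => m; rewrite expRM_natl.
  by apply: cvg_expr; rewrite ger0_norm ?expR_ge0// expR_lt1 subr_lt0.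
- apply: (@squeeze_cvgr _ _ _ _ (cst 0) (fun m : nat => expR (- (t - u)) ^+ m)).
  + apply: nearW => m; rewrite /= expR_ge0 /= -expRM_natl ler_expR mulrN lerN2.
    by have := expR_ge1Dx (m%:R * (t - u)); lra.
  + exact: cvg_cst.
  + apply: cvg_expr; rewrite ger0_norm ?expR_ge0// expR_lt1; lra.
- by under eq_fun do rewrite subrr mulr0 expR0; exact: cvg_cst.
Qed.

Variable h : R -> R.
Hypothesis inth : mu.-integrable D (EFin \o h).
Hypothesis h0 : forall k : nat, \int[mu]_(u in D) (expR (- (k%:R * u)) * h u) = 0.

Let mh : measurable_fun D h.
Proof. by apply/measurable_EFinP; exact: measurable_int inth. Qed.

Let integrable_expMh k :
  mu.-integrable D (EFin \o (fun u => expR (- (k%:R * u)) * h u)).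
Proof.
apply: (le_integrable _ _ _ inth) => //.
  apply/measurable_EFinP; apply: measurable_funM => //.
  by apply: measurableT_comp => //; apply: measurable_funN; apply: measurable_funM.
move=> u /=; rewrite in_itv/= andbT => u0.
rewrite lee_fin normrM ler_piMl// ger0_norm ?expR_ge0//.
by rewrite -expR0 ler_expR oppr_le0 mulr_ge0.
Qed.

Let S m t n u := series (exp_coeff (- expR (m%:R * (t - u)))) n * h u.

Let S_int m t n : mu.-integrable D (EFin \o S m t n) /\
  \int[mu]_(u in D) S m t n u = 0.
Proof.
elim: n => [|n [IHi IH0]].
  have -> : S m t 0 = cst 0.
    by apply/funext => u; rewrite /S /series /= big_geq// mul0r.
  by split; [exact: integrable0|rewrite Rintegral_cst// mul0r].
pose c := (- 1) ^+ n / n`!%:R * expR ((n * m)%:R * t).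
have SE : S m t n.+1 = (fun u => S m t n u + c * (expR (- ((n * m)%:R * u)) * h u)).
  apply/funext => u; rewrite /S seriesSr mulrDl; congr (_ + _).
  rewrite mulrA; congr (_ * _); rewrite /exp_coeff /= exprNn.
  rewrite -expRM_natl /c natrM.
  have -> : expR (n%:R * (m%:R * (t - u))) =
      expR (n%:R * m%:R * t) * expR (- (n%:R * m%:R * u)).
    by rewrite -expRD; congr expR; ring.
  by rewrite -!mulrA; congr (_ * _); rewrite mulrA mulrC.
have ci : mu.-integrable D (EFin \o (fun u => c * (expR (- ((n * m)%:R * u)) * h u))).
  exact: integrable_scale (integrable_expMh (n * m)%N).
rewrite SE; split.
  exact: integrable_add.
rewrite RintegralD// IH0 add0r RintegralZl//.
  by rewrite (h0 (n * m)%N) mulr0.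
Qed.

Let kern_int0 m t : \int[mu]_(u in D) (kern m t u * h u) = 0.
Proof.
have inte : mu.-integrable D
    (EFin \o (fun u => expR (expR (m%:R * t)) * `|h u|)).
  exact: integrable_scale (integrable_norm inth).
have [|||_] := @Rdominated_convergence _ _ _ mu D mD (S m t) (fun u => kern m t u * h u) _ _ _ inte.
- by move=> n; apply/measurable_EFinP; apply: measurable_int (S_int m t n).1.
- move=> u _; apply: cvgM; last exact: cvg_cst.
  exact: is_cvg_series_exp_coeff.
- move=> n u /=; rewrite in_itv/= andbT => u0.
  rewrite /S normrM ler_wpM2r//.
  apply: (@le_trans _ _ (series (exp_coeff (expR (m%:R * (t - u)))) n)).
    rewrite /series /= (le_trans (ler_norm_sum _ _ _))// ler_sum// => k _.
    by rewrite /exp_coeff /= normrM normrX normrN ger0_norm ?expR_ge0// ger0_norm.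
  apply: (@le_trans _ _ (expR (expR (m%:R * (t - u))))).
    apply: nondecreasing_cvgn_le; last exact: is_cvg_series_exp_coeff.
    apply: nondecreasing_series => k _ _; apply: exp_coeff_ge0; exact: expR_ge0.
  by rewrite !ler_expR ler_wpM2l// lerBlDr lerDl.
rewrite (_ : (fun n => _) = cst 0); last by apply/funext => n; exact: (S_int m t n).2.
by move=> /cvg_lim; rewrite lim_cst// => /(_ _)<-.
Qed.

Let lim_kern_int t : mu.-integrable D (EFin \o (fun u => lim_kern t u * h u)) /\
  \int[mu]_(u in D) (lim_kern t u * h u) = 0.
Proof.
have [|||] := @Rdominated_convergence _ _ _ mu D mD
    (fun m u => kern m t u * h u) (fun u => lim_kern t u * h u) _ _ _ (integrable_norm inth).
- move=> m; apply: measurable_funM => //.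
  apply: measurableT_comp => //; apply: measurable_funN.
  apply: measurableT_comp => //; apply: measurable_funM => //.
  exact: measurable_funB.
- by move=> u _; apply: cvgM; [exact: kern_cvg|exact: cvg_cst].
- move=> n u _; rewrite normrM ler_piMl// ger0_norm ?expR_ge0//.
  by rewrite -expR0 ler_expR oppr_le0 expR_ge0.
move=> ? c; split => //; move: c.
rewrite (_ : (fun n => _) = cst 0); last by apply/funext => n; exact: kern_int0.
by move=> /cvg_lim; rewrite lim_cst// => /(_ _)<-.
Qed.

Hypothesis rch : forall x, 0 <= x -> h t @[t --> x^'+] --> h x.

Lemma moments0_le0 (t : R) : 0 <= t -> h t <= 0.
Proof.
move=> t0; rewrite leNgt; apply/negP => ht.
have /(cvgr_gt (h t)) /(_ (h t / 2)) [|e /= e0 He] := rch t0.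
  by lra.
(* If h t > 0, then h exceeds h t / 2 on some interval [t, t2]. There, up to the
   constant c, it is dominated by h times the difference of the limit kernels at
   t and t2, and the integral of the latter is 0. At the points t and t2 the
   limit kernels take the value exp(-1), which is why c is below both exp(-1)
   and 1 - exp(-1). *)
pose t2 := t + e / 2.
pose c := expR (- 1) * (1 - expR (- 1)) : R.
have e1 : 0 < expR (- 1) :> R by exact: expR_gt0.
have e2 : expR (- 1) < 1 :> R by rewrite expR_lt1; lra.
have c0 : 0 < c by rewrite mulr_gt0// subr_gt0.
have [i1 I1] := lim_kern_int t; have [i2 I2] := lim_kern_int t2.
have iA : mu.-integrable D (EFin \o (\1_(`[t, t2]%classic : set R) : R -> R)).
  apply: (@integrableS _ _ _ mu setT) => //.
  exact: integrable_indic_itv.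
have : \int[mu]_(u in D) (c * (h t / 2) * \1_(`[t, t2]%classic : set R) u) <=
  \int[mu]_(u in D) (lim_kern t u * h u - lim_kern t2 u * h u).
  apply: le_Rintegral => //.
  - exact: integrable_scale.
  - exact: integrable_sub.
  - move=> u; rewrite /= in_itv/= andbT => u0; rewrite -mulrBl indicE /lim_kern.
    have Hu : t <= u <= t2 -> h t / 2 <= h u.
      move=> /andP[]; rewrite le_eqVlt => /orP[/eqP <- _|tu ut2]; first by lra.
      apply/ltW/He => //=; rewrite /ball/= ltr_norml; rewrite /t2 in ut2.
      by apply/andP; split; lra.
    have tt2 : t < t2 by rewrite /t2 ltrDl divr_gt0.
    case: (boolP (u \in _)) => [|].
      rewrite inE/= in_itv/= => utt2; have := Hu utt2; move: utt2 => /andP[tu ut2] hu.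
      have hu0 : 0 <= h u by lra.
      rewrite mulr1 (@le_trans _ _ (c * h u))// ?ler_wpM2l ?(ltW c0)// ler_wpM2r//.
      have c1 : c <= expR (- 1) by rewrite /c ler_piMr ?gerBl ?(ltW e1).
      have c2 : c <= 1 - expR (- 1) by rewrite /c ler_piMl ?subr_ge0 ?(ltW e2).
      rewrite (ltNge t2 u) ut2 /=; move: tu; rewrite le_eqVlt => /orP[/eqP tu|tu].
        by rewrite -tu ltxx eqxx (lt_eqF tt2) subr0.
      rewrite tu; case: ifP => // _; rewrite subr0; exact: (le_trans c1 (ltW e2)).
    rewrite notin_setE/= in_itv/= => /negP; rewrite negb_and -!ltNge mulr0 => /orP[ut|t2u].
      have ut2 := lt_trans ut tt2.
      by rewrite !ltNge !(ltW ut) !(ltW ut2) (lt_eqF ut) (lt_eqF ut2) subrr mul0r.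
    by rewrite t2u (lt_trans tt2 t2u) subrr mul0r.
rewrite RintegralB// I1 I2 subrr RintegralZl// leNgt => /negP; apply.
rewrite mulr_gt0//; first by rewrite mulr_gt0//; lra.
rewrite /Rintegral integral_indic// setIidl; last first.
  by move=> u /=; rewrite !in_itv/= andbT => /andP[+ _]; exact: le_trans.
have E : mu `[t, t2]%classic = (t2 - t)%:E.
  by rewrite [LHS]lebesgue_measure_itv/= lte_fin ifT// /t2 ltrDl divr_gt0.
by rewrite [ltRHS](congr1 fine E : _ = t2 - t) subr_gt0 /t2 ltrDl divr_gt0.
Qed.

End laplace_uniqueness.

Lemma moments0_eq0 (R : realType) (h : R -> R) :
  (@lebesgue_measure R).-integrable `[0, +oo[ (EFin \o h) ->
  (forall k : nat,
    \int[lebesgue_measure]_(u in `[0, +oo[) (expR (- (k%:R * u)) * h u) = 0) ->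
  (forall x, 0 <= x -> h t @[t --> x^'+] --> h x) ->
  forall t, 0 <= t -> h t = 0.
Proof.
move=> hi h0 hrc t t0; apply/eqP; rewrite eq_le moments0_le0//=.
rewrite -oppr_le0 -mulN1r; apply: (@moments0_le0 _ (fun x => - 1 * h x)) => //.
- exact: integrable_scale.
- move=> k; under eq_Rintegral do rewrite mulrCA.
  rewrite RintegralZl// ?h0 ?mulr0//.
  apply: (integrable_dominated _ _ _ (integrable_norm hi)) => //.
    apply: measurable_funM; last exact: integrable_measurable hi.
    by apply: measurableT_comp => //; apply: measurable_funN; exact: measurable_funM.
  move=> u /=; rewrite in_itv/= andbT => u0.
  rewrite normrM ler_piMl// ger0_norm ?expR_ge0//.
  by rewrite -expR0 ler_expR oppr_le0 mulr_ge0.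
- by move=> x x0; apply: cvgM; [exact: cvg_cst|exact: hrc].
Qed.

(** * Convolutions and causal functions *)

Section bilateral_laplace.
Context {R : realType}.
Local Notation mu := (@lebesgue_measure R).
Implicit Types (f g p : R -> R) (z : R).

Definition exp_integrable (nu : {measure set (measurableTypeR R) -> \bar R}) f z :=
  nu.-integrable setT (EFin \o (fun u => expR (- (u * z)) * f u)).

Definition lap (nu : {measure set (measurableTypeR R) -> \bar R}) f z : R :=
  \int[nu]_u (expR (- (u * z)) * f u).

(** A measure nu with density p convolved with f. With nu the Lebesgue measure
    it is the usual convolution of p and f, and with nu a law of jumps and p
    the indicator function of the positive numbers it is the mean of f after a
    downward displacement by a jump. *)
Definition conv (nu : {measure set (measurableTypeR R) -> \bar R}) p f (y : R) : R :=
  \int[nu]_v (p v * f (y - v)).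

Lemma RintegralZl_gt0 d (T : measurableType d)
    (m : {measure set T -> \bar R}) (D : set T) (f : T -> R) (c : R) : 0 < c ->
  measurable D -> measurable_fun D f ->
  \int[m]_(x in D) (c * f x) = c * \int[m]_(x in D) f x.
Proof.
move=> c0 mD mf; rewrite /Rintegral integralE [in RHS]integralE.
have mfp : measurable_fun D ((EFin \o f)^\+)%E by exact/measurable_funepos/measurable_EFinP.
have mfn : measurable_fun D ((EFin \o f)^\-)%E by exact/measurable_funeneg/measurable_EFinP.
pose X := (\int[m]_(x in D) ((EFin \o f)^\+) x)%E.
pose Y := (\int[m]_(x in D) ((EFin \o f)^\-) x)%E.
transitivity (fine (c%:E * X - c%:E * Y))%E.
  rewrite /X /Y -!ge0_integralZl//; last 2 first.
    by rewrite lee_fin ltW.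
    by rewrite lee_fin ltW.
  congr (fine (_ - _)%E).
    apply: eq_integral => x _; rewrite !funeposE -!EFin_max -EFinM.
    by rewrite maxr_pMr ?mulr0// ltW.
  apply: eq_integral => x _; rewrite !funenegE -!EFinN -!EFin_max -EFinM.
  by rewrite maxr_pMr ?mulr0 ?mulrN// ltW.
transitivity (c * fine (X - Y)%E); last by [].
have : (0 <= X)%E by apply: integral_ge0 => x _; exact: funepos_ge0.
have : (0 <= Y)%E by apply: integral_ge0 => x _; exact: funeneg_ge0.
case: Y => [y||//] y0; case: X => [x||//] x0 //=;
  rewrite ?gt0_muley ?lte_fin//= ?mulr0//.
by rewrite mulrBr.
Qed.

Lemma measurable_expRM z : measurable_fun [set: R] (fun u : R => expR (- (u * z))).
Proof.
by apply: measurableT_comp => //; apply: measurable_funN; exact: measurable_funM.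
Qed.

Section convolution.
Variable nu : {sigma_finite_measure set (measurableTypeR R) -> \bar R}.
Variables (p f : R -> R) (z : R).
Hypotheses (mp : measurable_fun setT p) (mf : measurable_fun setT f).
Hypotheses (ip : exp_integrable nu p z) (jf : exp_integrable mu f z).

Let F (yv : measurableTypeR R * measurableTypeR R) : R :=
  (expR (- (yv.2 * z)) * p yv.2) *
  (expR (- ((yv.1 - yv.2) * z)) * f (yv.1 - yv.2)).

Let mF : measurable_fun setT F.
Proof.
have mpe : measurable_fun [set: R] (fun v => expR (- (v * z)) * p v).
  by apply: measurable_funM => //; exact: measurable_expRM.
have mfe : measurable_fun [set: R] (fun v => expR (- (v * z)) * f v).
  by apply: measurable_funM => //; exact: measurable_expRM.
apply: measurable_funM.
  by apply: (measurableT_comp mpe); exact: measurable_snd.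
apply: (measurableT_comp mfe).
by apply: measurable_funB; [exact: measurable_fst|exact: measurable_snd].
Qed.

Let iF : (mu \x nu)%E.-integrable setT (EFin \o F).
Proof.
have mEF : measurable_fun setT (EFin \o F) by exact/measurable_EFinP.
have [_] := @integrable21ltyP _ _ _ _ _ mu nu (EFin \o F) mEF.
apply => /=.
have mfe : measurable_fun [set: R] (fun v => (`|expR (- (v * z)) * f v|)%:E).
  apply/measurable_EFinP; apply: measurableT_comp => //.
  by apply: measurable_funM => //; exact: measurable_expRM.
have mpe : measurable_fun [set: measurableTypeR R] (fun v => (`|expR (- (v * z)) * p v|)%:E).
  apply/measurable_EFinP; apply: measurableT_comp => //.
  by apply: measurable_funM => //; exact: measurable_expRM.
rewrite (_ : (\int[nu]_y _)%E = (\int[nu]_v ((`|expR (- (v * z)) * p v|)%:E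
    * (\int[mu]_u (`|expR (- (u * z)) * f u|)%:E)))%E).
  rewrite ge0_integralZr//; last by apply: integral_ge0 => x _; rewrite lee_fin.
  have /integrableP[_ ?] := ip; have /integrableP[_ ?] := jf.
  apply: lte_mul_pinfty; rewrite ?integral_ge0//.
  by rewrite ge0_fin_numE ?integral_ge0.
apply: eq_integral => v _.
have := @ge0_integral_affine R 1 (- v) (fun u => (`|expR (- (u * z)) * f u|)%:E).
rewrite oner_eq0 normr1 invr1 mul1e => /(_ isT mfe) /(_ (fun _ => _)) <-; last first.
  by move=> x; rewrite lee_fin.
rewrite -ge0_integralZl//.
- by apply: eq_integral => u _; rewrite /F /= -EFinM -normrM mul1r.
- apply/measurable_EFinP; apply: measurableT_comp => //.
  have mfe' : measurable_fun [set: R] (fun v => expR (- (v * z)) * f v).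
    by apply: measurable_funM => //; exact: measurable_expRM.
  by apply: (measurableT_comp mfe'); exact: measurable_affine.
Qed.

Let convE y : expR (- (y * z)) * conv nu p f y = \int[nu]_v F (y, v).
Proof.
rewrite /conv -RintegralZl_gt0 ?expR_gt0//; last first.
  apply: measurable_funM => //; apply: (measurableT_comp mf).
  exact: measurable_funB.
apply: eq_Rintegral => v _; rewrite /F/=.
rewrite (_ : - (y * z) = - (v * z) - (y - v) * z); last by ring.
by rewrite expRD; ring.
Qed.

Lemma exp_integrable_conv : exp_integrable mu (conv nu p f) z.
Proof.
have := integrable_Rintegral1 iF.
by apply: eq_integrable => // y _ /=; rewrite convE.
Qed.

Lemma lap_conv : lap mu (conv nu p f) z = lap nu p z * lap mu f z.
Proof.
rewrite /lap; under eq_Rintegral do rewrite convE.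
rewrite (Rintegral_exchange iF) -RintegralZr//.
apply: eq_Rintegral => v _; rewrite /F/= RintegralZl//; last first.
  have := @integrable_affine R 1 (- v) _ (oner_neq0 _) jf.
  by apply: eq_integrable => // u _ /=; rewrite mul1r.
congr (_ * _).
have mfe : measurable_fun [set: R] (fun v => expR (- (v * z)) * f v).
  by apply: measurable_funM => //; exact: measurable_expRM.
have := @Rintegral_affine R 1 (- v) _ (oner_neq0 _) mfe.
by rewrite normr1 invr1 mul1r => <-; apply: eq_Rintegral => u _; rewrite mul1r.
Qed.

Lemma measurable_conv : measurable_fun setT (conv nu p f).
Proof.
have := integrable_measurable (integrable_Rintegral1 iF).
have -> : conv nu p f = fun y => expR (y * z) * \int[nu]_v F (y, v).
  by apply/funext => y; rewrite -convE mulrA -expRD subrr expR0 mul1r.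
move=> h; apply: measurable_funM => //.
by apply: measurableT_comp => //; exact: measurable_funM.
Qed.

End convolution.
End bilateral_laplace.

Section tame.
Context {R : realType}.
Local Notation mu := (@lebesgue_measure R).
Implicit Types (f g p : R -> R) (z : R).

(** The regularity of resolvents: zero on the negative half-line and right
    continuous by definition, locally bounded by the renewal equation. Right
    continuity makes the values at points depend on the transform only. *)
Record tame f : Prop := Tame {
  tame_measurable : measurable_fun setT f ;
  tame_causal : forall x : R, x < 0 -> f x = 0 ;
  tame_bounded : forall M : R, exists C : R, forall x, x <= M -> `|f x| <= C ;
  tame_right : forall x, f t @[t --> x^'+] --> f x }.

Lemma tame_cvg f x : tame f -> f t @[t --> x^'+] --> f x.
Proof. by case. Qed.
Arguments tame_cvg : clear implicits.

Section conv_tame.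
Variables (p f : R -> R) (z : R).
Hypotheses (mp : measurable_fun setT p) (p0 : forall x : R, x < 0 -> p x = 0).
Hypotheses (z0 : 0 <= z) (ip : exp_integrable mu p z).
Hypothesis tf : tame f.

Let prod_bound (M C y v : R) : y <= M -> (forall x, x <= M -> `|f x| <= C) ->
  `|p v * f (y - v)| <= C * expR (M * z) * `|expR (- (v * z)) * p v|.
Proof.
move=> yM fC.
have C0 : 0 <= C by exact: le_trans (fC M (lexx _)).
have [v0|v0] := ltP v 0; first by rewrite p0// mul0r normr0 mulr0 normr0 mulr0.
have [yv|yv] := ltP (y - v) 0.
  by rewrite (tame_causal tf)// mulr0 normr0 !mulr_ge0// expR_ge0.
rewrite normrM [leRHS]mulrAC mulrC -mulrA ler_pM//.
  by apply: fC; lra.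
rewrite normrM (ger0_norm (expR_ge0 _)) mulrAC -expRD -[leLHS]mul1r.
by rewrite ler_wpM2r// -expR0 ler_expR addrC -mulrBl mulr_ge0//; lra.
Qed.

Let integrable_bound (C : R) :
  mu.-integrable setT (EFin \o (fun v => C * `|expR (- (v * z)) * p v|)).
Proof. by apply: integrable_scale => //; exact: integrable_norm ip. Qed.

Lemma integrable_conv_tame y :
  mu.-integrable setT (EFin \o (fun v => p v * f (y - v))).
Proof.
have [C fC] := tame_bounded tf y.
apply: (integrable_dominated _ _ _ (integrable_bound (C * expR (y * z)))) => //.
  apply: measurable_funM => //; apply: (measurableT_comp (tame_measurable tf)).
  exact: measurable_funB.
by move=> v _; exact: prod_bound.
Qed.

Lemma conv_causal y : y < 0 -> conv mu p f y = 0.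
Proof.
move=> y0; rewrite /conv (_ : (fun v => _) = cst 0) ?Rintegral_cst ?mul0r//.
apply/funext => v /=; have [v0|v0] := ltP v 0; first by rewrite p0// mul0r.
by rewrite (tame_causal tf) ?mulr0//; lra.
Qed.

Lemma conv_bounded M : exists C, forall y, y <= M -> `|conv mu p f y| <= C.
Proof.
have [C fC] := tame_bounded tf M.
exists (\int[mu]_v (C * expR (M * z) * `|expR (- (v * z)) * p v|)) => y yM.
rewrite (le_trans (le_normr_Rintegral _ (integrable_conv_tame y)))//.
apply: le_Rintegral => //.
- exact: integrable_norm (integrable_conv_tame y).
- by move=> v _; exact: prod_bound.
Qed.

Lemma conv_right x : conv mu p f t @[t --> x^'+] --> conv mu p f x.
Proof.
apply/cvg_at_rightP => u [ux uc].
have [M [_ uM]] := cvg_seq_bounded (cvgP _ uc).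
have {}uM n : u n <= M + 1.
  by rewrite (le_trans (ler_norm _))// uM// ltrDl.
have [C fC] := tame_bounded tf (M + 1).
have [|||_] := @Rdominated_convergence _ _ _ mu setT measurableT
  (fun n v => p v * f (u n - v)) (fun v => p v * f (x - v)) _ _ _
  (integrable_bound (C * expR ((M + 1) * z))).
- move=> n; apply: measurable_funM => //; apply: (measurableT_comp (tame_measurable tf)).
  exact: measurable_funB.
- move=> /= v _; apply: cvgM; first exact: cvg_cst.
  have /cvg_at_rightP rc := tame_cvg f (x - (v : R)) tf.
  apply: (rc (fun n => u n - (v : R))); split.
    by move=> n; rewrite ltrD2r.
  by apply: cvgB => //; exact: cvg_cst.
- by move=> n v _; exact: prod_bound.
exact.
Qed.

(** All properties are inherited from f, by dominated convergence as far as right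
    continuity is concerned. This is how resolvents, which are given by their
    transforms, turn out to be locally bounded. *)
Lemma conv_tame : exp_integrable mu f z -> tame (conv mu p f).
Proof.
move=> jf; split.
- exact: (measurable_conv mp (tame_measurable tf) ip jf).
- exact: conv_causal.
- exact: conv_bounded.
- exact: conv_right.
Qed.

End conv_tame.

(** The transforms need to agree only on a real half-line: after
    multiplication of f - g by exp(-z0 u) the values at z0, z0 + 1, z0 + 2, and
    so on are the integrals that occur in [moments0_eq0]. *)
Lemma lap_inj f g z0 :
  (forall x : R, x < 0 -> f x = g x) ->
  (forall x, 0 <= x -> f t @[t --> x^'+] --> f x) ->
  (forall x, 0 <= x -> g t @[t --> x^'+] --> g x) ->
  (forall x : R, x < 0 -> g x = 0) ->
  (forall z, z0 <= z -> exp_integrable mu f z) ->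
  (forall z, z0 <= z -> exp_integrable mu g z) ->
  (forall z, z0 <= z -> lap mu f z = lap mu g z) ->
  forall x, f x = g x.
Proof.
move=> fg0 rf rg gc jf jg fg x.
have [x0|x0] := ltP x 0; first exact: fg0.
pose h u := expR (- (u * z0)) * f u - expR (- (u * z0)) * g u.
have hE k : (fun u : R => expR (- (u * (z0 + k%:R))) * f u - expR (- (u * (z0 + k%:R))) * g u) =
    (fun u => expR (- (k%:R * u)) * h u).
  apply/funext => u; rewrite /h !mulrBr mulrDr opprD expRD (mulrC u k%:R).
  by ring.
have z0k (k : nat) : z0 <= z0 + k%:R by rewrite lerDl.
suff : h x = 0.
  by rewrite /h -mulrBr => /eqP; rewrite mulf_eq0 expR_eq0/= subr_eq0 => /eqP.
apply: (@moments0_eq0 R h) => //.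
- apply: (@integrableS _ _ _ mu setT) => //.
  by apply: integrable_sub => //; [exact: jf|exact: jg].
- move=> k; rewrite -hE Rintegral_mkcond.
  rewrite (_ : _ \_ _ = fun u : R => expR (- (u * (z0 + k%:R))) * f u - expR (- (u * (z0 + k%:R))) * g u).
    rewrite RintegralB//; [|exact: jf|exact: jg].
    by have := fg _ (z0k k); rewrite /lap => ->; rewrite subrr.
  apply/funext => u; rewrite patchE; case: ifPn => //.
  rewrite notin_setE/= in_itv/= andbT => /negP; rewrite -ltNge => u0.
  by rewrite fg0// gc// subrr.
- move=> y y0; rewrite /h.
  have ec : expR (- (t * z0)) @[t --> y^'+] --> expR (- (y * z0)).
    apply: cvg_at_right_filter.
    apply: continuous_cvg; first exact: continuous_expR.
    by apply: cvgN; apply: cvgM; [exact: cvg_id|exact: cvg_cst].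
  by apply: cvgB; apply: cvgM => //; [exact: rf|exact: rg].
Qed.

End tame.

(** * Laplace transforms on the real axis *)

Section real_axis.
Context {R : realType}.
Local Notation mu := (@lebesgue_measure R).
Local Notation D := (`[0, +oo[%classic : set R).
Implicit Types (f : R -> R) (x u : R).

Lemma cexp_real u x : cexp (- (u%:C * x%:C)) = (expR (- (u * x)))%:C :> R[i].
Proof.
rewrite -rmorphM -rmorphN /cexp /=.
by rewrite cos0 sin0 mulr1 mulr0.
Qed.

Lemma laplace_real f x : laplace f x%:C = (lap mu (f \_ D) x)%:C.
Proof.
rewrite /laplace /Cintegral.
under [X in X +i* _]eq_Rintegral do rewrite cexp_real -rmorphM /=.
under [X in _ +i* X]eq_Rintegral do rewrite cexp_real -rmorphM /=.
congr (_ +i* _); last by rewrite Rintegral_cst// mul0r.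
rewrite Rintegral_mkcond /lap; apply: eq_Rintegral => u _.
by rewrite !patchE; case: ifP => //; rewrite mulr0.
Qed.

Lemma laplace_cvg_real f x : laplace_cvg f x%:C -> exp_integrable mu (f \_ D) x.
Proof.
have mD : measurable (D : set (measurableTypeR R)) by exact: measurable_itv.
move=> h; have := proj1 (integrable_mkcond _ mD) h; apply: eq_integrable => // u _ /=.
by rewrite !patchE; case: ifP => //; rewrite mulr0.
Qed.

(** The exponential function cut off at 0, with transform 1 / (z - c). *)
Definition Ec (c y : R) : R := if 0 <= y then expR (c * y) else 0.

Lemma lap_Ec c x : c < x ->
  exp_integrable mu (Ec c) x /\ lap mu (Ec c) x = (x - c)^-1.
Proof.
move=> cx; have xc0 : 0 < x - c by rewrite subr_gt0.
have E : (fun u => expR (- (u * x)) * Ec c u) =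
    (fun u => (x - c)^-1 * exponential_pdf (x - c) u).
  apply/funext => u; rewrite /Ec /exponential_pdf patchE.
  case: ifPn => u0.
    rewrite ifT ?inE/= ?in_itv/= ?u0// mulrA mulVf ?gt_eqF// mul1r -expRD.
    by congr expR; ring.
  by rewrite memNset ?mulr0//= in_itv/= andbT; exact/negP.
split.
  rewrite /exp_integrable E; apply: integrable_scale => //.
  exact: integrable_exponential_pdf.
rewrite /lap E RintegralZl//; last exact: integrable_exponential_pdf.
by rewrite /Rintegral integral_exponential_pdf// mulr1.
Qed.

Lemma tame_Ec c : 0 <= c -> tame (Ec c).
Proof.
move=> c0; split.
- apply: measurable_fun_ifT => //; first exact: measurable_fun_ler.
  by apply: measurableT_comp => //; exact: measurable_funM.
- by move=> y y0; rewrite /Ec leNgt y0.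
- move=> M; exists (expR (c * M)) => y yM; rewrite /Ec; case: ifP => _.
    by rewrite ger0_norm ?expR_ge0// ler_expR ler_wpM2l.
  by rewrite normr0 expR_ge0.
- move=> y; have [y0|y0] := ltP y 0.
    rewrite {2}/Ec leNgt y0 /=; apply: cvg_near_cst.
    near=> t; rewrite /Ec leNgt.
    have -> : t < 0 by near: t; apply: nbhs_right_lt.
    by [].
  rewrite {2}/Ec y0.
  apply: (@cvg_trans _ (expR (c * t) @[t --> y^'+])).
    apply: near_eq_cvg; near=> t; rewrite /Ec ifT//.
    by rewrite (le_trans y0)// ltW//; near: t; exact: nbhs_right_gt.
  apply: cvg_at_right_filter; apply: continuous_cvg; first exact: continuous_expR.
  by apply: cvgM; [exact: cvg_cst|exact: cvg_id].
Unshelve. all: by end_near. Qed.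

(** The law F of the jumps lives on the positive half-line. This factor makes
    integrals over the whole line equal to those over that half-line. *)
Definition pos_jump : R -> R := \1_(`]0, +oo[%classic : set R).

Section cumulant_real.
Variables (a lam : R) (F : probability (measurableTypeR R) R).
Hypothesis F1 : F [set y | 0 < y] = 1%E.

Let F1' : F (`]0, +oo[%classic) = 1%E.
Proof.
rewrite -F1; congr (F _); apply/seteqP; split => y /=; by rewrite in_itv/= andbT.
Qed.

Lemma exp_integrable_pos_jump x : 0 <= x -> exp_integrable F pos_jump x.
Proof.
move=> x0; apply: (@integrable_bounded _ _ _ F _ 1).
  apply: measurable_funM; first exact: measurable_expRM.
  by apply: measurable_indic; exact: measurable_itv.
move=> u; rewrite /pos_jump indicE; case: (boolP (u \in _)); rewrite ?mulr0 ?normr0//.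
rewrite inE/= in_itv/= andbT mulr1 => u0; rewrite ger0_norm ?expR_ge0//.
by rewrite -expR0 ler_expR oppr_le0 mulr_ge0// ltW.
Qed.

Lemma cumulant_real x : 0 <= x ->
  cumulant a lam F x%:C = (a * x + lam * (lap F pos_jump x - 1))%:C.
Proof.
move=> x0; rewrite /cumulant /Cintegral.
under [X in X +i* _]eq_Rintegral do rewrite cexp_real -(rmorph1 (@real_complex R)) -rmorphB /=.
under [X in _ +i* X]eq_Rintegral do rewrite cexp_real -(rmorph1 (@real_complex R)) -rmorphB /=.
rewrite [X in _ +i* X](_ : _ = 0); last by rewrite Rintegral_cst// mul0r.
rewrite [X in X +i* _](_ : _ = lap F pos_jump x - 1).
  by rewrite -[_ +i* 0]/((lap F pos_jump x - 1)%:C) -!rmorphM -rmorphD.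
rewrite RintegralB//.
- rewrite Rintegral_cst//= F1' mulr1; congr (_ - _).
  rewrite Rintegral_mkcond /lap; apply: eq_Rintegral => u _.
  rewrite patchE /pos_jump indicE; case: ifP; rewrite ?mulr1 ?mulr0//.
- apply/integrable_mkcond => //; have := exp_integrable_pos_jump x0.
  apply: eq_integrable => // u _ /=.
  by rewrite !patchE /pos_jump indicE; case: ifP; rewrite ?mulr1 ?mulr0.
- by apply: (@integrableS _ _ _ F setT) => //; exact: finite_measure_integrable_cst.
Qed.
End cumulant_real.

End real_axis.

(** * The renewal equation of a resolvent *)

Section resolvent.
Context {R : realType}.
Local Notation mu := (@lebesgue_measure R).

Lemma tame_lin (f g : R -> R) (al be : R) :
  tame f -> tame g -> tame (fun x => al * f x + be * g x).
Proof.
move=> tf tg; split.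
- by apply: measurable_funD; apply: measurable_funM => //; exact: tame_measurable.
- by move=> x x0; rewrite (tame_causal tf x0) (tame_causal tg x0) !mulr0 addr0.
- move=> M; have [C fC] := tame_bounded tf M; have [C' gC] := tame_bounded tg M.
  exists (`|al| * C + `|be| * C') => x xM.
  rewrite (le_trans (ler_normD _ _))// !normrM lerD// ler_wpM2l//.
    exact: fC.
  exact: gC.
- move=> x; apply: cvgD; apply: cvgM; try exact: cvg_cst; exact: tame_cvg.
Qed.

Lemma exp_integrable_measurable (f : R -> R) z :
  exp_integrable mu f z -> measurable_fun setT f.
Proof.
move=> /integrable_measurable h.
have -> : f = fun u => expR (u * z) * (expR (- (u * z)) * f u).
  by apply/funext => u; rewrite mulrA -expRD subrr expR0 mul1r.
apply: measurable_funM => //.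
by apply: measurableT_comp => //; exact: measurable_funM.
Qed.

Lemma exp_integrable_lin (f g : R -> R) (al be z : R) :
  exp_integrable mu f z -> exp_integrable mu g z ->
  exp_integrable mu (fun x => al * f x + be * g x) z /\
  lap mu (fun x => al * f x + be * g x) z = al * lap mu f z + be * lap mu g z.
Proof.
move=> jf jg.
have E : (fun u => expR (- (u * z)) * (al * f u + be * g u)) =
  (fun u => al * (expR (- (u * z)) * f u) + be * (expR (- (u * z)) * g u)).
  by apply/funext => u; ring.
split.
  by rewrite /exp_integrable E; apply: integrable_add => //; exact: integrable_scale.
rewrite /lap E RintegralD//; try exact: integrable_scale.
by rewrite !RintegralZl.
Qed.

Variables (a lam s : R) (F : probability (measurableTypeR R) R).
Hypotheses (a0 : 0 < a) (lam0 : 0 < lam) (s0 : 0 <= s).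
Hypothesis F1 : F [set y | 0 < y] = 1%E.
Variables (zr : R) (r : R -> R).
Hypothesis rneg : forall x : R, x < 0 -> r x = 0.
Hypothesis rright : forall x : R, 0 <= x -> r t @[t --> x^'+] --> r x.
Hypothesis rlap : forall x : R, zr < x ->
  laplace_cvg r x%:C /\ laplace r x%:C = (cumulant a lam F x%:C - s%:C)^-1.

Let c := (lam + s) / a.
Let c0 : 0 < c. Proof. by rewrite divr_gt0// ltr_wpDr. Qed.
Let Z := `|zr| + c + 1.
Let Z0 : 0 <= Z. Proof. by rewrite !addr_ge0// ltW. Qed.
Let Zc (z : R) : Z <= z -> c < z.
Proof. by apply: lt_le_trans; rewrite /Z; have := normr_ge0 zr; lra. Qed.
Let Zzr (z : R) : Z <= z -> zr < z.
Proof.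
by apply: lt_le_trans; rewrite /Z; have := ler_norm zr; have := c0; lra.
Qed.
Let Zz0 (z : R) : Z <= z -> 0 <= z. Proof. exact: le_trans. Qed.

Let rD : r \_ (`[0, +oo[%classic : set R) = r.
Proof.
apply/funext => u; rewrite patchE; case: ifPn => //.
rewrite notin_setE/= in_itv/= andbT => /negP; rewrite -ltNge => u0.
by rewrite rneg.
Qed.

Let jr (z : R) : Z <= z -> exp_integrable mu r z.
Proof. by move=> /Zzr /rlap[+ _] => /laplace_cvg_real; rewrite rD. Qed.

Let Fh_ge0 z : 0 <= lap F pos_jump z.
Proof.
by apply: Rintegral_ge0 => u _; rewrite mulr_ge0 ?expR_ge0.
Qed.

Lemma lap_resolvent z : Z <= z ->
  lap mu r z * (a * (z - c) + lam * lap F pos_jump z) = 1.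
Proof.
move=> zZ; have [_] := rlap (Zzr zZ); rewrite laplace_real rD.
rewrite (cumulant_real _ _ F1 (Zz0 zZ)) -rmorphB -fmorphV => -[->].
have -> : a * z + lam * (lap F pos_jump z - 1) - s =
   a * (z - c) + lam * lap F pos_jump z.
  by rewrite /c; field; rewrite gt_eqF.
rewrite mulVf// gt_eqF// ltr_wpDr// ?mulr_ge0 ?(ltW lam0)//.
by rewrite mulr_gt0// subr_gt0 Zc.
Qed.

Definition jump_conv := conv F pos_jump r.

Let mr : measurable_fun setT r.
Proof. exact: exp_integrable_measurable (jr (lexx Z)). Qed.

Let mpos : measurable_fun setT (@pos_jump R).
Proof. by apply: measurable_indic; exact: measurable_itv. Qed.

Let jq (z : R) : Z <= z -> exp_integrable mu jump_conv z.
Proof.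
move=> zZ; apply: exp_integrable_conv => //; last exact: jr.
exact: exp_integrable_pos_jump (Zz0 zZ).
Qed.

Let lq (z : R) : Z <= z -> lap mu jump_conv z = lap F pos_jump z * lap mu r z.
Proof.
move=> zZ; apply: lap_conv => //; last exact: jr.
exact: exp_integrable_pos_jump (Zz0 zZ).
Qed.

Lemma measurable_jump_conv : measurable_fun setT jump_conv.
Proof. exact: exp_integrable_measurable (jq (lexx Z)). Qed.

Lemma jump_conv_causal x : x < 0 -> jump_conv x = 0.
Proof.
move=> x0; rewrite /jump_conv /conv (_ : (fun v => _) = cst 0) ?Rintegral_cst ?mul0r//.
apply/funext => v /=; rewrite /pos_jump indicE.
case: (boolP (v \in _)); rewrite ?mul0r// mul1r inE/= in_itv/= andbT => v0.
by apply: rneg; rewrite subr_lt0 (lt_trans x0).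
Qed.

Let jE (z : R) : Z <= z -> exp_integrable mu (Ec c) z.
Proof. by move=> /Zc /lap_Ec[]. Qed.

Let tT : tame (conv mu jump_conv (Ec c)).
Proof.
apply: (conv_tame measurable_jump_conv jump_conv_causal Z0 (jq (lexx _))).
  by apply: tame_Ec; exact: ltW.
exact: jE.
Qed.

(** With c = (lam + s) / a, the definition of the transform of r can be written
    as r^(z) (a (z - c) + lam F^(z)) = 1, that is to say
    r^ = (1 / a - (lam / a) F^ r^) / (z - c); this is the equation below, read
    through transforms. *)
Lemma resolvent_convE y :
  r y = a^-1 * Ec c y + (- (lam / a)) * conv mu jump_conv (Ec c) y.
Proof.
have tE : tame (Ec c) by apply: tame_Ec; exact: ltW.
have tg := tame_lin a^-1 (- (lam / a)) tE tT.
have mq := measurable_jump_conv; have mE := tame_measurable tE.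
apply: (@lap_inj R r (fun y => a^-1 * Ec c y + (- (lam / a)) * conv mu jump_conv (Ec c) y) Z) => //.
- by move=> x x0; rewrite rneg// (tame_causal tg x0).
- by move=> x _; exact: tame_cvg tg.
- by move=> x x0; rewrite (tame_causal tg x0).
- move=> z zZ; apply: (exp_integrable_lin _ _ (jE zZ) _).1.
  by apply: exp_integrable_conv => //; [exact: jq|exact: jE].
- move=> z zZ; rewrite (exp_integrable_lin _ _ (jE zZ) _).2; last first.
    by apply: exp_integrable_conv => //; [exact: jq|exact: jE].
  rewrite lap_conv//; [|exact: jq|exact: jE].
  rewrite lq// (lap_Ec (Zc zZ)).2.
  have h := lap_resolvent zZ.
  have zc : z - c != 0 by rewrite gt_eqF// subr_gt0 Zc.
  have an : a != 0 by rewrite gt_eqF.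
  apply: (mulfI (x := a * (z - c))); first by rewrite mulf_neq0.
  have -> : a * (z - c) * (a^-1 * (z - c)^-1 +
     - (lam / a) * (lap F pos_jump z * lap mu r z / (z - c))) =
     1 - lam * lap F pos_jump z * lap mu r z by field; apply/andP.
  by rewrite -h; ring.
Qed.

Lemma resolvent_tame : tame r.
Proof.
have -> : r = (fun y => a^-1 * Ec c y + (- (lam / a)) * conv mu jump_conv (Ec c) y).
  by apply/funext => y; exact: resolvent_convE.
by apply: tame_lin => //; apply: tame_Ec; exact: ltW.
Qed.

(** The integral equation in a form without convolution by an exponential
    function: exp(-c y) r(y) decreases at the rate given by the jumps, and jumps
    upwards by 1 / a where y crosses 0. In the applications Y1 <= Y2 are
    the signed distances between a fixed level and the start and end points of
    a path that moves down. *)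
Lemma resolvent_step Y1 Y2 : Y1 <= Y2 ->
  expR (- (c * Y1)) * r Y1 + (Y1 < 0 <= Y2)%R%:R / a =
  expR (- (c * Y2)) * r Y2 +
  lam / a * \int[mu]_(w in `]Y1, Y2]) (expR (- (c * w)) * jump_conv w).
Proof.
move=> Y12.
have tE : tame (Ec c) by apply: tame_Ec; exact: ltW.
have iT Y := integrable_conv_tame measurable_jump_conv jump_conv_causal Z0 (jq (lexx _)) tE Y.
have TE Y : expR (- (c * Y)) * conv mu jump_conv (Ec c) Y =
    \int[mu]_w (expR (- (c * Y)) * (jump_conv w * Ec c (Y - w))).
  by rewrite RintegralZl//; exact: iT.
have -> : \int[mu]_(w in `]Y1, Y2]) (expR (- (c * w)) * jump_conv w) =
  expR (- (c * Y2)) * conv mu jump_conv (Ec c) Y2 -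
  expR (- (c * Y1)) * conv mu jump_conv (Ec c) Y1.
  rewrite !TE -RintegralB//; try by apply: integrable_scale => //; exact: iT.
  rewrite [LHS]Rintegral_mkcond; apply: eq_Rintegral => w _.
  have e Y : expR (- (c * Y)) * (jump_conv w * expR (c * (Y - w))) =
    expR (- (c * w)) * jump_conv w.
    by rewrite mulrCA -expRD mulrC; congr (expR _ * _); ring.
  rewrite patchE /Ec !subr_ge0; case: ifPn => [|].
    rewrite inE/= in_itv/= => /andP[Y1w wY2]; rewrite wY2 leNgt Y1w/=.
    by rewrite e !mulr0 subr0.
  rewrite notin_setE/= in_itv/= => /negP; rewrite negb_and -leNgt -ltNge.
  move=> /orP[wY1|Y2w].
    by rewrite wY1 (le_trans wY1 Y12) !e subrr.
  by rewrite leNgt Y2w leNgt (le_lt_trans Y12 Y2w)/= !mulr0 subrr.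
rewrite !(resolvent_convE Y1) !(resolvent_convE Y2).
have e Y : expR (- (c * Y)) * Ec c Y = (0 <= Y)%R%:R.
  rewrite /Ec; case: ifP => _; last by rewrite mulr0.
  by rewrite -expRD addNr expR0.
rewrite !mulrDr ![expR _ * (a^-1 * _)]mulrCA !e.
have -> : (Y1 < 0 <= Y2)%R%:R = (0 <= Y2)%R%:R - (0 <= Y1)%R%:R :> R.
  rewrite ltNge; have [Y10|Y10] := leP 0 Y1.
    by rewrite (le_trans Y10 Y12) subrr.
  by rewrite /= subr0.
move: (conv _ _ _ Y1) (conv _ _ _ Y2) => T1 T2.
move: (expR (- (c * Y1))) (expR (- (c * Y2))) (lam / a) => e1 e2 k.
by ring.
Qed.

Lemma integrable_jump_conv Y1 Y2 :
  mu.-integrable `[Y1, Y2] (EFin \o (fun w => expR (- (c * w)) * jump_conv w)).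
Proof.
have tE : tame (Ec c) by apply: tame_Ec; exact: ltW.
have mI : measurable (`[Y1, Y2]%classic : set (measurableTypeR R)) by exact: measurable_itv.
have := integrable_conv_tame measurable_jump_conv jump_conv_causal Z0 (jq (lexx _)) tE Y2.
move=> /(integrable_scale (mu := mu) measurableT (expR (- (c * Y2)))).
move=> /(integrableS measurableT mI (@subsetT _ _)).
apply: eq_integrable => // w; rewrite inE/= in_itv/= => /andP[_ wY2].
by rewrite /Ec subr_ge0 wY2 mulrCA -expRD mulrC; congr (EFin (expR _ * _)); ring.
Qed.

(** All that the sequel uses about a resolvent. Unlike the transform, it can be
    combined directly with one step of a path. *)
Definition resolvent_eq := [/\ tame r,
  forall Y1 Y2, mu.-integrable `[Y1, Y2]
    (EFin \o (fun w => expR (- (c * w)) * jump_conv w)) &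
  forall Y1 Y2, Y1 <= Y2 ->
  expR (- (c * Y1)) * r Y1 + (Y1 < 0 <= Y2)%R%:R / a =
  expR (- (c * Y2)) * r Y2 +
  lam / a * \int[mu]_(w in `[Y1, Y2]) (expR (- (c * w)) * jump_conv w)].

Lemma resolvent_eqP : resolvent_eq.
Proof.
split; [exact: resolvent_tame|exact: integrable_jump_conv|move=> Y1 Y2 Y12].
rewrite resolvent_step// (Rintegral_itv_obnd_cbnd)//.
have := integrable_jump_conv Y1 Y2; apply: integrableS => //.
exact: subset_itv_oc_cc.
Qed.
End resolvent.

(** * The one-step operator *)

Lemma measurable_Rintegral_param (R : realType) d1 d2 (T1 : measurableType d1)
    (T2 : measurableType d2) (m2 : {sigma_finite_measure set T2 -> \bar R})
    (f : T1 * T2 -> R) : measurable_fun setT f ->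
  measurable_fun setT (fun x => \int[m2]_y f (x, y)).
Proof.
move=> mf; apply: (measurableT_comp (@fine_measurable R setT measurableT)).
have mEf : measurable_fun setT (EFin \o f) by exact/measurable_EFinP.
under eq_fun do rewrite integralE.
apply: emeasurable_funB.
  have := @measurable_fun_fubini_tonelli_F _ _ T1 T2 R m2 ((EFin \o f)^\+)%E
    (measurable_funepos mEf) (fun x => funepos_ge0 _ x).
  apply: eq_measurable_fun => x _; rewrite /fubini_F; apply: eq_integral => y _.
  by rewrite !funeposE.
have := @measurable_fun_fubini_tonelli_F _ _ T1 T2 R m2 ((EFin \o f)^\-)%E
  (measurable_funeneg mEf) (fun x => funeneg_ge0 _ x).
apply: eq_measurable_fun => x _; rewrite /fubini_F; apply: eq_integral => y _.
by rewrite !funenegE.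
Qed.

Section one_step.
Context {R : realType}.
Local Notation mu := (@lebesgue_measure R).
Implicit Types (f : R -> R) (x t v l : R).

(** A path with drift -a starts at x, above the floor l. If the inter-arrival
    time t comes before the floor is reached, then the discounted value of f
    after the jump v is taken, otherwise that of f at the floor, discounted at
    the time at which the path creeps to it. The absolute value of t keeps the
    discount at most 1 for every real t. *)
Definition onestep (a s l : R) f x t v : R :=
  if a * t <= x - l then expR (- (s * `|t|)) * f (x - a * t + v)
  else expR (- (s * ((x - l) / a))) * f l.

(** The mean of one step, L being the law of the inter-arrival times and F that
    of the jumps. *)
Definition Qop (L F : probability (measurableTypeR R) R) (a s l : R) f x : R :=
  \int[L]_t \int[F]_v onestep a s l f x t v.

Variables (L F : probability (measurableTypeR R) R) (a s l : R).
Hypotheses (a0 : 0 < a) (s0 : 0 <= s).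

Lemma onestep_bound f C x t v : l <= x -> (forall x, `|f x| <= C) ->
  `|onestep a s l f x t v| <= C.
Proof.
move=> lx fC; have C0 : 0 <= C by exact: le_trans (fC 0).
have e (y : R) : 0 <= y -> expR (- (s * y)) <= 1.
  by move=> y0; rewrite -expR0 ler_expR oppr_le0 mulr_ge0.
rewrite /onestep; case: ifP => _; rewrite normrM ger0_norm ?expR_ge0//.
  by rewrite (le_trans _ (fC (x - a * t + v)))// ler_piMl// e.
by rewrite (le_trans _ (fC l))// ler_piMl// e// divr_ge0 ?subr_ge0// ltW.
Qed.

Lemma measurable_onestep d (T : measurableType d) (f : R -> T -> R) x
    (t v : T -> R) :
  measurable_fun setT (fun p => f (x - a * t p + v p) p) ->
  measurable_fun setT (fun p => f l p) ->
  measurable_fun setT t ->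
  measurable_fun setT (fun p => onestep a s l (f ^~ p) x (t p) (v p)).
Proof.
move=> m1 m2 mt; apply: measurable_fun_ifT.
- by apply: measurable_fun_ler => //; exact: measurable_funM.
- apply: measurable_funM => //; apply: measurableT_comp => //.
  apply: measurable_funN; apply: measurable_funM => //.
  exact: measurableT_comp.
- exact: measurable_funM.
Qed.

Section superposition.
Context d (V : measurableType d) (m : {sigma_finite_measure set V -> \bar R}).
Variables (w : V -> R) (f : R * V -> R) (C : R).
Hypotheses (iw : m.-integrable setT (EFin \o w)) (mf : measurable_fun setT f).
Hypothesis fC : forall p, `|f p| <= C.

Let C0 : 0 <= C. Proof. exact: le_trans (fC (0, point)). Qed.

Let mw : measurable_fun setT w. Proof. exact: integrable_measurable iw. Qed.

Let iwC : m.-integrable setT (EFin \o (fun p => C * `|w p|)).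
Proof. by apply: integrable_scale => //; exact: integrable_norm. Qed.

Let iwf x : m.-integrable setT (EFin \o (fun p => w p * f (x, p))).
Proof.
apply: (integrable_dominated _ _ _ iwC) => //.
  apply: measurable_funM => //; apply: (measurableT_comp mf).
  exact: measurable_pair1.
by move=> p _; rewrite normrM mulrC ler_wpM2r.
Qed.

Definition superpose x := \int[m]_p (w p * f (x, p)).

Lemma measurable_superpose : measurable_fun setT superpose.
Proof.
apply: (measurable_Rintegral_param m (f := fun xp => w xp.2 * f xp)).
by apply: measurable_funM => //; exact: (measurableT_comp mw measurable_snd).
Qed.

Lemma superpose_bounded x : `|superpose x| <= \int[m]_p (C * `|w p|).
Proof.
rewrite (le_trans (le_normr_Rintegral _ (iwf x)))//.
apply: le_Rintegral => //; first exact: integrable_norm (iwf x).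
by move=> p _; rewrite normrM mulrC ler_wpM2r.
Qed.

Let step_superpose x t v : onestep a s l superpose x t v =
  \int[m]_p (w p * onestep a s l (fun y => f (y, p)) x t v).
Proof.
rewrite /onestep; case: ifP => _; rewrite -RintegralZl//;
  by apply: eq_Rintegral => p _; rewrite mulrCA.
Qed.

(** Harmonicity is linear, hence it passes to mixtures of harmonic functions;
    this turns statements about resolvents shifted by arbitrary amounts into
    statements about the functions C1 and K. *)
Lemma Qop_superpose x : l <= x ->
  Qop L F a s l superpose x =
  \int[m]_p (w p * Qop L F a s l (fun y => f (y, p)) x).
Proof.
move=> lx.
have stepC t v p : `|onestep a s l (fun y => f (y, p)) x t v| <= C.
  exact: onestep_bound.
have mstep : measurable_fun setT (fun tvp : (R * R) * V =>
    onestep a s l (fun y => f (y, tvp.2)) x tvp.1.1 tvp.1.2).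
  apply: (@measurable_onestep _ _ (fun y (tvp : (R * R) * V) => f (y, tvp.2))) => //.
  - apply: (measurableT_comp mf); apply/measurable_fun_pair => /=; last exact: measurable_snd.
    apply: measurable_funD; last exact: (measurableT_comp measurable_snd measurable_fst).
    apply: measurable_funB => //; apply: measurable_funM => //.
    exact: (measurableT_comp measurable_fst measurable_fst).
  - apply: (measurableT_comp mf); apply/measurable_fun_pair => //=; exact: measurable_snd.
  - exact: (measurableT_comp measurable_fst measurable_fst).
have inner t : \int[F]_v onestep a s l superpose x t v =
    \int[m]_p (w p * \int[F]_v onestep a s l (fun y => f (y, p)) x t v).
  have mtv : measurable_fun setT (fun vp : R * V =>
      onestep a s l (fun y => f (y, vp.2)) x t vp.1).
    apply: (measurableT_comp (g := fun vp : R * V => ((t, vp.1), vp.2)) mstep).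
    apply/measurable_fun_pair => /=; last exact: measurable_snd.
    by apply/measurable_fun_pair => //=; exact: measurable_fst.
  under eq_Rintegral do rewrite step_superpose.
  rewrite (Rintegral_exchange (m1 := F) (m2 := m)
    (f := fun vp : R * V => w vp.2 * onestep a s l (fun y => f (y, vp.2)) x t vp.1)).
    apply: eq_Rintegral => p _ /=; rewrite RintegralZl//.
    apply: (integrable_bounded F (C := C)) => //.
    by apply: (measurableT_comp (g := fun v : R => (v, p)) mtv); exact: measurable_pair2.
  apply: (integrable_product (p := cst 1) (q := fun p => C * `|w p|)) => //.
  - exact: finite_measure_integrable_cst.
  - by apply: measurable_funM => //; exact: (measurableT_comp mw measurable_snd).
  - by move=> v p /=; rewrite mul1r normrM mulrC ler_wpM2r.
have mG : measurable_fun setT (fun tp : R * V =>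
    \int[F]_v onestep a s l (fun y => f (y, tp.2)) x tp.1 v).
  apply: (measurable_Rintegral_param F (f := fun tpv : (R * V) * R =>
    onestep a s l (fun y => f (y, tpv.1.2)) x tpv.1.1 tpv.2)).
  apply: (measurableT_comp (g := fun tpv : (R * V) * R => ((tpv.1.1, tpv.2), tpv.1.2)) mstep).
  apply/measurable_fun_pair => /=; last exact: (measurableT_comp measurable_snd measurable_fst).
  apply/measurable_fun_pair => /=; last exact: measurable_snd.
  exact: (measurableT_comp measurable_fst measurable_fst).
have GC t p : `|\int[F]_v onestep a s l (fun y => f (y, p)) x t v| <= C.
  have is_ : F.-integrable setT (EFin \o (fun v => onestep a s l (fun y => f (y, p)) x t v)).
    apply: (integrable_bounded F (C := C)) => //.
    apply: (measurableT_comp (g := fun v : R => ((t, v), p)) mstep).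
    by apply/measurable_fun_pair => //=; exact/measurable_fun_pair.
  rewrite (le_trans (le_normr_Rintegral _ is_))//.
  rewrite -[leRHS]mulr1 -[X in _ <= _ * X](_ : fine (F setT) = 1); last first.
    by rewrite probability_setT.
  rewrite -Rintegral_cst//; apply: le_Rintegral => //.
    exact: integrable_norm is_.
  exact: finite_measure_integrable_cst.
rewrite {1}/Qop; under eq_Rintegral do rewrite inner.
rewrite (Rintegral_exchange (m1 := L) (m2 := m)
  (f := fun tp : R * V => w tp.2 * \int[F]_v onestep a s l (fun y => f (y, tp.2)) x tp.1 v)).
  apply: eq_Rintegral => p _ /=; rewrite RintegralZl//.
  apply: (integrable_bounded L (C := C)) => //.
  by apply: (measurableT_comp (g := fun t : R => (t, p)) mG); exact: measurable_pair2.
apply: (integrable_product (p := cst 1) (q := fun p => C * `|w p|)) => //.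
- exact: finite_measure_integrable_cst.
- by apply: measurable_funM => //; exact: (measurableT_comp mw measurable_snd).
- by move=> v p /=; rewrite mul1r normrM mulrC ler_wpM2r.
Qed.
End superposition.
End one_step.

Lemma integrable_patch d (T : measurableType d) (R : realType)
    (mu : {measure set T -> \bar R}) (D : set T) (f : T -> R) : measurable D ->
  mu.-integrable D (EFin \o f) -> mu.-integrable setT (EFin \o (f \_ D)).
Proof.
move=> mD h; have := proj1 (integrable_mkcond _ mD) h; apply: eq_integrable => // u _ /=.
by rewrite !patchE; case: ifP.
Qed.

Section one_step_laws.
Context {R : realType}.
Local Notation mu := (@lebesgue_measure R).
Implicit Types (f g : R -> R) (x t v l : R).

Definition bdd f : Prop := measurable_fun setT f /\ exists C : R, forall x, `|f x| <= C.

Lemma bdd_integrable (m : probability (measurableTypeR R) R) f :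
  bdd f -> m.-integrable setT (EFin \o f).
Proof. by move=> [mf [C fC]]; exact: (integrable_bounded m mf fC). Qed.

Lemma bdd_shift f y : bdd f -> bdd (fun v => f (y + v)).
Proof.
move=> [mf [C fC]]; split; last by exists C.
by apply: (measurableT_comp mf); exact: measurable_funD.
Qed.

Lemma bdd_lin (f g : R -> R) (al be : R) : bdd f -> bdd g ->
  bdd (fun y => al * f y + be * g y).
Proof.
move=> [mf [C fC]] [mg [C' gC]]; split.
  by apply: measurable_funD; exact: measurable_funM.
exists (`|al| * C + `|be| * C') => y.
by rewrite (le_trans (ler_normD _ _))// !normrM lerD// ler_wpM2l.
Qed.

Lemma Rintegral_prob_cst (m : probability (measurableTypeR R) R) (k : R) :
  \int[m]_v k = k.
Proof.
have E : fine (m setT) = 1 by rewrite probability_setT.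
by rewrite Rintegral_cst// [X in _ * X]E mulr1.
Qed.

Lemma Rintegral_prob_le (m : probability (measurableTypeR R) R) f (C : R) :
  measurable_fun setT f -> (forall x, `|f x| <= C) -> `|\int[m]_v f v| <= C.
Proof.
move=> mf fC; have fi := integrable_bounded m mf fC.
rewrite (le_trans (le_normr_Rintegral _ fi))// -[leRHS](Rintegral_prob_cst m).
apply: le_Rintegral => //; first exact: integrable_norm fi.
exact: finite_measure_integrable_cst.
Qed.

Section fixed_law.
Variables (L F : probability (measurableTypeR R) R) (a lam s : R).
Hypotheses (a0 : 0 < a) (lam0 : 0 < lam) (s0 : 0 <= s).

Lemma inner_onestep l f x t : bdd f -> \int[F]_v onestep a s l f x t v =
  if a * t <= x - l then expR (- (s * `|t|)) * \int[F]_v f (x - a * t + v)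
  else expR (- (s * ((x - l) / a))) * f l.
Proof.
move=> bf; rewrite /onestep; case: ifP => _; last by rewrite Rintegral_prob_cst.
by rewrite RintegralZl//; apply: bdd_integrable; exact: bdd_shift.
Qed.

Lemma measurable_inner_onestep l f x : measurable_fun setT f ->
  measurable_fun setT (fun t => \int[F]_v onestep a s l f x t v).
Proof.
move=> mf; apply: (measurable_Rintegral_param F (f := fun tv : R * R => onestep a s l f x tv.1 tv.2)).
apply: (@measurable_onestep _ _ _ _ _ _ (fun y _ => f y)) => //.
apply: (measurableT_comp mf); apply: measurable_funD; last exact: measurable_snd.
by apply: measurable_funB => //; apply: measurable_funM => //; exact: measurable_fst.
Qed.

Lemma Qop_lin l f g (al be : R) x : l <= x -> bdd f -> bdd g ->
  Qop L F a s l (fun y => al * f y + be * g y) x =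
  al * Qop L F a s l f x + be * Qop L F a s l g x.
Proof.
move=> lx bf bg; have [mf [C fC]] := bf; have [mg [C' gC]] := bg.
have ii h : bdd h -> L.-integrable setT (EFin \o (fun t => \int[F]_v onestep a s l h x t v)).
  move=> [mh [D hD]]; apply: (integrable_bounded L (C := D)).
    exact: measurable_inner_onestep.
  move=> t; apply: Rintegral_prob_le => [|v]; last exact: onestep_bound.
  apply: (@measurable_onestep _ _ _ _ _ _ (fun y _ => h y)) => //.
  by apply: (measurableT_comp mh); exact: measurable_funD.
have [iif iig] := (ii _ bf, ii _ bg).
rewrite /Qop -(RintegralZl _ measurableT iif) -(RintegralZl _ measurableT iig).
rewrite -RintegralD//; try by apply: integrable_scale => //; exact: ii.
have blin : bdd (fun y => al * f y + be * g y).
  split; first by apply: measurable_funD; exact: measurable_funM.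
  exists (`|al| * C + `|be| * C') => y.
  by rewrite (le_trans (ler_normD _ _))// !normrM lerD// ler_wpM2l.
apply: eq_Rintegral => t _; rewrite !inner_onestep//; case: ifP => _; last by ring.
rewrite RintegralD//; try by apply: integrable_scale => //; apply: bdd_integrable; exact: bdd_shift.
rewrite !RintegralZl//; try by apply: bdd_integrable; exact: bdd_shift.
by ring.
Qed.

Hypothesis LE : forall A, measurable A -> L A = exponential_prob lam A.

Lemma Rintegral_exponential_tail X : 0 <= X ->
  \int[mu]_(t in `[0, X]) exponential_pdf lam t = 1 - expR (- (lam * X)).
Proof.
rewrite le_eqVlt => /orP[/eqP <-|X0].
  by rewrite mulr0 oppr0 expR0 subrr set_itv1 Rintegral_set1.
rewrite /Rintegral [X in fine X](_ : _ = exponential_prob lam `[0, X]%classic)//.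
by rewrite exponential_prob_itv0c// mulNr.
Qed.

(** Once the exponential density is inserted, killing at rate s and waiting at
    rate lam combine to a single exponential rate. *)
Lemma QopE l f x : l <= x -> bdd f ->
  Qop L F a s l f x =
  \int[mu]_(t in `[0, (x - l) / a])
     (lam * expR (- ((lam + s) * t)) * \int[F]_v f (x - a * t + v)) +
  expR (- ((lam + s) * ((x - l) / a))) * f l.
Proof.
move=> lx bf; set X := (x - l) / a.
have X0 : 0 <= X by rewrite divr_ge0 ?subr_ge0// ltW.
have [mf [C fC]] := bf.
have mi := @measurable_inner_onestep l f x mf.
have pdf0 : forall t, 0 <= exponential_pdf lam t by move=> t; apply: exponential_pdf_ge0; exact: ltW.
have mpdf := measurable_exponential_pdf lam.
have pdfE t : 0 <= t -> exponential_pdf lam t = lam * expR (- (lam * t)).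
  by move=> t0; rewrite exponential_pdfE// mulNr.
have ipdf : mu.-integrable setT (EFin \o exponential_pdf lam) by exact: integrable_exponential_pdf.
rewrite /Qop (@Rintegral_density R _ (measurableTypeR R) L mu (exponential_pdf lam) pdf0 mpdf LE _ mi).
pose G t := \int[F]_v f (x - a * t + v).
have mG : measurable_fun setT G.
  apply: (measurable_Rintegral_param F (f := fun tv : R * R => f (x - a * tv.1 + tv.2))).
  apply: (measurableT_comp mf); apply: measurable_funD; last exact: measurable_snd.
  by apply: measurable_funB => //; apply: measurable_funM => //; exact: measurable_fst.
have GC t : `|G t| <= C.
  apply: Rintegral_prob_le => //; apply: (measurableT_comp mf).
  exact: measurable_funD.
pose A := ((fun t => lam * expR (- ((lam + s) * t)) * G t) \_ `[0, X]).
pose I := (exponential_pdf lam \_ `[0, X]).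
pose k := expR (- (s * X)) * f l.
have mIt : measurable (`[0, X]%classic : set (measurableTypeR R)) by exact: measurable_itv.
have iI : mu.-integrable setT (EFin \o I).
  apply: integrable_patch => //; apply: (@integrableS _ _ _ mu setT) => //.
have iA : mu.-integrable setT (EFin \o A).
  have iCI : mu.-integrable setT (EFin \o (fun t => C * I t)) by exact: integrable_scale.
  apply: (integrable_dominated _ _ _ iCI) => //.
  - apply: (proj1 (measurable_restrictT _ mIt)); apply: measurable_funTS.
    apply: measurable_funM => //; apply: measurable_funM => //.
    by apply: measurableT_comp => //; apply: measurable_funN; exact: measurable_funM.
  - move=> t _; rewrite /A /I !patchE; case: ifPn; last by rewrite normr0 mulr0.
    rewrite inE/= in_itv/= => /andP[t0 tX].
    rewrite normrM mulrC ler_pM// normrM (gtr0_norm lam0) ger0_norm ?expR_ge0//.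
    rewrite pdfE// ler_wpM2l ?(ltW lam0)//.
    by rewrite ler_expR mulrDl lerN2 lerDl mulr_ge0.
(* On [0, X] no floor is met; beyond X the integrand is the constant k, so that
   the second part is k times the tail of the exponential law. *)
have -> : (fun t => \int[F]_v onestep a s l f x t v * exponential_pdf lam t) =
    (fun t => A t + k * (exponential_pdf lam t - I t)).
  apply/funext => t; rewrite inner_onestep// /A /I !patchE.
  have -> : (a * t <= x - l) = (t <= X) by rewrite /X ler_pdivlMr// mulrC.
  case: ifPn => [tX|tX].
    have [t0|t0] := ltP t 0.
      rewrite /exponential_pdf patchE !memNset/= ?in_itv/= ?andbT ?leNgt ?t0//.
      by rewrite !mulr0 subrr mulr0 addr0.
    rewrite mem_set/= ?in_itv/= ?t0// subrr mulr0 addr0 pdfE//.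
    rewrite (ger0_norm t0) -/(G t) [LHS]mulrC mulrA -!(mulrA lam) -expRD.
    by congr (_ * (expR _ * _)); ring.
  by rewrite memNset/= ?in_itv/= ?(negbTE tX) ?andbF// subr0 add0r.
rewrite RintegralD//; last by apply: integrable_scale => //; exact: integrable_sub.
congr (_ + _); first by rewrite [RHS]Rintegral_mkcond.
rewrite RintegralZl//; last exact: integrable_sub.
rewrite RintegralB//.
rewrite [X in k * (X - _)](_ : _ = 1); last first.
  by rewrite /Rintegral integral_exponential_pdf.
rewrite -[\int[mu]_x I x]Rintegral_mkcond Rintegral_exponential_tail//.
rewrite /k opprB addrC subrK mulrC mulrA -expRD; congr (expR _ * _); ring.
Qed.

Hypothesis F1 : F [set y | 0 < y] = 1%E.

Lemma Rintegral_pos_jump f : measurable_fun setT f ->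
  \int[F]_v f v = \int[F]_v (pos_jump v * f v).
Proof.
move=> mf; rewrite /Rintegral; congr fine; apply: ae_eq_integral => //.
- exact/measurable_EFinP.
- apply/measurable_EFinP; apply: measurable_funM => //.
  by apply: measurable_indic; exact: measurable_itv.
have Epos : [set y : R | 0 < y] = `]0, +oo[%classic.
  by apply/seteqP; split => y /=; rewrite in_itv/= andbT.
have mE : measurable [set y : measurableTypeR R | 0 < y].
  by rewrite Epos; exact: measurable_itv.
exists (~` [set y : measurableTypeR R | 0 < y]); split.
- exact: measurableC.
- apply: (etrans (probability_setC F mE)); rewrite F1 subee//.
- move=> v /= /not_implyP[_ nE] v0; apply: nE.
  by rewrite /pos_jump indicE mem_set ?mul1r//= in_itv/= v0.
Qed.

End fixed_law.
End one_step_laws.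

(** * Complex exponentials *)

Section complex_exponential.
Context {R : realType}.
Local Notation mu := (@lebesgue_measure R).
Implicit Types (w z : R[i]) (x y t : R).

Lemma cexpD z1 z2 : cexp (z1 + z2) = cexp z1 * cexp z2 :> R[i].
Proof.
case: z1 => a1 b1; case: z2 => a2 b2; rewrite /cexp /= expRD cosD sinD.
by apply/eqP; rewrite eq_complex /=; apply/andP; split; apply/eqP; ring.
Qed.

Lemma cexp0 : cexp 0 = 1 :> R[i].
Proof. by rewrite /cexp /= expR0 cos0 sin0 mulr1 mulr0. Qed.

(** Integrals of complex functions are defined by their real and imaginary
    parts. For varying w this real function carries both: w = 1 gives the
    real part of the exponential, and w = -i its imaginary part. *)
Definition rexp w z y : R := complex.Re (w * cexp (z * y%:C)).

Lemma rexpE w z y : rexp w z y = expR (complex.Re z * y) *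
  (complex.Re w * cos (complex.Im z * y) - complex.Im w * sin (complex.Im z * y)).
Proof.
rewrite /rexp /cexp; case: w => p q; case: z => al be /=.
by rewrite !mulr0 subr0 add0r; ring.
Qed.

Lemma rexpD w z y1 y2 : rexp w z (y1 + y2) = rexp (w * cexp (z * y1%:C)) z y2.
Proof. by rewrite /rexp rmorphD mulrDr cexpD mulrA. Qed.

Lemma rexp_lin w1 w2 z y : rexp (w1 + w2) z y = rexp w1 z y + rexp w2 z y.
Proof. by rewrite /rexp mulrDl raddfD. Qed.

Lemma rexp_scale (k : R) w z y : rexp (k%:C * w) z y = k * rexp w z y.
Proof. by rewrite !rexpE; case: w => p q /=; ring. Qed.

Lemma rexp_tilt (k : R) w z y : expR (- (k * y)) * rexp w z y = rexp w (z - k%:C) y.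
Proof.
rewrite !rexpE; case: z => al be /=; rewrite oppr0 addr0 mulrA -expRD.
by congr (expR _ * _); ring.
Qed.

Lemma is_derive_rexp w z y : is_derive y 1 (rexp w z) (rexp (w * z) z y).
Proof.
have -> : rexp w z = fun y => expR (complex.Re z * y) *
  (complex.Re w * cos (complex.Im z * y) - complex.Im w * sin (complex.Im z * y)).
  by apply/funext => x; rewrite rexpE.
have dl (k : R) : is_derive y (1 : R) (fun x => k * x) k.
  by apply: is_derive_eq; rewrite /GRing.scale/= mulr1 ?mulr0 ?addr0 ?add0r.
have de := is_derive1_comp (is_derive_expR (complex.Re z * y)) (dl (complex.Re z)).
have dc := is_derive1_comp (is_derive_cos (complex.Im z * y)) (dl (complex.Im z)).
have ds := is_derive1_comp (is_derive_sin (complex.Im z * y)) (dl (complex.Im z)).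
rewrite rexpE.
apply: is_derive_eq; rewrite /GRing.scale/=.
by case: w z {dl de dc ds} => p q [al be] /=; ring.
Qed.

Lemma continuous_rexp w z : continuous (rexp w z).
Proof.
move=> y; apply/differentiable_continuous/derivable1_diffP.
by have [] := is_derive_rexp w z y.
Qed.

Lemma measurable_rexp w z : measurable_fun setT (rexp w z).
Proof. by apply: continuous_measurable_fun; exact: continuous_rexp. Qed.

Lemma rexp_bound w z y (M : R) : 0 <= complex.Re z -> y <= M ->
  `|rexp w z y| <= expR (complex.Re z * M) * (`|complex.Re w| + `|complex.Im w|).
Proof.
move=> z0 yM; rewrite rexpE normrM ger0_norm ?expR_ge0// ler_pM ?expR_ge0//.
  by rewrite ler_expR ler_wpM2l.
rewrite (le_trans (ler_normB _ _))// !normrM lerD// ler_piMr//.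
  by rewrite ler_norml cos_geN1 cos_le1.
by rewrite ler_norml sin_geN1 sin_le1.
Qed.

Lemma rexp_boundN w z y : 0 <= complex.Re z -> 0 <= y ->
  `|rexp w (- z) y| <= `|complex.Re w| + `|complex.Im w|.
Proof.
move=> z0 y0; have := @rexp_bound w z (- y) 0 z0; rewrite oppr_le0 => /(_ y0).
by rewrite mulr0 expR0 mul1r /rexp rmorphN mulrN mulNr.
Qed.

Lemma rexp_FTC w z X : 0 <= X ->
  \int[mu]_(t in `[0, X]) rexp (w * z) z t = rexp w z X - rexp w z 0.
Proof.
rewrite le_eqVlt => /orP[/eqP <-|X0].
  by rewrite subrr set_itv1 Rintegral_set1.
rewrite /Rintegral (@continuous_FTC2 _ (rexp (w * z) z) (rexp w z))//.
- by apply: continuous_subspaceT => y; exact: continuous_rexp.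
- split.
  + by move=> y _; have [] := is_derive_rexp w z y.
  + by apply/cvg_at_right_filter; exact: continuous_rexp.
  + by apply/cvg_at_left_filter; exact: continuous_rexp.
- by move=> y _; rewrite derive1E; have [_ ->] := is_derive_rexp w z y.
Qed.

Lemma Re_Cintegral d (T : measurableType d) (m : {measure set T -> \bar R})
    (D : set T) (f : T -> R[i]) w : measurable D ->
  m.-integrable D (EFin \o (fun p => complex.Re (f p))) ->
  m.-integrable D (EFin \o (fun p => complex.Im (f p))) ->
  complex.Re (w * Cintegral m D f) = \int[m]_(p in D) complex.Re (w * f p).
Proof.
move=> mD i1 i2; rewrite /Cintegral; case: w => p q /=.
under [RHS]eq_Rintegral => x _.
  have -> : complex.Re ((p +i* q) * f x) = p * complex.Re (f x) - q * complex.Im (f x).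
    by case: (f x).
  over.
rewrite RintegralB//; try exact: integrable_scale.
by rewrite !RintegralZl.
Qed.

Lemma ReIm_cexp z v : complex.Re (cexp (- (v%:C * z))) = rexp 1 (- z) v /\
  complex.Im (cexp (- (v%:C * z))) = rexp (- 'i) (- z) v.
Proof.
rewrite /rexp mulNr (mulrC z) mul1r; split => //.
by case: (cexp _) => p q /=; ring.
Qed.

Lemma rexp_jump (F : probability (measurableTypeR R) R) w z y :
  F [set y | 0 < y] = 1%E -> 0 <= complex.Re z ->
  \int[F]_v (pos_jump v * rexp w z (y - v)) =
  rexp (w * (Cintegral F `]0, +oo[ (fun x => cexp (- (x%:C * z)) - 1) + 1)) z y.
Proof.
move=> F1 z0; set D := `]0, +oo[%classic.
have mD : measurable (D : set (measurableTypeR R)) by exact: measurable_itv.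
have FD : F D = 1%E.
  rewrite -F1; congr (F _); apply/seteqP; split => x /=; by rewrite /D/= in_itv/= andbT.
have ib w' : F.-integrable D (EFin \o rexp w' (- z)).
  have := finite_measure_integrable_cst F (`|complex.Re w'| + `|complex.Im w'|) mD.
  apply: integrable_dominated => //.
    by apply: measurable_funTS; exact: measurable_rexp.
  by move=> x; rewrite /D/= in_itv/= andbT => x0; apply: rexp_boundN => //; exact: ltW.
have i1 : F.-integrable D (EFin \o cst (1 : R)) by exact: finite_measure_integrable_cst.
rewrite [RHS]/rexp -mulrA (mulrC _ (cexp _)) mulrA mulrDr mulr1 raddfD/= Re_Cintegral//; last 2 first.
- have := integrable_sub mD (ib 1) i1; apply: eq_integrable => // v _.
  by rewrite /comp -(ReIm_cexp z v).1; case: (cexp _).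
- have := ib (- 'i); apply: eq_integrable => // v _.
  by rewrite /comp -(ReIm_cexp z v).2; case: (cexp _) => p q /=; rewrite subr0.
set w' := w * cexp (z * y%:C).
have -> : \int[F]_(v in D) complex.Re (w' * (cexp (- (v%:C * z)) - 1)) =
    \int[F]_(v in D) (rexp w' (- z) v - complex.Re w').
  apply: eq_Rintegral => v _; rewrite /rexp mulrBr mulr1 raddfB/= mulNr (mulrC z).
  by [].
rewrite RintegralB//; last exact: finite_measure_integrable_cst.
rewrite Rintegral_cst// [X in _ * X](_ : _ = 1); last exact: (congr1 fine FD).
rewrite mulr1 subrK [RHS]Rintegral_mkcond; apply: eq_Rintegral => v _.
rewrite patchE /pos_jump indicE; case: ifP => _; rewrite ?mul0r// mul1r.
by rewrite rexpD /rexp rmorphN mulrN mulNr.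
Qed.
End complex_exponential.

(** * Harmonic functions of a single process *)

Section harmonic_base.
Context {R : realType}.
Local Notation mu := (@lebesgue_measure R).
Variables (L F : probability (measurableTypeR R) R) (a lam s : R) (r : R -> R).
Hypotheses (a0 : 0 < a) (lam0 : 0 < lam) (s0 : 0 <= s).
Hypothesis LE : forall A, measurable A -> L A = exponential_prob lam A.
Hypothesis F1 : F [set y | 0 < y] = 1%E.
Hypothesis Hr : resolvent_eq a lam s F r.

Let c := (lam + s) / a.
Let tr : tame r. Proof. by case: Hr. Qed.
Let ca : c * a = lam + s. Proof. by rewrite /c mulfVK ?gt_eqF. Qed.

(** The functions are considered on [0, +oo[, the position 0 being where paths
    are stopped; the value 0 on the negative half-line makes them bounded. *)
Definition killed (f : R -> R) (y : R) : R := if 0 <= y then f y else 0.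

Lemma bdd_killed (f : R -> R) (C : R) : measurable_fun setT f ->
  (forall y, 0 <= y -> `|f y| <= C) -> bdd (killed f).
Proof.
move=> mf fC; split.
  by apply: measurable_fun_ifT => //; exact: measurable_fun_ler.
exists `|C| => y; rewrite /killed; case: ifP => [y0|_]; last by rewrite normr0.
by rewrite (le_trans (fC y y0))// ler_norm.
Qed.

Lemma bdd_resolvent c0 : bdd (killed (fun y => r (c0 - y))).
Proof.
have [C rC] := tame_bounded tr c0; apply: (@bdd_killed _ C).
  by apply: (measurableT_comp (tame_measurable tr)); exact: measurable_funB.
by move=> y y0; apply: rC; rewrite gerBl.
Qed.

Lemma killed_jump f (l x t : R) : 0 <= l -> x - a * t >= l -> bdd (killed f) ->
  \int[F]_v killed f (x - a * t + v) =
  \int[F]_v (pos_jump v * f (x - a * t + v)).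
Proof.
move=> l0 xl bf; rewrite Rintegral_pos_jump//; last exact: (bdd_shift _ bf).1.
apply: eq_Rintegral => v _; rewrite /pos_jump indicE.
case: (boolP (v \in _)); rewrite ?mul0r// inE/= in_itv/= andbT => v0.
by rewrite /killed ifT// addr_ge0 ?(ltW v0)// (le_trans l0 xl).
Qed.

(** Down from x to l the distance to the level c0 grows from Y1 to Y2, and
    [resolvent_step] for these two numbers is the assertion. The extra term is
    the atom of the renewal equation; it occurs if the level c0 is passed on
    the way down. *)
Lemma Qop_resolvent (l x c0 : R) : 0 <= l -> l <= x ->
  Qop L F a s l (killed (fun y => r (c0 - y))) x =
  killed (fun y => r (c0 - y)) x +
  (c0 - x < 0 <= c0 - l)%R%:R * (expR (c * (c0 - x)) / a).
Proof.
move=> l0 lx; have bf := bdd_resolvent c0.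
have [_ ir rstep] := Hr.
rewrite (QopE F a0 lam0 s0 LE)//; set X := (x - l) / a.
set Y1 := c0 - x; set Y2 := c0 - l.
have X0 : 0 <= X by rewrite divr_ge0 ?subr_ge0// ltW.
have aX : a * X = x - l by rewrite mulrC divfK ?gt_eqF.
have Y12 : Y1 <= Y2 by rewrite lerD2l lerN2.
pose phi := (fun w => expR (- (c * w)) * jump_conv F r w) \_ `[Y1, Y2].
have mphi : measurable_fun setT phi.
  apply: (proj1 (measurable_restrictT _ _)); first exact: measurable_itv.
  exact: integrable_measurable (ir Y1 Y2).
(* The substitution w = a t + Y1 turns time into distance to the level c0. *)
have -> : \int[mu]_(t in `[0, X]) (lam * expR (- ((lam + s) * t)) *
    \int[F]_v killed (fun y => r (c0 - y)) (x - a * t + v)) =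
    \int[mu]_t (lam * expR (c * Y1) * phi (a * t + Y1)).
  rewrite Rintegral_mkcond; apply: eq_Rintegral => t _; rewrite /phi !patchE.
  have -> : (t \in `[0, X]%classic) = (a * t + Y1 \in `[Y1, Y2]%classic).
    rewrite !mem_setE !in_itv/= lerDr pmulr_rge0//; congr (_ && _).
    by rewrite /X ler_pdivlMr// (mulrC t) /Y1 /Y2; apply/idP/idP; lra.
  case: ifPn; last by rewrite mulr0.
  rewrite inE/= in_itv/= lerDr pmulr_rge0// => /andP[t0 tY2].
  rewrite (@killed_jump _ l)//; last by move: tY2; rewrite /Y1 /Y2; lra.
  rewrite mulrA -(mulrA lam (expR _) (expR _)) -expRD.
  have -> : c * Y1 - c * (a * t + Y1) = - ((lam + s) * t) by rewrite -ca; ring.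
  congr (_ * _); apply: eq_Rintegral => v _; congr (_ * r _).
  by rewrite /Y1; ring.
rewrite RintegralZl_gt0//; last first.
- by apply: (measurableT_comp mphi); exact: measurable_affine.
- by rewrite mulr_gt0// expR_gt0.
rewrite Rintegral_affine ?gt_eqF// gtr0_norm// -[\int[mu]_x phi x]Rintegral_mkcond.
rewrite /killed l0 (le_trans l0 lx) -/Y1 -/Y2.
have := rstep _ _ Y12; rewrite -/c => E.
have e : expR (c * Y1) * expR (- (c * Y1)) = 1 by rewrite -expRD subrr expR0.
have e2 : expR (- ((lam + s) * X)) = expR (c * Y1) * expR (- (c * Y2)).
  by rewrite -expRD -ca; congr expR; rewrite -mulrA aX /Y1 /Y2; ring.
rewrite e2.
set I := \int[mu]_(w in _) _ in E *.
move: e E; move: (expR (c * Y1)) (expR (- (c * Y1))) (expR (- (c * Y2))) => e1 e1' e2' e.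
move: I (r Y1) (r Y2) ((Y1 < 0 <= Y2)%R%:R) => {}I r1 r2 de E.
transitivity (e1 * (e2' * r2 + lam / a * I)); first by ring.
by rewrite -E mulrDr mulrA e mul1r; ring.
Qed.

Lemma Rintegral_itv_affine (f : R -> R) (X Y1 : R) : measurable_fun setT f ->
  \int[mu]_(t in `[0, X]) f (a * t + Y1) =
  a^-1 * \int[mu]_(p in `[Y1, a * X + Y1]) f p.
Proof.
move=> mf; rewrite [in RHS]Rintegral_mkcond.
have mI : measurable (`[Y1, a * X + Y1]%classic : set (measurableTypeR R)).
  exact: measurable_itv.
have mfI := proj1 (measurable_restrictT f mI) (measurable_funTS mf).
have := @Rintegral_affine R a Y1 _ (lt0r_neq0 a0) mfI.
rewrite gtr0_norm// => <-.
rewrite Rintegral_mkcond; apply: eq_Rintegral => t _; rewrite !patchE.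
suff -> : (t \in `[0, X]%classic) = (a * t + Y1 \in `[Y1, a * X + Y1]%classic) by [].
by rewrite !mem_setE !in_itv/= lerDr pmulr_rge0// lerD2r ler_pM2l.
Qed.

Section exponentials.
Variables (z : R[i]).
Hypothesis z0 : 0 <= complex.Re z.
Let k := cumulant a lam F z.

Definition exp_fun (w : R[i]) (B : R) : R -> R := killed (fun y => rexp w z (B - y)).

Lemma bdd_exp_fun w B : bdd (exp_fun w B).
Proof.
apply: (@bdd_killed _ (expR (complex.Re z * B) * (`|complex.Re w| + `|complex.Im w|))).
  by apply: (measurableT_comp (measurable_rexp w z)); exact: measurable_funB.
by move=> y y0; apply: rexp_bound => //; rewrite gerBl.
Qed.

Let tilted (w : R[i]) (Y1 p : R) : R := expR (c * (Y1 - p)) * rexp w z p.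

Let measurable_tilted w Y1 : measurable_fun setT (tilted w Y1).
Proof.
apply: measurable_funM; last exact: measurable_rexp.
by apply: measurableT_comp => //; apply: measurable_funM => //; exact: measurable_funB.
Qed.

Let continuous_tilted w Y1 : continuous (tilted w Y1).
Proof.
move=> p; apply: cvgM; last exact: continuous_rexp.
apply: continuous_cvg; first exact: continuous_expR.
by apply: cvgM; [exact: cvg_cst|apply: cvgB; [exact: cvg_cst|exact: cvg_id]].
Qed.

(** The exponential function is an eigenfunction of the generator with
    eigenvalue k(z), so that killing at rate s leaves the defect k(z) - s,
    accumulated over the levels that are passed. *)
Lemma Qop_exp_fun (w : R[i]) (l x B : R) : 0 <= l -> l <= x ->
  Qop L F a s l (exp_fun w B) x = exp_fun w B x +
  a^-1 * \int[mu]_(p in `[B - x, B - l])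
     (expR (c * (B - x - p)) * rexp (w * (k - s%:C)) z p).
Proof.
move=> l0 lx; have bf := bdd_exp_fun w B.
rewrite (QopE F a0 lam0 s0 LE)//; set X := (x - l) / a; set Y1 := B - x.
have X0 : 0 <= X by rewrite divr_ge0 ?subr_ge0// ltW.
have aX : a * X = x - l by rewrite mulrC divfK ?gt_eqF.
have -> : B - l = a * X + Y1 by rewrite aX /Y1; ring.
rewrite -(Rintegral_itv_affine X Y1 (measurable_tilted _ _)).
pose ga : R := lam + s.
pose Fz := Cintegral F `]0, +oo[ (fun x => cexp (- (x%:C * z)) - 1).
have tE (w' : R[i]) t : tilted w' Y1 (a * t + Y1) =
    rexp (w' * cexp (z * Y1%:C)) (a%:C * z - ga%:C) t.
  rewrite /tilted (addrC _ Y1) rexpD.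
  have -> : c * (Y1 - (Y1 + a * t)) = - (ga * t) by rewrite /ga -ca; ring.
  rewrite -rexp_tilt; congr (_ * _); rewrite /rexp; congr (complex.Re (_ * cexp _)).
  by rewrite rmorphM mulrA (mulrC z).
have -> : \int[mu]_(t in `[0, X]) (lam * expR (- ((lam + s) * t)) *
    \int[F]_v exp_fun w B (x - a * t + v)) =
    \int[mu]_(t in `[0, X]) (tilted (w * (k - s%:C)) Y1 (a * t + Y1) -
       rexp ((w * cexp (z * Y1%:C)) * (a%:C * z - ga%:C)) (a%:C * z - ga%:C) t).
  apply: eq_Rintegral => t; rewrite inE/= in_itv/= => /andP[t0 tX].
  rewrite (@killed_jump _ l)//; last first.
    by move: tX; rewrite /X ler_pdivlMr// (mulrC t); lra.
  have -> : \int[F]_v (pos_jump v * rexp w z (B - (x - a * t + v))) =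
      \int[F]_v (pos_jump v * rexp w z (Y1 + a * t - v)).
    by apply: eq_Rintegral => v _; congr (_ * rexp _ _ _); rewrite /Y1; ring.
  rewrite rexp_jump// -/Fz tE.
  have -> : w * (k - s%:C) * cexp (z * Y1%:C) =
     lam%:C * ((w * (Fz + 1)) * cexp (z * Y1%:C)) +
     w * cexp (z * Y1%:C) * (a%:C * z - ga%:C).
    by rewrite /k /cumulant -/Fz /ga rmorphD; ring.
  rewrite rexp_lin addrK rexp_scale -mulrA; congr (_ * _).
  by rewrite -tE /tilted (addrC _ Y1); congr (expR _ * _); rewrite -ca; ring.
have ir w' z' : mu.-integrable `[0, X] (EFin \o rexp w' z').
  apply: continuous_compact_integrable; first exact: segment_compact.
  by apply: continuous_subspaceT => t; exact: continuous_rexp.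
have i1 : mu.-integrable `[0, X] (EFin \o (fun t => tilted (w * (k - s%:C)) Y1 (a * t + Y1))).
  by rewrite (funext (tE (w * (k - s%:C)))); exact: ir.
rewrite RintegralB//.
rewrite rexp_FTC//.
have -> : rexp (w * cexp (z * Y1%:C)) (a%:C * z - ga%:C) X =
    expR (- ((lam + s) * X)) * exp_fun w B l.
  rewrite -tE /tilted /exp_fun /killed l0 -ca aX; congr (expR _ * rexp _ _ _).
    by rewrite -[in RHS]mulrA aX; ring.
  by rewrite /Y1; ring.
have -> : rexp (w * cexp (z * Y1%:C)) (a%:C * z - ga%:C) 0 = exp_fun w B x.
  rewrite -tE /tilted mulr0 add0r subrr mulr0 expR0 mul1r /exp_fun /killed.
  by rewrite (le_trans l0 lx).
by ring.
Qed.

Section scale.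
Variables (w : R[i]) (B : R).
Hypothesis B0 : 0 <= B.

Let W := rexp w z \_ `[0, B].
Let f2 (yp : R * R) : R := killed (fun y => r (B - `|yp.2| - y)) yp.1.

Let iW : mu.-integrable setT (EFin \o W).
Proof.
apply: integrable_patch; first exact: measurable_itv.
apply: continuous_compact_integrable; first exact: segment_compact.
by apply: continuous_subspaceT => t; exact: continuous_rexp.
Qed.

Let mf2 : measurable_fun setT f2.
Proof.
apply: measurable_fun_ifT => //; first by apply: measurable_fun_ler => //; exact: measurable_fst.
apply: (measurableT_comp (tame_measurable tr)).
apply: measurable_funB; last exact: measurable_fst.
by apply: measurable_funB => //; apply: measurableT_comp => //; exact: measurable_snd.
Qed.

Let f2_bound : exists C : R, forall p, `|f2 p| <= C.
Proof.
have [C rC] := tame_bounded tr B; exists `|C| => -[y p]; rewrite /f2 /killed/=.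
case: ifP => [y0|_]; last by rewrite normr0.
rewrite (le_trans (rC _ _)) ?ler_norm//.
by rewrite -addrA gerDl -opprD oppr_le0 addr_ge0.
Qed.

(** The mixture of the resolvents at levels B - p, 0 <= p <= B, with weights
    w exp(z p); by [scale_funE] it is the integral of exp(-u z) r(u) over
    [0, B - x], multiplied by exp(z (B - x)). *)
Definition scale_fun : R -> R := superpose mu W f2.

Lemma bdd_scale_fun : bdd scale_fun.
Proof.
have [C fC] := f2_bound; split; first exact: (measurable_superpose iW mf2).
by eexists => x; exact: (superpose_bounded iW mf2 fC x).
Qed.

(** The level B - p contributes the atom in [Qop_resolvent] exactly if p is in
    ]B - x, B - l]. The result is the integral in [Qop_exp_fun], and the two
    defects cancel in C1. *)
Lemma Qop_scale_fun (l x : R) : 0 <= l -> l <= x -> x <= B ->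
  Qop L F a s l scale_fun x = scale_fun x +
  a^-1 * \int[mu]_(p in `[B - x, B - l]) (expR (c * (B - x - p)) * rexp w z p).
Proof.
move=> l0 lx xB; have [C fC] := f2_bound.
rewrite (Qop_superpose L F a0 s0 iW mf2 fC lx).
pose V (p : R) : R := (tilted w (B - x) \_ `]B - x, B - l]) p.
have mI : measurable (`]B - x, B - l]%classic : set (measurableTypeR R)).
  exact: measurable_itv.
have iVc : mu.-integrable `[B - x, B - l] (EFin \o tilted w (B - x)).
  apply: continuous_compact_integrable; first exact: segment_compact.
  by apply: continuous_subspaceT => t; exact: continuous_tilted.
have iVo : mu.-integrable `]B - x, B - l] (EFin \o tilted w (B - x)).
  by apply: integrableS iVc => //; exact: subset_itv_oc_cc.
have iV : mu.-integrable setT (EFin \o V) by exact: integrable_patch.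
have -> : (fun p => W p * Qop L F a s l (fun y => f2 (y, p)) x) =
    (fun p => W p * f2 (x, p) + a^-1 * V p).
  apply/funext => p; transitivity (W p * (f2 (x, p) +
    (B - `|p| - x < 0 <= B - `|p| - l)%R%:R * (expR (c * (B - `|p| - x)) / a))).
    congr (_ * _); exact: Qop_resolvent (B - `|p|) l0 lx.
  rewrite mulrDr; congr (_ + _).
  rewrite /W /V /tilted !patchE; case: ifPn => [|]; last first.
    rewrite notin_setE/= in_itv/= => /negP; rewrite negb_and -!ltNge => pB.
    rewrite mul0r; case: ifPn => [|]; last by rewrite mulr0.
    rewrite inE/= in_itv/= => /andP[p1 p2]; exfalso.
    by move: pB => /orP[pB|pB]; lra.
  rewrite inE/= in_itv/= => /andP[p0 pB]; rewrite (ger0_norm p0).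
  have -> : (p \in `]B - x, B - l]%classic) = (B - p - x < 0 <= B - p - l)%R.
    by rewrite mem_setE in_itv/=; congr andb; apply/idP/idP; lra.
  case: ifP => _; last by rewrite mul0r !mulr0.
  rewrite mul1r (_ : B - p - x = B - x - p); last by ring.
  by ring.
rewrite RintegralD//; first last.
- exact: integrable_scale.
- have iC : mu.-integrable setT (EFin \o (fun p => C * `|W p|)).
    by apply: integrable_scale => //; exact: integrable_norm iW.
  apply: (integrable_dominated _ _ _ iC) => //.
    apply: measurable_funM; first exact: integrable_measurable iW.
    by apply: (measurableT_comp (g := fun p : R => (x, p)) mf2); exact: measurable_pair1.
  by move=> p _; rewrite normrM mulrC ler_wpM2r.
congr (_ + _); rewrite RintegralZl//; congr (_ * _).
by rewrite -Rintegral_mkcond Rintegral_itv_obnd_cbnd.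
Qed.

Lemma scale_funE x : 0 <= x ->
  scale_fun x = \int[mu]_(u in `[0, B - x]) (rexp w z (B - x - u) * r u).
Proof.
move=> x0; rewrite /scale_fun /superpose.
have mph : measurable_fun setT (fun p => W p * f2 (x, p)).
  apply: measurable_funM; first exact: integrable_measurable iW.
  by apply: (measurableT_comp (g := fun p : R => (x, p)) mf2); exact: measurable_pair1.
have := @Rintegral_affine R (- 1) (B - x) _ _ mph.
rewrite oppr_eq0 oner_eq0 normrN normr1 invr1 mul1r => /(_ isT) <-.
rewrite [RHS]Rintegral_mkcond; apply: eq_Rintegral => u _.
rewrite mulN1r addrC /W /f2 /killed/= x0 !patchE.
have [u0|u0] := ltP u 0.
  have -> : (u \in `[0, B - x]%classic) = false by rewrite mem_setE in_itv/= leNgt u0.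
  rewrite mem_setE in_itv/=; case: ifPn => [/andP[v0 _]|_]; last by rewrite mul0r.
  by rewrite ger0_norm// (tame_causal tr) ?mulr0//; move: u0; lra.
have [uy|uy] := leP u (B - x).
  have -> : (u \in `[0, B - x]%classic) by rewrite mem_setE in_itv/= u0 uy.
  have -> : (B - x - u \in `[0, B]%classic).
    by rewrite mem_setE in_itv/=; apply/andP; split; lra.
  by rewrite ger0_norm ?subr_ge0//; congr (_ * r _); ring.
have -> : (u \in `[0, B - x]%classic) = false.
  by rewrite mem_setE in_itv/= u0/= leNgt uy.
have -> : (B - x - u \in `[0, B]%classic) = false.
  by rewrite mem_setE in_itv/= leNgt subr_lt0 uy.
by rewrite mul0r.
Qed.
End scale.
End exponentials.
End harmonic_base.

Section harmonic_C1.
Context {R : realType}.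
Local Notation mu := (@lebesgue_measure R).
Variables (L F : probability (measurableTypeR R) R) (a lam s : R) (r : R -> R).
Hypotheses (a0 : 0 < a) (lam0 : 0 < lam) (s0 : 0 <= s).
Hypothesis LE : forall A, measurable A -> L A = exponential_prob lam A.
Hypothesis F1 : F [set y | 0 < y] = 1%E.
Hypothesis Hr : resolvent_eq a lam s F r.
Variable z : R[i].
Hypothesis z0 : 0 <= complex.Re z.

Lemma integrable_cexp_mul (f : R -> R) (u : R) : tame f ->
  mu.-integrable `[0, u] (EFin \o (fun v => complex.Re (cexp (- (v%:C * z)) * (f v)%:C))) /\
  mu.-integrable `[0, u] (EFin \o (fun v => complex.Im (cexp (- (v%:C * z)) * (f v)%:C))).
Proof.
move=> tf; have [C fC] := tame_bounded tf u.
have mI : measurable (`[0, u]%classic : set (measurableTypeR R)) by exact: measurable_itv.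
have ib w' : mu.-integrable `[0, u] (EFin \o (fun v => rexp w' (- z) v * f v)).
  have ic : mu.-integrable `[0, u]
      (EFin \o cst ((`|complex.Re w'| + `|complex.Im w'|) * C)).
    apply: continuous_compact_integrable; first exact: segment_compact.
    by apply: continuous_subspaceT => t; exact: cvg_cst.
  apply: (integrable_dominated _ _ _ ic) => //.
    apply: measurable_funTS; apply: measurable_funM; first exact: measurable_rexp.
    exact: tame_measurable.
  move=> v; rewrite /= in_itv/= => /andP[v0 vu]; rewrite normrM ler_pM//.
    exact: rexp_boundN.
  exact: fC.
split.
  have := ib 1; apply: eq_integrable => // v _.
  by rewrite /comp -(ReIm_cexp z v).1; case: (cexp _) => p q /=; congr EFin; ring.
have := ib (- 'i); apply: eq_integrable => // v _.
by rewrite /comp -(ReIm_cexp z v).2; case: (cexp _) => p q /=; congr EFin; ring.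
Qed.

Lemma Re_laplace_upto (f : R -> R) (u : R) (w : R[i]) : tame f ->
  complex.Re (w * laplace_upto u f z) =
  \int[mu]_(v in `[0, u]) (rexp w (- z) v * f v).
Proof.
move=> tf; have [i1 i2] := integrable_cexp_mul u tf.
rewrite /laplace_upto Re_Cintegral//.
apply: eq_Rintegral => v _; rewrite /rexp mulNr (mulrC z).
by move: (cexp _) => [p q]; case: w => p' q' /=; ring.
Qed.

(** By [C1_funE] this is C1 read as a function of the starting point, in the
    form in which its harmonicity is visible. *)
Definition C1_fun (w : R[i]) (B : R) (x : R) : R :=
  1 * exp_fun z w B x +
  (- 1) * scale_fun r z (w * (cumulant a lam F z - s%:C)) B x.

Lemma C1_funE w B x : 0 <= B -> 0 <= x ->
  C1_fun w B x = complex.Re (w * C1 (cumulant a lam F) r s (B - x) z).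
Proof.
move=> B0 x0; have tr : tame r by case: Hr.
rewrite /C1_fun mul1r mulN1r /exp_fun /killed x0 (scale_funE Hr)//.
rewrite /C1; case: ifPn => y0.
  by rewrite set_itv_ge ?Rintegral_set0 ?subr0// bnd_simp -ltNge.
set kap := cumulant a lam F z - s%:C; set LU := laplace_upto _ _ _.
have -> : w * (cexp (z * (B - x)%:C) * (1 - kap * LU)) =
  w * cexp (z * (B - x)%:C) - (w * kap * cexp (z * (B - x)%:C)) * LU by ring.
have ReB (p q : R[i]) : complex.Re (p - q) = complex.Re p - complex.Re q by case: p; case: q.
rewrite ReB; congr (_ - _).
rewrite /LU Re_laplace_upto//; apply: eq_Rintegral => u _; congr (_ * _).
by rewrite rexpD /rexp rmorphN mulrN mulNr.
Qed.

Lemma bdd_C1_fun w B : 0 <= B -> bdd (C1_fun w B).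
Proof.
move=> B0; apply: bdd_lin; first exact: bdd_exp_fun.
exact: (bdd_scale_fun Hr).
Qed.

Lemma harmonic_C1_fun w B l x : 0 <= B -> 0 <= l -> l <= x -> x <= B ->
  Qop L F a s l (C1_fun w B) x = C1_fun w B x.
Proof.
move=> B0 l0 lx xB; rewrite Qop_lin//; last 2 first.
- exact: bdd_exp_fun.
- exact: (bdd_scale_fun Hr).
rewrite (Qop_exp_fun a0 lam0 s0 LE F1)// (Qop_scale_fun a0 lam0 s0 LE F1 Hr)//.
by rewrite /C1_fun; ring.
Qed.

End harmonic_C1.

(** * The functions K *)
Section shifts.
Context {R : realType}.
Local Notation mu := (@lebesgue_measure R).
Local Notation D := (`[0, +oo[%classic : set R).

Lemma tame_shift (f : R -> R) (y : R) : tame f ->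
  tame ((fun u => f (y + u)) \_ D).
Proof.
move=> tf; split.
- apply: (proj1 (measurable_restrictT _ _)); first exact: measurable_itv.
  apply: measurable_funTS; apply: (measurableT_comp (tame_measurable tf)).
  exact: measurable_funD.
- by move=> x x0; rewrite patchE memNset//= in_itv/= leNgt x0.
- move=> M; have [C fC] := tame_bounded tf (y + M); exists C => x xM.
  rewrite patchE; case: ifP => _; first by rewrite fC// lerD2l.
  by rewrite normr0 (le_trans _ (fC (y + M) (lexx _))).
- move=> x; have [x0|x0] := ltP x 0.
    rewrite [X in _ --> X]patchE memNset/= ?in_itv/= ?leNgt ?x0//.
    apply: cvg_near_cst; near=> t; rewrite patchE memNset//= in_itv/= leNgt.
    have -> : t < 0 by near: t; apply: nbhs_right_lt.
    by [].
  rewrite [X in _ --> X]patchE mem_set/= ?in_itv/= ?x0//.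
  have /cvg_at_rightP rc := @tame_cvg R f (y + x) tf.
  apply/cvg_at_rightP => u [ux uc].
  rewrite (_ : (fun n => _) = (fun n => f (y + u n))).
    apply: rc; split; first by move=> n; rewrite ltrD2l.
    by apply: cvgD => //; exact: cvg_cst.
  apply/funext => n; rewrite patchE mem_set//= in_itv/= (le_trans x0)//=.
  by rewrite ltW.
Unshelve. all: by end_near. Qed.

Lemma exp_integrable_shift (f : R -> R) (y z : R) : exp_integrable mu f z ->
  exp_integrable mu (fun u => f (y + u)) z /\
  lap mu (fun u => f (y + u)) z = expR (y * z) * lap mu f z.
Proof.
move=> jf.
have E : (fun u => expR (- (u * z)) * f (y + u)) =
    (fun u => expR (y * z) * (expR (- ((1 * u + y) * z)) * f (1 * u + y))).
  apply/funext => u; rewrite mul1r mulrA -expRD (addrC u); congr (expR _ * _).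
  by ring.
have ji := @integrable_affine R 1 y _ (oner_neq0 _) jf.
split; first by rewrite /exp_integrable E; exact: integrable_scale.
rewrite /lap E RintegralZl//; congr (_ * _).
have := @Rintegral_affine R 1 y _ (oner_neq0 _) (integrable_measurable jf).
by rewrite normr1 invr1 mul1r.
Qed.

Lemma exp_integrable_patch (f : R -> R) (z : R) : exp_integrable mu f z ->
  exp_integrable mu (f \_ D) z.
Proof.
move=> jf.
have mD : measurable (D : set (measurableTypeR R)) by exact: measurable_itv.
have := integrable_patch mD (integrableS measurableT mD (@subsetT _ _) jf).
by apply: eq_integrable => // u _ /=; rewrite !patchE; case: ifP => //; rewrite mulr0.
Qed.
End shifts.

Section K_representation.
Context {R : realType}.
Local Notation mu := (@lebesgue_measure R).
Local Notation D := (`[0, +oo[%classic : set R).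

Lemma patch_id (f : R -> R) : (forall x : R, x < 0 -> f x = 0) -> f \_ D = f.
Proof.
move=> f0; apply/funext => u; rewrite patchE; case: ifPn => //.
rewrite notin_setE/= in_itv/= andbT => /negP; rewrite -ltNge => u0.
by rewrite f0.
Qed.

Lemma patch_neg (f : R -> R) (x : R) : x < 0 -> (f \_ D) x = 0.
Proof. by move=> x0; rewrite patchE memNset//= in_itv/= leNgt x0. Qed.

Lemma patch_pos (f : R -> R) (x : R) : 0 <= x -> (f \_ D) x = f x.
Proof. by move=> x0; rewrite patchE mem_set//= in_itv/= x0. Qed.

Lemma patch_right (f : R -> R) (x : R) : 0 <= x ->
  f v @[v --> x^'+] --> f x -> (f \_ D) t @[t --> x^'+] --> (f \_ D) x.
Proof.
move=> x0 /cvg_at_rightP rc; rewrite (patch_pos _ x0); apply/cvg_at_rightP => u [ux uc].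
rewrite (_ : (fun n => _) = (fun n => f (u n))); first exact: rc.
by apply/funext => n; rewrite patch_pos// (le_trans x0)// ltW.
Qed.

(** k(z) - s on the real axis, in the form that appears in the renewal equation
    and that is visibly positive for large z. *)
Definition psi (a lam s : R) (F : probability (measurableTypeR R) R) (z : R) : R :=
  a * (z - (lam + s) / a) + lam * lap F pos_jump z.

Lemma cumulant_psi (a lam s : R) (F : probability (measurableTypeR R) R) (z : R) : 0 < a -> F [set y | 0 < y] = 1%E -> 0 <= z ->
  cumulant a lam F z%:C - s%:C = (psi a lam s F z)%:C.
Proof.
move=> a0 F1 z0; rewrite cumulant_real// -rmorphB; congr (_%:C).
by rewrite /psi; field; rewrite gt_eqF.
Qed.

Lemma psi_gt0 (a lam s : R) (F : probability (measurableTypeR R) R) (z : R) : 0 < a -> 0 < lam -> (lam + s) / a < z ->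
  0 < psi a lam s F z.
Proof.
move=> a0 lam0 zc; rewrite /psi ltr_wpDr ?mulr_ge0 ?(ltW lam0)//.
  by apply: Rintegral_ge0 => u _; rewrite mulr_ge0 ?expR_ge0.
by rewrite mulr_gt0// subr_gt0.
Qed.

Variables (a1 a2 lam1 lam2 s c1s c2s : R).
Variables (F1 F2 : probability (measurableTypeR R) R) (r1 : R -> R) (K : R -> R -> R).
Hypotheses (a10 : 0 < a1) (a20 : 0 < a2) (lam10 : 0 < lam1) (lam20 : 0 < lam2).
Hypothesis s0 : 0 <= s.
Hypotheses (F1pos : F1 [set y | 0 < y] = 1%E) (F2pos : F2 [set y | 0 < y] = 1%E).
Hypothesis Hr1 : is_resolvent (cumulant a1 lam1 F1) a1 c1s s r1.
Hypothesis HK : is_Kfun (cumulant a1 lam1 F1) (cumulant a2 lam2 F2) c1s c2s s r1 K.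

Let rneg1 : forall x : R, x < 0 -> r1 x = 0. Proof. by case: Hr1. Qed.
Let rright1 : forall x : R, 0 <= x -> r1 t @[t --> x^'+] --> r1 x. Proof. by case: Hr1. Qed.
Let rlap1 (x : R) : c1s < x ->
  laplace_cvg r1 x%:C /\ laplace r1 x%:C = (cumulant a1 lam1 F1 x%:C - s%:C)^-1.
Proof. by case: Hr1 => h _ _ _ xc; exact: (h x%:C). Qed.

Lemma resolvent1_eq : resolvent_eq a1 lam1 s F1 r1.
Proof. exact: (resolvent_eqP a10 lam10 s0 F1pos rneg1 rright1 rlap1). Qed.

Let tr1 : tame r1. Proof. by case: resolvent1_eq. Qed.

(* All transforms are compared on the real half-line [Z, +oo[, which lies to the
   right of the abscissas of the hypotheses and on which both functions psi are
   positive. *)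
Let d1 := (lam1 + s) / a1.
Let d2 := (lam2 + s) / a2.
Let Z := `|c1s| + d1 + 1 + (`|c2s| + d2 + 1).

Let d10 : 0 < d1. Proof. by rewrite divr_gt0// ltr_wpDr. Qed.
Let d20 : 0 < d2. Proof. by rewrite divr_gt0// ltr_wpDr. Qed.
Let Zge (z : R) : Z <= z -> [/\ 0 <= z, `|c1s| + d1 + 1 <= z, d1 < z, d2 < z &
  Num.max c1s c2s < z].
Proof.
move=> zZ; have := (ler_norm c1s, ler_norm c2s, normr_ge0 c1s, normr_ge0 c2s).
move: zZ d10 d20; rewrite /Z gt_max.
move: d1 d2 (`|c1s|) (`|c2s|) => e1 e2 n1 n2 zZ e10 e20 [[[h1 h2] h3] h4].
by split; try apply/andP; try split; lra.
Qed.

Let psi1_gt0 (z : R) : Z <= z -> 0 < psi a1 lam1 s F1 z.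
Proof. by case/Zge => _ _ ? _ _; exact: psi_gt0. Qed.
Let psi2_gt0 (z : R) : Z <= z -> 0 < psi a2 lam2 s F2 z.
Proof. by case/Zge => _ _ _ ? _; exact: psi_gt0. Qed.

Let lap_r1 (z : R) : Z <= z -> lap mu r1 z = (psi a1 lam1 s F1 z)^-1.
Proof.
move=> zZ; have [_ zz _ _ _] := Zge zZ.
have := lap_resolvent a10 lam10 s0 F1pos rneg1 rlap1 zz.
rewrite -/(psi a1 lam1 s F1 z) => /(canRL (mulfK _)) ->; first by rewrite mul1r.
by rewrite gt_eqF// psi1_gt0.
Qed.

Let jr1 (z : R) : Z <= z -> exp_integrable mu r1 z.
Proof.
move=> zZ; have [_ _ _ _] := Zge zZ; rewrite gt_max => /andP[/rlap1[+ _] _].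
by move=> /laplace_cvg_real; rewrite patch_id.
Qed.

Let f1 (y : R) := (fun u => r1 (y + u)) \_ D.

Let lapK (y z : R) : Z <= z -> exp_integrable mu (K y \_ D) z /\
  lap mu (K y \_ D) z = psi a1 lam1 s F1 z / psi a2 lam2 s F2 z * lap mu (f1 y) z.
Proof.
move=> zZ; have [z0 _ _ _ zc] := Zge zZ.
have [/(_ z%:C zc) [kc kl] _] := HK y.
split; first exact: laplace_cvg_real.
move: kl; rewrite !laplace_real (cumulant_psi _ _ a10 F1pos)// (cumulant_psi _ _ a20 F2pos)//.
by rewrite -fmorphV -!rmorphM => -[].
Qed.

Let Kright (y x : R) : 0 <= x -> (K y \_ D) t @[t --> x^'+] --> (K y \_ D) x.
Proof. by move=> x0; apply: patch_right => //; have [_] := HK y; exact. Qed.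

(** The resolvent of the second process is K_0, since the transform of r1
    cancels the factor k1 - s in the transform of K_0. *)
Definition resolvent2 : R -> R := K 0 \_ D.

Let f10 : f1 0 = r1.
Proof.
have E : (fun u => r1 (0 + u)) = r1 by apply/funext => u; rewrite add0r.
by rewrite /f1 E patch_id.
Qed.

Let jr2 (z : R) : Z <= z -> exp_integrable mu resolvent2 z.
Proof. by move=> zZ; have [] := lapK 0 zZ. Qed.

Let lap_r2 (z : R) : Z <= z -> lap mu resolvent2 z = (psi a2 lam2 s F2 z)^-1.
Proof.
move=> zZ; have [_ ->] := lapK 0 zZ; rewrite f10 lap_r1//.
by rewrite mulrAC mulfV ?mul1r// gt_eqF// psi1_gt0.
Qed.

Let rneg2 (x : R) : x < 0 -> resolvent2 x = 0. Proof. exact: patch_neg. Qed.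
Let rright2 (x : R) : 0 <= x -> resolvent2 t @[t --> x^'+] --> resolvent2 x. Proof. exact: Kright. Qed.
Let rlap2 (x : R) : Z < x -> laplace_cvg resolvent2 x%:C /\
  laplace resolvent2 x%:C = (cumulant a2 lam2 F2 x%:C - s%:C)^-1.
Proof.
move=> /ltW zZ; have [z0 _ _ _ zc] := Zge zZ.
split.
  apply: (@integrableS _ _ _ mu setT) => //; exact: jr2.
rewrite laplace_real (patch_id rneg2) lap_r2// (cumulant_psi _ _ a20 F2pos)//.
by rewrite fmorphV.
Qed.

Lemma resolvent2_eq : resolvent_eq a2 lam2 s F2 resolvent2.
Proof. exact: (resolvent_eqP a20 lam20 s0 F2pos rneg2 rright2 rlap2). Qed.

Let tr2 : tame resolvent2. Proof. by case: resolvent2_eq. Qed.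

(** For y <= 0 the shift by y multiplies transforms of causal functions by
    exp(y z), on both sides. *)
Lemma K_nonpos (y u : R) : y <= 0 -> 0 <= u -> K y u = resolvent2 (y + u).
Proof.
move=> y0 u0; rewrite -(patch_pos (K y) u0).
have ge : (fun u => resolvent2 (y + u)) = (fun u => resolvent2 (y + u)) \_ D.
  by rewrite patch_id// => x x0; rewrite rneg2//; lra.
have tg : tame (fun u => resolvent2 (y + u)) by rewrite ge; exact: tame_shift.
have fe : f1 y = (fun u => r1 (y + u)).
  by rewrite /f1 patch_id// => x x0; rewrite rneg1//; lra.
apply: (@lap_inj R (K y \_ D) (fun u => resolvent2 (y + u)) Z) => //.
- by move=> x x0; rewrite patch_neg// rneg2//; lra.
- by move=> x x0; exact: Kright.
- by move=> x x0; exact: tame_cvg tg.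
- by move=> x x0; rewrite rneg2//; lra.
- by move=> z /(lapK y)[].
- by move=> z /jr2 /(exp_integrable_shift y)[].
- move=> z zZ; have [_ ->] := lapK y zZ.
  have [_ ->] := exp_integrable_shift y (jr2 zZ).
  rewrite fe; have [_ ->] := exp_integrable_shift y (jr1 zZ).
  rewrite lap_r1// lap_r2//; have := psi1_gt0 zZ; have := psi2_gt0 zZ.
  move: (psi a1 _ _ _ _) (psi a2 _ _ _ _) (expR _) => p1 p2 e p20 p10.
  by field; rewrite !gt_eqF.
Qed.

Let al := (a1 / a2) * (lam2 + s) - (lam1 + s).

(** The function with transform (k1 - s) / (k2 - s) - a1 / a2. The quotient
    tends to a1 / a2 at infinity; without this constant the numerator is
    al + lam1 F1^ - (a1 / a2) lam2 F2^, in which the terms linear in z have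
    cancelled. *)
Definition rho (v : R) : R :=
  al * resolvent2 v + 1 * (lam1 * jump_conv F1 resolvent2 v + (- (a1 / a2 * lam2)) * jump_conv F2 resolvent2 v).

Let jq (F : probability (measurableTypeR R) R) (z : R) : F [set y | 0 < y] = 1%E -> Z <= z ->
  exp_integrable mu (jump_conv F resolvent2) z /\
  lap mu (jump_conv F resolvent2) z = lap F pos_jump z / psi a2 lam2 s F2 z.
Proof.
move=> Fpos zZ; have [z0 _ _ _ _] := Zge zZ.
have mp : measurable_fun setT (@pos_jump R) by apply: measurable_indic; exact: measurable_itv.
have m2 := tame_measurable tr2.
have jp := exp_integrable_pos_jump F z0.
split; first exact: (exp_integrable_conv mp m2 jp (jr2 zZ)).
by rewrite /jump_conv (lap_conv mp m2 jp (jr2 zZ)) lap_r2.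
Qed.

Let lap_rho (z : R) : Z <= z -> exp_integrable mu rho z /\
  lap mu rho z = psi a1 lam1 s F1 z / psi a2 lam2 s F2 z - a1 / a2.
Proof.
move=> zZ; have [j1 l1] := jq F1pos zZ; have [j2 l2] := jq F2pos zZ.
have [jj ll] := exp_integrable_lin lam1 (- (a1 / a2 * lam2)) j1 j2.
have [jjj lll] := exp_integrable_lin al 1 (jr2 zZ) jj.
split => //; rewrite [LHS]lll ll l1 l2 lap_r2//.
have := psi2_gt0 zZ => p2.
have [a1n a2n] : a1 != 0 /\ a2 != 0 by rewrite !gt_eqF.
move: (erefl (psi a2 lam2 s F2 z)) (erefl (psi a1 lam1 s F1 z)).
rewrite {2}/psi {3}/psi.
move: (lap F1 _ z) (lap F2 _ z) (psi a1 _ _ _ _) (psi a2 _ _ _ _) p2 => e1 e2 P1 P p2 PE P1E.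
have Pn : P != 0 by rewrite gt_eqF.
transitivity ((al + lam1 * e1 - a1 / a2 * lam2 * e2) / P); first by ring.
have -> : P1 / P - a1 / a2 = (P1 - a1 / a2 * P) / P by field; apply/andP.
by congr (_ / P); rewrite P1E PE /al; field; apply/andP.
Qed.

Lemma rho_exp_integrable : exists2 z, 0 <= z & exp_integrable mu rho z.
Proof. by exists Z; [case: (Zge (lexx Z))|case: (lap_rho (lexx Z))]. Qed.

Let mrho : measurable_fun setT rho.
Proof. exact: exp_integrable_measurable (lap_rho (lexx Z)).1. Qed.

Lemma rho_causal (x : R) : x < 0 -> rho x = 0.
Proof.
move=> x0; rewrite /rho rneg2// (jump_conv_causal F1 rneg2)// (jump_conv_causal F2 rneg2)//.
by rewrite !mulr0 addr0 mulr0 addr0.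
Qed.

(** K_y is a mixture of the shifts r1(y + u - v) of the first resolvent with
    weights that do not depend on y. Hence K_{b - x} is, as a function of x,
    a mixture of harmonic functions of the first process. *)
Lemma K_representation (y u : R) : 0 <= u ->
  K y u = a1 / a2 * r1 (y + u) + conv mu rho (f1 y) u.
Proof.
move=> u0; rewrite -(patch_pos (K y) u0).
have [Z0 _ _ _ _] := Zge (lexx Z).
have tf := tame_shift y tr1.
have jf (z : R) : Z <= z -> exp_integrable mu (f1 y) z.
  by move=> zZ; apply: exp_integrable_patch; have [] := exp_integrable_shift y (jr1 zZ).
have tc := conv_tame mrho rho_causal Z0 (lap_rho (lexx Z)).1 tf (jf _ (lexx Z)).
have tg := tame_lin (a1 / a2) 1 tf tc.
have e : r1 (y + u) = f1 y u by rewrite /f1 (patch_pos (fun u => r1 (y + u)) u0).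
rewrite e -[X in _ + X]mul1r.
have jc (z : R) (zZ : Z <= z) := exp_integrable_conv mrho (tame_measurable tf) (lap_rho zZ).1 (jf _ zZ).
apply: (@lap_inj R (K y \_ D) (fun u => a1 / a2 * f1 y u + 1 * conv mu rho (f1 y) u) Z) => //.
- by move=> x x0; rewrite patch_neg// (tame_causal tg x0).
- by move=> x x0; exact: Kright.
- by move=> x x0; exact: tame_cvg tg.
- by move=> x x0; rewrite (tame_causal tg x0).
- by move=> z /(lapK y)[].
- by move=> z zZ; exact: (exp_integrable_lin _ _ (jf _ zZ) (jc _ zZ)).1.
- move=> z zZ; have [_ ->] := lapK y zZ.
  rewrite (exp_integrable_lin _ _ (jf _ zZ) (jc _ zZ)).2.
  rewrite (lap_conv mrho (tame_measurable tf) (lap_rho zZ).1 (jf _ zZ)) (lap_rho zZ).2.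
  by ring.
Qed.

Lemma K_patch_tame (y : R) : tame (K y \_ D).
Proof.
have [Z0 _ _ _ _] := Zge (lexx Z).
have tf := tame_shift y tr1.
have jf : exp_integrable mu (f1 y) Z.
  apply: exp_integrable_patch.
  by have [] := exp_integrable_shift y (jr1 (lexx Z)).
have tc := conv_tame mrho rho_causal Z0 (lap_rho (lexx Z)).1 tf jf.
have tg := tame_lin (a1 / a2) 1 tf tc.
have -> // : K y \_ D = (fun x => a1 / a2 * f1 y x + 1 * conv mu rho (f1 y) x).
apply/funext => x; have [x0|x0] := ltP x 0.
  by rewrite patch_neg// (tame_causal tg x0).
rewrite patch_pos// K_representation// mul1r; congr (_ * _ + _).
by rewrite /f1 (patch_pos (fun u => r1 (y + u)) x0).
Qed.

End K_representation.

(** * Harmonic functions of the oscillating process *)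

Section Qop_congruence.
Context {R : realType}.
Variables (L F : probability (measurableTypeR R) R) (a lam s : R).
Hypotheses (a0 : 0 < a) (lam0 : 0 < lam) (s0 : 0 <= s).
Hypothesis F1 : F [set y | 0 < y] = 1%E.

Lemma Qop_congr (f g : R -> R) (l x : R) : bdd f -> bdd g ->
  (forall y, l <= y -> f y = g y) -> l <= x ->
  Qop L F a s l f x = Qop L F a s l g x.
Proof.
move=> bf bg fg lx; apply: eq_Rintegral => t _.
rewrite (inner_onestep F a s l x t bf) (inner_onestep F a s l x t bg) fg//.
case: ifP => // atx; congr (_ * _).
rewrite (Rintegral_pos_jump F1 (bdd_shift _ bf).1) (Rintegral_pos_jump F1 (bdd_shift _ bg).1).
apply: eq_Rintegral => v _; rewrite /pos_jump indicE.
case: (boolP (v \in _)); rewrite ?mul0r// inE/= in_itv/= andbT => v0.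
by rewrite fg//; move: atx v0; lra.
Qed.
End Qop_congruence.

Section harmonic_functions.
Context {R : realType}.
Local Notation mu := (@lebesgue_measure R).
Local Notation D := (`[0, +oo[%classic : set R).

Variables (a1 a2 lam1 lam2 s c1s c2s b B : R).
Variables (L1 L2 F1 F2 : probability (measurableTypeR R) R).
Variables (r1 : R -> R) (K : R -> R -> R).
Hypotheses (a10 : 0 < a1) (a20 : 0 < a2) (lam10 : 0 < lam1) (lam20 : 0 < lam2).
Hypothesis s0 : 0 <= s.
Hypotheses (F1pos : F1 [set y | 0 < y] = 1%E) (F2pos : F2 [set y | 0 < y] = 1%E).
Hypothesis L1E : forall A, measurable A -> L1 A = exponential_prob lam1 A.
Hypothesis L2E : forall A, measurable A -> L2 A = exponential_prob lam2 A.
Hypotheses (b0 : 0 <= b) (bB : b <= B).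
Let k1 := cumulant a1 lam1 F1.
Let k2 := cumulant a2 lam2 F2.
Hypothesis Hr1 : is_resolvent k1 a1 c1s s r1.
Hypothesis HK : is_Kfun k1 k2 c1s c2s s r1 K.

Let B0 : 0 <= B. Proof. exact: le_trans bB. Qed.
Let u := B - b.
Let u0 : 0 <= u. Proof. by rewrite subr_ge0. Qed.

Let E1 : resolvent_eq a1 lam1 s F1 r1 := resolvent1_eq a10 lam10 s0 F1pos Hr1.
Let E2 : resolvent_eq a2 lam2 s F2 (resolvent2 K) :=
  resolvent2_eq a10 a20 lam10 lam20 s0 F1pos F2pos Hr1 HK.
Let tr1 : tame r1. Proof. by case: E1. Qed.
Let tr2 : tame (resolvent2 K). Proof. by case: E2. Qed.

Let rh : R -> R := rho a1 a2 lam1 lam2 s F1 F2 K.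
Let rh_exp : exists2 z, 0 <= z & exp_integrable mu rh z :=
  rho_exp_integrable a10 a20 lam10 lam20 s0 F1pos F2pos Hr1 HK.
Let KE := K_representation a10 a20 lam10 lam20 s0 F1pos F2pos Hr1 HK.
Let Kneg := K_nonpos a10 a20 lam10 lam20 s0 F1pos F2pos Hr1 HK.

Let mrh : measurable_fun setT rh.
Proof. by have [z _ /exp_integrable_measurable] := rh_exp. Qed.

Let irh v : mu.-integrable setT (EFin \o (rh \_ `[0, v])).
Proof.
have [z z0 iz] := rh_exp.
have mI : measurable (`[0, v]%classic : set (measurableTypeR R)) by exact: measurable_itv.
have ib : mu.-integrable setT
    (EFin \o (fun t => expR (v * z) * `|expR (- (t * z)) * rh t|)).
  by apply: integrable_scale => //; exact: integrable_norm iz.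
apply: (integrable_dominated _ _ _ ib) => //.
  exact: (proj1 (measurable_restrictT _ mI) (measurable_funTS mrh)).
move=> t _; rewrite patchE; case: ifPn => [|_]; last by rewrite normr0 mulr_ge0 ?expR_ge0.
rewrite inE/= in_itv/= => /andP[t0 tv].
rewrite normrM (ger0_norm (expR_ge0 _)) mulrA -expRD -[leLHS]mul1r.
by rewrite ler_wpM2r// -expR0 ler_expR -mulrBl mulr_ge0// subr_ge0.
Qed.

Let ker v (yp : R * R) : R := killed (fun y => r1 (b + v - `|yp.2| - y)) yp.1.

Let mker v : measurable_fun setT (ker v).
Proof.
apply: measurable_fun_ifT => //; first by apply: measurable_fun_ler => //; exact: measurable_fst.
apply: (measurableT_comp (tame_measurable tr1)).
apply: measurable_funB; last exact: measurable_fst.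
by apply: measurable_funB => //; apply: measurableT_comp => //; exact: measurable_snd.
Qed.

(* A bound of r1 on ]-oo, B], and hence of all the kernels. *)
Let C := xget 0 [set C : R | 0 <= C /\ forall x, x <= B -> `|r1 x| <= C].
Let CP : 0 <= C /\ forall x, x <= B -> `|r1 x| <= C.
Proof.
rewrite /C; case: xgetP => [? _ []//|].
have [c rc] := tame_bounded tr1 B; move=> /(_ c) []; split => //.
exact: le_trans (rc B (lexx _)).
Qed.

Let ker_bound (v : R) p : v <= u -> `|ker v p| <= C.
Proof.
case: p => y t vu; rewrite /ker /killed/=; case: ifP => y0; last by rewrite normr0 CP.1.
apply: CP.2; rewrite -addrA -opprD lerBlDr.
have : b + v <= B by move: vu; rewrite /u; lra.
by move=> /le_trans; apply; rewrite lerDl addr_ge0.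
Qed.

(* K_{b - x}(v) as a mixture of resolvents at the levels b + v - t for
   0 <= t <= v. All of them are at or above b, whence the atoms of
   [Qop_resolvent] do not occur for x <= b. *)
Let kap v : R -> R := fun x =>
  (a1 / a2) * killed (fun y => r1 (b + v - y)) x +
  1 * superpose mu (rh \_ `[0, v]) (ker v) x.

Let kap_neg (v x : R) : x < 0 -> kap v x = 0.
Proof.
move=> x0; rewrite /kap {1}/killed leNgt x0/= mulr0 add0r mul1r /superpose.
rewrite (_ : (fun p => _) = cst 0) ?Rintegral_cst ?mul0r//.
by apply/funext => p; rewrite /ker /killed/= leNgt x0/= mulr0.
Qed.

Let kapE (v x : R) : 0 <= v -> 0 <= x -> kap v x = K (b - x) v.
Proof.
move=> v0 x0; rewrite (KE (b - x) v0) /kap {1}/killed x0 mul1r.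
congr (_ * r1 _ + _); first by ring.
apply: eq_Rintegral => t _; rewrite /ker /killed/= x0.
have [t0|t0] := ltP t 0.
  rewrite [X in X * _]patchE memNset/= ?in_itv/= ?leNgt ?t0//.
  by rewrite (rho_causal a1 a2 lam1 lam2 s F1 F2 K t0) !mul0r.
have [tv|tv] := leP t v.
  rewrite [X in X * _]patchE mem_set/= ?in_itv/= ?t0 ?tv//.
  rewrite (patch_pos (fun u => r1 (b - x + u))) ?subr_ge0//.
  by congr (_ * r1 _); rewrite ger0_norm//; ring.
rewrite [X in X * _]patchE memNset/= ?in_itv/= ?t0 ?leNgt ?tv//.
by rewrite (patch_neg (fun u => r1 (b - x + u))) ?subr_lt0// mul0r mulr0.
Qed.

Let kap_bdd (v : R) : v <= u -> bdd (kap v).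
Proof.
move=> vu; apply: bdd_lin; first exact: (bdd_resolvent E1).
split; first exact: (measurable_superpose (irh v) (mker v)).
by eexists => x; exact: (superpose_bounded (irh v) (mker v) (fun p => ker_bound p vu) x).
Qed.

Let harmonic_kap (v x : R) : 0 <= v -> v <= u -> 0 <= x -> x <= b ->
  Qop L1 F1 a1 s 0 (kap v) x = kap v x.
Proof.
move=> v0 vu x0 xb.
have b1 : bdd (killed (fun y => r1 (b + v - y))) := bdd_resolvent E1 (b + v).
have b2 : bdd (superpose mu (rh \_ `[0, v]) (ker v)).
  split; first exact: (measurable_superpose (irh v) (mker v)).
  by eexists => y; exact: (superpose_bounded (irh v) (mker v) (fun p => ker_bound p vu) y).
rewrite /kap Qop_lin// (Qop_resolvent a10 lam10 s0 L1E F1pos E1 _ (lexx 0) x0).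
have -> : (b + v - x < 0 <= b + v - 0)%R = false.
  by apply/negbTE; rewrite negb_and -leNgt; apply/orP; left; lra.
rewrite mul0r addr0; congr (_ + _ * _).
rewrite (Qop_superpose L1 F1 a10 s0 (irh v) (mker v) (fun p => ker_bound p vu) x0).
apply: eq_Rintegral => t _; rewrite patchE; case: ifPn => [|_]; last by rewrite !mul0r.
rewrite inE/= in_itv/= => /andP[t0 tv].
have := Qop_resolvent a10 lam10 s0 L1E F1pos E1 (b + v - `|t|) (lexx 0) x0.
have -> : (b + v - `|t| - x < 0 <= b + v - `|t| - 0)%R = false.
  by apply/negbTE; rewrite negb_and -leNgt; apply/orP; left; rewrite ger0_norm//; lra.
by rewrite mul0r addr0 => E; congr (_ * _); exact: E.
Qed.

(** The candidate for a multiple of the discounted probability of leaving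
    through 0. Below b it is a mixture of resolvents of the first process;
    above b it is the resolvent of the second process at the level B. *)
Definition hit_fun : R -> R := killed (fun x => K (b - x) (B - b)).

Let hit_kap : hit_fun = kap u.
Proof.
apply/funext => x; rewrite /hit_fun /killed; case: ifPn => [x0|]; first by rewrite kapE.
by rewrite -ltNge => x0; rewrite kap_neg.
Qed.

Lemma bdd_hit_fun : bdd hit_fun.
Proof. by rewrite hit_kap; exact: kap_bdd. Qed.

Lemma harmonic_hit_below (x : R) : 0 <= x -> x <= b ->
  Qop L1 F1 a1 s 0 hit_fun x = hit_fun x.
Proof. by move=> x0 xb; rewrite hit_kap; exact: harmonic_kap. Qed.

Let hit_above_E (x : R) : b <= x -> hit_fun x = killed (fun y => resolvent2 K (B - y)) x.
Proof.
move=> bx; have x0 : 0 <= x by exact: le_trans bx.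
rewrite /hit_fun /killed x0 Kneg//; last by rewrite subr_le0.
by congr (resolvent2 K _); ring.
Qed.

Lemma harmonic_hit_above (x : R) : b <= x -> x <= B ->
  Qop L2 F2 a2 s b hit_fun x = hit_fun x.
Proof.
move=> bx xB; have b2 := bdd_resolvent E2 B.
rewrite (Qop_congr L2 a2 s F2pos bdd_hit_fun b2 hit_above_E bx) (hit_above_E bx).
rewrite (Qop_resolvent a20 lam20 s0 L2E F2pos E2 _ b0 bx).
have -> : (B - x < 0 <= B - b)%R = false.
  by apply/negbTE; rewrite negb_and -leNgt subr_ge0 xB.
by rewrite mul0r addr0.
Qed.

Lemma hit_fun_out (x : R) : B < x -> hit_fun x = 0.
Proof.
move=> Bx; have bx : b <= x by rewrite (le_trans bB)// ltW.
rewrite hit_above_E// /killed (tame_causal tr2) ?if_same//.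
by rewrite subr_lt0.
Qed.

Section fixed_argument.
Variables (z w : R[i]).
Hypothesis z0 : 0 <= complex.Re z.

(** The harmonic function whose value above B is the payoff
    Re (w exp(-z (x - B))), see [exit_fun_out]. *)
Definition exit_fun : R -> R :=
  killed (fun x => complex.Re (w * frakKz k1 k2 r1 K s (b - x) (B - b) z)).

Let K_tame := K_patch_tame a10 a20 lam10 lam20 s0 F1pos F2pos Hr1 HK.

Let w1 := w * cexp (u%:C * z).
Let w2 := w1 * (k2 z - s%:C).

Let exit_funE x : 0 <= x -> exit_fun x = complex.Re (w1 * C1 k1 r1 s (b - x) z) -
  \int[mu]_(v in `[0, u]) (rexp w2 (- z) v * K (b - x) v).
Proof.
move=> x0; rewrite /exit_fun /killed x0 /frakKz -/u.
set LU := laplace_upto _ _ _; set c := C1 _ _ _ _ _.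
have -> : w * (cexp (u%:C * z) * (c - (k2 z - s%:C) * LU)) = w1 * c - w2 * LU.
  by rewrite /w2 /w1; ring.
have ReB (p q : R[i]) : complex.Re (p - q) = complex.Re p - complex.Re q by case: p; case: q.
rewrite ReB; congr (_ - _).
have -> : LU = laplace_upto u (K (b - x) \_ D) z.
  rewrite /LU /laplace_upto /Cintegral; congr (_ +i* _); apply: eq_Rintegral => v;
    by rewrite inE/= in_itv/= => /andP[v0 _]; rewrite patch_pos.
rewrite Re_laplace_upto//.
by apply: eq_Rintegral => v; rewrite inE/= in_itv/= => /andP[v0 _]; rewrite patch_pos.
Qed.

Let W := rexp w2 (- z) \_ `[0, u].
Let f3 (xv : R * R) : R := if 0 <= xv.2 <= u then kap xv.2 xv.1 else 0.

Let iW : mu.-integrable setT (EFin \o W).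
Proof.
apply: integrable_patch; first exact: measurable_itv.
apply: continuous_compact_integrable; first exact: segment_compact.
by apply: continuous_subspaceT => t; exact: continuous_rexp.
Qed.

Let mf3 : measurable_fun setT f3.
Proof.
have mr := tame_measurable tr1.
apply: measurable_fun_ifT => //.
  apply: measurable_and; apply: measurable_fun_ler => //; exact: measurable_snd.
apply: measurable_funD; apply: measurable_funM => //.
  apply: measurable_fun_ifT => //.
    by apply: measurable_fun_ler => //; exact: measurable_fst.
  apply: (measurableT_comp mr).
  apply: measurable_funB; last exact: measurable_fst.
  by apply: measurable_funD => //; exact: measurable_snd.
pose G (xvt : (R * R) * R) : R :=
  (if 0 <= xvt.2 <= xvt.1.2 then rh xvt.2 else 0) *
  killed (fun y => r1 (b + xvt.1.2 - `|xvt.2| - y)) xvt.1.1.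
have mx : measurable_fun setT (fun p : (R * R) * R => p.1.1).
  exact: (measurableT_comp measurable_fst measurable_fst).
have mv : measurable_fun setT (fun p : (R * R) * R => p.1.2).
  exact: (measurableT_comp measurable_snd measurable_fst).
have mt : measurable_fun setT (fun p : (R * R) * R => p.2) by exact: measurable_snd.
have mG : measurable_fun setT G.
  apply: measurable_funM; apply: measurable_fun_ifT => //.
  - by apply: measurable_and; apply: measurable_fun_ler.
  - exact: (measurableT_comp mrh).
  - exact: measurable_fun_ler.
  - apply: (measurableT_comp mr); apply: measurable_funB => //.
    apply: measurable_funB; first exact: measurable_funD.
    exact: (measurableT_comp (@normr_measurable R setT)).
have := measurable_Rintegral_param mu mG.
apply: eq_measurable_fun => -[x v] _; rewrite /superpose; apply: eq_Rintegral => t _.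
rewrite /G /ker patchE/=; congr (_ * _).
by rewrite mem_setE in_itv.
Qed.

Let f3_bound p : `|f3 p| <= a1 / a2 * C + \int[mu]_t (C * `|(rh \_ `[0, u]) t|).
Proof.
have iC v : mu.-integrable setT (EFin \o (fun t => C * `|(rh \_ `[0, v]) t|)).
  by apply: integrable_scale => //; exact: integrable_norm (irh v).
have C0 := CP.1; have a120 : 0 <= a1 / a2 by rewrite divr_ge0// ltW.
case: p => x v; rewrite /f3/=; case: ifPn => [/andP[v0 vu]|_]; last first.
  rewrite normr0; apply: addr_ge0; first exact: mulr_ge0.
  by apply: Rintegral_ge0 => t _; rewrite mulr_ge0.
rewrite /kap mul1r (le_trans (ler_normD _ _))// lerD//.
  rewrite normrM (ger0_norm a120) ler_wpM2l// /killed; case: ifP => x0; last by rewrite normr0.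
  by apply: CP.2; move: vu; rewrite /u; lra.
rewrite (le_trans (superpose_bounded (irh v) (mker v) (fun p => ker_bound p vu) x))//.
apply: le_Rintegral => // t _; rewrite ler_wpM2l// !patchE.
case: ifPn => [|_]; last by rewrite normr0.
rewrite inE/= in_itv/= => /andP[t0 tv]; rewrite ifT// mem_setE in_itv/= t0/=.
exact: le_trans vu.
Qed.

(* Below b: a C1 function of the first process at level b, minus a mixture of
   the functions kap, hence harmonic for the first process. *)
Let exit_fun_sum :
  exit_fun = (fun x => 1 * C1_fun F1 a1 lam1 s r1 z w1 b x + (- 1) * superpose mu W f3 x).
Proof.
apply/funext => x; have [x0|x0] := ltP x 0.
  rewrite /exit_fun {1}/killed leNgt x0/= /C1_fun /exp_fun {1}/killed leNgt x0/=.
  rewrite /scale_fun /superpose.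
  rewrite (_ : (fun p => _) = cst 0); last first.
    by apply/funext => p; rewrite /killed/= leNgt x0/= mulr0.
  rewrite Rintegral_cst// mul0r !mulr0 !addr0 mulr0 add0r.
  rewrite (_ : (fun p => _) = cst 0) ?Rintegral_cst// ?mul0r ?mulr0//.
  by apply/funext => v; rewrite /f3/= kap_neg// if_same mulr0.
rewrite exit_funE// (C1_funE E1 z0 _ b0 x0) mul1r mulN1r; congr (_ - _).
rewrite Rintegral_mkcond /superpose; apply: eq_Rintegral => v _.
rewrite /W /f3 !patchE; case: ifPn => [|_]; last by rewrite mul0r.
by rewrite inE/= in_itv/= => v0u; rewrite v0u kapE//; case/andP: v0u.
Qed.

Let bdd_sup : bdd (superpose mu W f3).
Proof.
split; first exact: (measurable_superpose iW mf3).
by eexists => x; exact: (superpose_bounded iW mf3 f3_bound x).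
Qed.

Lemma bdd_exit_fun : bdd exit_fun.
Proof.
rewrite exit_fun_sum; apply: bdd_lin => //.
exact: (bdd_C1_fun E1 z0 _ b0).
Qed.

Lemma harmonic_exit_below (x : R) : 0 <= x -> x <= b ->
  Qop L1 F1 a1 s 0 exit_fun x = exit_fun x.
Proof.
move=> x0 xb; rewrite exit_fun_sum Qop_lin//; last exact: (bdd_C1_fun E1 z0 _ b0).
rewrite (harmonic_C1_fun a10 lam10 s0 L1E F1pos E1 z0 _ b0 (lexx 0) x0 xb).
congr (_ + _ * _).
rewrite (Qop_superpose L1 F1 a10 s0 iW mf3 f3_bound x0); apply: eq_Rintegral => v _.
rewrite /W patchE; case: ifPn => [|_]; last by rewrite !mul0r.
rewrite inE/= in_itv/= => v0u; congr (_ * _).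
have [v0 vu] := andP v0u.
have -> : (fun y => f3 (y, v)) = kap v by apply/funext => y; rewrite /f3/= v0u.
by rewrite harmonic_kap// /f3/= v0u.
Qed.

(* Above b the representation of K by the second resolvent makes this the C1
   function of the second process at level B. *)
Let exit_above_E (x : R) : b <= x -> exit_fun x = C1_fun F2 a2 lam2 s (resolvent2 K) z w B x.
Proof.
move=> bx; have x0 : 0 <= x by exact: le_trans bx.
have y0 : b - x <= 0 by rewrite subr_le0.
rewrite exit_funE// /C1_fun mul1r mulN1r (scale_funE E2 _ _ _ x0).
have -> : C1 k1 r1 s (b - x) z = cexp (z * (b - x)%:C).
  rewrite /C1; case: ifPn => // yn0.
  have {yn0}y0 : b - x = 0 by apply: le_anti; rewrite y0 leNgt.
  rewrite y0 /laplace_upto /Cintegral set_itv1 !Rintegral_set1.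
  rewrite -[RHS]mulr1 -[X in _ = _ * X]subr0; congr (_ * (_ - _)).
  apply: etrans (mulr0 (k1 z - s%:C)); congr (_ * _).
congr (_ - _).
  rewrite /exp_fun /killed x0 /w1 (mulrC u%:C).
  by rewrite -[LHS]/(rexp (w * cexp (z * u%:C)) z (b - x)) -rexpD; congr (rexp _ _ _); rewrite /u; ring.
have e v : rexp w2 (- z) v = rexp (w * (k2 z - s%:C)) z (u - v).
  rewrite rexpD /rexp rmorphN mulrN mulNr; congr (complex.Re (_ * _)).
  by rewrite /w2 /w1 (mulrC u%:C); ring.
pose phi (v : R) := ((fun v => rexp w2 (- z) v * resolvent2 K (b - x + v)) \_ `[0, u]) v.
have mphi : measurable_fun setT phi.
  apply: (proj1 (measurable_restrictT _ _)); first exact: measurable_itv.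
  apply: measurable_funTS; apply: measurable_funM; first exact: measurable_rexp.
  by apply: (measurableT_comp (tame_measurable tr2)); exact: measurable_funD.
transitivity (\int[mu]_v phi v).
  rewrite Rintegral_mkcond; apply: eq_Rintegral => v _; rewrite /phi !patchE.
  by case: ifPn => //; rewrite inE/= in_itv/= => /andP[v0 _]; rewrite Kneg.
have := @Rintegral_affine R 1 (- (b - x)) phi (oner_neq0 _) mphi.
rewrite normr1 invr1 mul1r => <-.
rewrite [RHS]Rintegral_mkcond; apply: eq_Rintegral => v _; rewrite mul1r /phi !patchE.
have -> : (v - (b - x) \in `[0, u]%classic) = (0 <= v - (b - x) <= u)%R by rewrite mem_setE in_itv.
have -> : (v \in `[0, B - x]%classic) = (0 <= v <= B - x)%R by rewrite mem_setE in_itv.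
have [v0|v0] := ltP v 0.
  rewrite /= [X in _ * resolvent2 K X](_ : _ = v); last by ring.
  by rewrite (tame_causal tr2 v0) mulr0 if_same.
have -> /= : (0 <= v - (b - x))%R by rewrite subr_ge0 (le_trans y0).
have -> : (v - (b - x) <= u) = (v <= B - x).
  by rewrite /u; apply/idP/idP; lra.
case: ifP => // _; rewrite e; congr (rexp _ _ _ * resolvent2 K _); last by ring.
by rewrite /u; ring.
Qed.

Lemma harmonic_exit_above (x : R) : b <= x -> x <= B ->
  Qop L2 F2 a2 s b exit_fun x = exit_fun x.
Proof.
move=> bx xB; have b2 := bdd_C1_fun E2 z0 w B0.
rewrite (Qop_congr L2 a2 s F2pos bdd_exit_fun b2 exit_above_E bx) (exit_above_E bx).
exact: (harmonic_C1_fun a20 lam20 s0 L2E F2pos E2 z0 _ B0 b0 bx xB).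
Qed.

Lemma exit_fun_out (x : R) : B < x -> exit_fun x = complex.Re (w * cexp (- (z * (x - B)%:C))).
Proof.
move=> Bx; have bx : b <= x by rewrite (le_trans bB)// ltW.
have x0 : 0 <= x by exact: le_trans bx.
rewrite exit_above_E// /C1_fun mul1r mulN1r (scale_funE E2 _ _ _ x0).
rewrite set_itv_ge ?Rintegral_set0 ?subr0; last by rewrite bnd_simp -ltNge subr_lt0.
rewrite /exp_fun /killed x0 /rexp; congr (complex.Re (_ * cexp _)).
by rewrite -mulrN -rmorphN opprB.
Qed.
End fixed_argument.
End harmonic_functions.

(** * Freezing an independent coordinate *)

Section independent_pair.
Context d (T : measurableType d) (R : realType) (P : probability T R).
Context d1 d2 (V1 : measurableType d1) (V2 : measurableType d2).
Variables (Y : {mfun T >-> V1}) (Z : {mfun T >-> V2}).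
Hypothesis indep : forall A B, measurable A -> measurable B ->
  P (Y @^-1` A `&` Z @^-1` B) = (P (Y @^-1` A) * P (Z @^-1` B))%E.

Lemma freeze_pair (phi : V1 * V2 -> R) (C : R) : measurable_fun setT phi ->
  (forall p, `|phi p| <= C) ->
  \int[P]_w phi (Y w, Z w) = \int[distribution P Y]_y \int[P]_w phi (y, Z w).
Proof.
move=> mphi phiC.
have mYZ : measurable_fun setT (fun w => (Y w, Z w)).
  by apply/measurable_fun_pair => /=; exact: measurable_funPT.
pose YZ : {mfun T >-> (V1 * V2)%type} :=
  HB.pack (fun w => (Y w, Z w)) (isMeasurableFun.Build _ _ _ _ _ mYZ).
have i2 (Q : probability _ R) : Q.-integrable setT (EFin \o phi).
  exact: integrable_bounded.
have mE : measurable_fun setT (EFin \o phi) by exact/measurable_EFinP.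
transitivity (\int[distribution P YZ]_p phi p).
  rewrite /Rintegral integral_distribution//.
  by apply: (integrable_bounded P (C := C)) => [|w /=] //; exact: measurableT_comp.
have prodE : forall X, measurable X ->
    (distribution P Y \x distribution P Z)%E X = distribution P YZ X.
  apply: product_measure_unique => A B mA mB; exact: indep.
transitivity (\int[(distribution P Y \x distribution P Z)%E]_p phi p).
  by congr fine; apply: eq_measure_integral => A mA _; exact: esym (prodE A mA).
rewrite -Rintegral12; last first.
  apply: (integrable_product (p := cst 1) (q := cst C)) => //.
  - exact: finite_measure_integrable_cst.
  - exact: finite_measure_integrable_cst.
  - by move=> y v; rewrite mul1r.
apply: eq_Rintegral => y _; rewrite /Rintegral integral_distribution//.
  by apply/measurable_EFinP; apply: (measurableT_comp mphi); exact: measurable_pair1.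
apply: (integrable_bounded P (C := C)) => [|w /=] //.
apply: (measurableT_comp (g := fun w => (y, Z w)) mphi).
by apply/measurable_fun_pair => //=; exact: measurable_funPT.
Qed.
End independent_pair.

Section independent_family.
Context d (T : measurableType d) (R : realType) (P : probability T R).
Variables (I : choiceType) (X : I -> {RV P >-> R}).
Hypothesis indep : mutually_independent X.
Variable i0 : I.

(** A pi-system that generates the sigma-algebra of all the coordinates except
    i0; mutual independence speaks of exactly these events. *)
Definition other_events : set (set T) := [set E | exists s A,
  [/\ uniq s, i0 \notin s, forall i, measurable (A i : set (measurableTypeR R)) &
      E = \big[setI/setT]_(i <- s) (X i @^-1` A i)]].

Local Notation others := (g_sigma_algebraType other_events).

Lemma measurable_other j : j != i0 -> measurable_fun setT (X j : others -> R).
Proof.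
move=> ji0 _ A mA; rewrite setTI; apply: sub_sigma_algebra.
by exists [:: j], (fun=> A); split; rewrite ?inE 1?eq_sym// big_seq1.
Qed.

Let mX i A : measurable (A : set (measurableTypeR R)) -> measurable (X i @^-1` A).
Proof. by move=> mA; rewrite -[X in measurable X]setTI; exact: measurable_funPT. Qed.

Let sub_events : other_events `<=` measurable.
Proof.
by move=> _ [s [A [_ _ mA ->]]]; apply: bigsetI_measurable => i _; exact: mX.
Qed.

Let events_setI : setI_closed other_events.
Proof.
move=> _ _ [s [A [us si mA ->]]] [s' [A' [us' si' mA' ->]]].
exists (undup (s ++ s')), (fun i => (if i \in s then A i else setT) `&`
  (if i \in s' then A' i else setT)); split.
- exact: undup_uniq.
- by rewrite mem_undup mem_cat negb_or si.
- by move=> i; apply: measurableI; case: ifP.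
rewrite -!bigcap_seq; apply/seteqP; split => w.
  move=> [h h'] i _ /=; split; case: ifP => // js; [exact: h | exact: h'].
move=> h; split => i /= js.
  have := h i; rewrite /= mem_undup mem_cat js => /(_ isT)[] //.
have := h i; rewrite /= mem_undup mem_cat js orbT => /(_ isT)[] //.
Qed.

Let measurable_others E : <<s other_events >> E -> measurable E.
Proof. exact: (smallest_sub (@sigma_algebra_measurable _ T) sub_events). Qed.

Let indep_others A E : measurable (A : set (measurableTypeR R)) ->
  <<s other_events >> E -> P (X i0 @^-1` A `&` E) = (P (X i0 @^-1` A) * P E)%E.
Proof.
move=> mA sE.
have PA : 0 <= fine (P (X i0 @^-1` A)) by rewrite fine_ge0.
have -> : P (X i0 @^-1` A) = (fine (P (X i0 @^-1` A)))%:E.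
  by rewrite fineK// fin_num_measure//; exact: mX.
rewrite setIC.
apply: (@g_sigma_algebra_measure_unique _ R T other_events sub_events (fun=> setT)
  _ _ (mrestr P (mX i0 mA)) (mscale (NngNum PA) P)) => //.
- move=> _; exists [::], (fun=> setT); split; rewrite ?big_nil//.
- by apply/seteqP; split => // w _; exists 0%N.
- move=> _ [s [A' [us si mA' ->]]] /=.
  rewrite /mrestr /mscale /= fineK ?fin_num_measure//; last exact: mX.
  pose A_ i := if i == i0 then A else A' i.
  have As (op : Type) : \big[setI/setT]_(i <- s) (X i @^-1` A' i) =
      \big[setI/setT]_(i <- s) (X i @^-1` A_ i).
    rewrite big_seq [RHS]big_seq; apply: eq_bigr => i js.
    by rewrite /A_ (negbTE (memPn si _ js)).
  have mA_ i : measurable (A_ i : set (measurableTypeR R)) by rewrite /A_; case: ifP.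
  have := @indep A_ (i0 :: s); rewrite /= si us => /(_ isT mA_).
  rewrite !big_cons (As unit) /A_ eqxx setIC => ->.
  by rewrite -(@indep A_ s us mA_).
- by move=> _; rewrite /= /mrestr (le_lt_trans (probability_le1 _ _))// ?ltry//;
    rewrite setTI; exact: mX.
Qed.

(** One coordinate is integrated out while all the others are kept. The second
    argument of phi is the whole sample point, but phi is measurable for the
    sigma-algebra of the other coordinates only. *)
Lemma freeze (Q : probability (measurableTypeR R) R)
    (phi : measurableTypeR R * others -> R) (C : R) :
  has_law (X i0) Q -> measurable_fun setT phi -> (forall p, `|phi p| <= C) ->
  \int[P]_w phi (X i0 w, w) = \int[Q]_y \int[P]_w phi (y, w).
Proof.
move=> lawQ mphi phiC.
have mid : measurable_fun setT (id : T -> others).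
  by move=> _ A sA; rewrite setTI; exact: measurable_others.
pose Z : {mfun T >-> others} := HB.pack (id : T -> others)
  (isMeasurableFun.Build _ _ _ _ _ mid).
have mY : measurable_fun setT (X i0 : T -> measurableTypeR R).
  by move=> _ A mA; rewrite setTI; exact: mX.
pose Y : {mfun T >-> measurableTypeR R} := HB.pack (X i0 : T -> measurableTypeR R)
  (isMeasurableFun.Build _ _ _ _ _ mY).
rewrite (@freeze_pair _ T R P _ _ _ _ Y Z _ phi C)//.
rewrite /Rintegral; congr fine.
by apply: (@eq_measure_integral _ _ R setT Q (distribution P Y)) => A mA _; exact: lawQ.
Qed.
End independent_family.

(** * The chain of jumps and creeping times *)

(** An index ((n, m), (i, j)) stands for the m-th inter-arrival time (j = false) or
    jump (j = true) of the n-th copy of the first (i = false) or second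
    (i = true) process. *)
Notation clock := ((nat * nat) * (bool * bool))%type.

Lemma measurable_eqb d (V : measurableType d) (g : V -> bool) (i : bool) :
  measurable_fun setT g -> measurable_fun setT (fun p => g p == i).
Proof.
case: i => mg; first by under eq_fun do rewrite eqb_id.
by under eq_fun do rewrite eqbF_neg; exact: measurable_neg.
Qed.

Section jump_chain.
Context {R : realType}.
Variables (a : bool -> R) (b B : R).

(** Above b the second process is watched until it creeps to b, below b the
    first one until it creeps to 0. *)
Definition floor_level (above : bool) : R := if above then b else 0.

(** N steps of the oscillating path, in stage n with m clocks of that stage
    already used, at position x. A step takes the path to its next jump or to
    the floor. The next copies of both processes are used exactly when the
    path changes sides; that creeping to b is such a change agrees with b
    itself belonging to the lower side. Positions outside ]0, B] are absorbing
    and pay f; the chain pays f too when its N steps are used up. *)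
Fixpoint chain (s : R) (f : R -> R) (e : clock -> R) (N n m : nat) (x : R) : R :=
  if 0 < x <= B then
    if N is N'.+1 then
      onestep (a (b < x)) s (floor_level (b < x))
        (fun y => if (b < y) == (b < x) then chain s f e N' n m.+1 y
                  else chain s f e N' n.+1 0%N y)
        x (e ((n, m), (b < x, false))) (e ((n, m), (b < x, true)))
    else f x
  else f x.

Hypotheses (a0 : forall i, 0 < a i) (b0 : 0 <= b).
Variables (s : R) (f : R -> R).
Hypotheses (s0 : 0 <= s) (bf : bdd f).

Lemma floor_level_le (x : R) : 0 < x -> floor_level (b < x) <= x.
Proof. by rewrite /floor_level; case: ifP => [/ltW|_ /ltW]. Qed.

Lemma chain_bounded C e N n m x : (forall x, `|f x| <= C) ->
  `|chain s f e N n m x| <= C.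
Proof.
move=> fC; elim: N n m x => [|N IH] n m x /=; case: ifP => // /andP[x0 xB].
by apply: onestep_bound => //; [exact: floor_level_le | move=> y; case: ifP].
Qed.

Lemma measurable_onestep_var d (V : measurableType d) (c l : R) (g : R -> V -> R)
    (x t v : V -> R) :
  (forall y, measurable_fun setT y -> measurable_fun setT (fun p => g (y p) p)) ->
  measurable_fun setT x -> measurable_fun setT t -> measurable_fun setT v ->
  measurable_fun setT (fun p => onestep c s l (g ^~ p) (x p) (t p) (v p)).
Proof.
move=> mg mx mt mv.
have mct : measurable_fun setT (fun p => c * t p) by exact: measurable_funM.
have mxl : measurable_fun setT (fun p => x p - l) by exact: measurable_funB.
apply: measurable_fun_ifT; first exact: measurable_fun_ler.
  apply: measurable_funM; last first.
    by apply: mg; apply: measurable_funD => //; exact: measurable_funB.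
  apply: measurableT_comp => //; apply: measurable_funN; apply: measurable_funM => //.
  exact: measurableT_comp.
apply: measurable_funM; last exact: (mg (fun=> l)).
apply: measurableT_comp => //; apply: measurable_funN; apply: measurable_funM => //.
exact: measurable_funM.
Qed.

(** The clocks that the chain can still read in the state (n, m). *)
Definition not_before (n m : nat) (i : clock) :=
  (n < i.1.1)%N || ((i.1.1 == n) && (m <= i.1.2)%N).

Lemma measurable_chain d (V : measurableType d) (e : V -> clock -> R) N n m
    (x : V -> R) :
  (forall i, not_before n m i -> measurable_fun setT (e ^~ i)) ->
  measurable_fun setT x ->
  measurable_fun setT (fun p => chain s f (e p) N n m (x p)).
Proof.
elim: N n m x => [|N IH] n m x me mx /=.
  by apply: measurable_fun_ifT; first (apply: measurable_and;
    [exact: measurable_fun_ltr | exact: measurable_fun_ler]);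
    exact: (measurableT_comp bf.1 mx).
apply: measurable_fun_ifT; last exact: (measurableT_comp bf.1 mx).
  by apply: measurable_and; [exact: measurable_fun_ltr | exact: measurable_fun_ler].
have step i : measurable_fun setT (fun p => onestep (a i) s (floor_level i)
    (fun y => if (b < y) == i then chain s f (e p) N n m.+1 y
              else chain s f (e p) N n.+1 0%N y)
    (x p) (e p ((n, m), (i, false))) (e p ((n, m), (i, true)))).
  apply: (@measurable_onestep_var _ V _ _ (fun y p =>
    if (b < y) == i then chain s f (e p) N n m.+1 y
              else chain s f (e p) N n.+1 0%N y)) => //.
  - move=> y my; apply: measurable_fun_ifT.
    + by apply: measurable_eqb; exact: measurable_fun_ltr.
    + apply: IH => // i' /orP h; apply: me; apply/orP.
      by case: h => [|/andP[-> /ltnW ->]]; [left|right].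
    + apply: IH => // i' /orP h; apply: me; apply/orP; left.
      by case: h => [/ltnW//|/andP[/eqP ->]].
  - by apply: me; rewrite /not_before/= eqxx leqnn orbT.
  - by apply: me; rewrite /not_before/= eqxx leqnn orbT.
have mbx : measurable_fun setT (fun p => b < x p) by exact: measurable_fun_ltr.
apply: (eq_measurable_fun (fun p => if b < x p then
   onestep (a true) s (floor_level true)
    (fun y => if (b < y) == true then chain s f (e p) N n m.+1 y
              else chain s f (e p) N n.+1 0%N y)
    (x p) (e p ((n, m), (true, false))) (e p ((n, m), (true, true)))
  else onestep (a false) s (floor_level false)
    (fun y => if (b < y) == false then chain s f (e p) N n m.+1 y
              else chain s f (e p) N n.+1 0%N y)
    (x p) (e p ((n, m), (false, false))) (e p ((n, m), (false, true))))).
  by move=> p _; case: ifP.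
by apply: measurable_fun_ifT.
Qed.
End jump_chain.

Section mean_chain.
Context d (T : measurableType d) {R : realType} (P : probability T R).
Variables (X : clock -> {RV P >-> R}).
Hypothesis indep : mutually_independent X.
Variables (L F : bool -> probability (measurableTypeR R) R).
Hypothesis LX : forall n m i, has_law (X ((n, m), (i, false))) (L i).
Hypothesis FX : forall n m i, has_law (X ((n, m), (i, true))) (F i).
Variables (a : bool -> R) (b B : R).
Hypotheses (a0 : forall i, 0 < a i) (b0 : 0 <= b).
Variables (s : R) (f : R -> R).
Hypotheses (s0 : 0 <= s) (bf : bdd f).
Local Notation chain := (chain a b B s f).
Local Notation others i0 := (g_sigma_algebraType (other_events X i0)).
Local Notation floor_level := (floor_level b).

(** The deterministic counterpart of the chain: it forgets n and m, since all
    copies have the same laws. *)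
Fixpoint mean_chain (N : nat) (x : R) : R :=
  if 0 < x <= B then
    if N is N'.+1 then
      Qop (L (b < x)) (F (b < x)) (a (b < x)) s (floor_level (b < x))
        (mean_chain N') x
    else f x
  else f x.

(** In one step the chain reads the two clocks (n, m); what follows reads only
    later clocks. So these two can be integrated out one after the other, with
    everything else frozen. *)
Lemma Rintegral_chain N n m x :
  \int[P]_w chain (fun i => X i w) N n m x = mean_chain N x.
Proof.
have cstE (k : R) : \int[P]_w k = k.
  by rewrite Rintegral_cst// (congr1 fine (probability_setT P)) mulr1.
have [C fC] := bf.2.
elim: N n m x => [|N IH] n m x /=.
  by case: ifP => _; rewrite cstE.
case: ifP => x0B; last by rewrite cstE.
have x0 : 0 < x by case/andP: x0B.
set i := b < x; set l := floor_level i.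
have lx : l <= x by exact: floor_level_le.
pose nxt (e : clock -> R) y := if (b < y) == i then chain e N n m.+1 y
  else chain e N n.+1 0%N y.
have nxtC e y : `|nxt e y| <= C by rewrite /nxt; case: ifP => _; exact: chain_bounded.
pose iW : clock := ((n, m), (i, false)); pose iJ : clock := ((n, m), (i, true)).
have later n' m' i0 i' : (i0 == iW) || (i0 == iJ) ->
    (n' == n) && (m' == m.+1) || (n' == n.+1) -> not_before n' m' i' -> i' != i0.
  move=> h0 h h'; apply/eqP => E; move: h0 h h'; rewrite {}E /not_before.
  move=> /orP[]/eqP -> /=;
  by case/orP => [/andP[/eqP -> /eqP ->]|/eqP ->];
    rewrite ?ltnn ?eqxx/= ?ltnn// ltnNge leqnSn/= ltn_eqF.
have mnxt i0 (y : measurableTypeR R * others i0 -> R) :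
    (i0 == iW) || (i0 == iJ) -> measurable_fun setT y ->
    measurable_fun setT (fun p : measurableTypeR R * others i0 =>
      nxt (fun i => X i p.2) (y p)).
  move=> i0E my; apply: measurable_fun_ifT.
  - by apply: measurable_eqb; exact: measurable_fun_ltr.
  - apply: measurable_chain => // i' h; apply: (measurableT_comp _ measurable_snd).
    by apply: measurable_other; apply: later h; rewrite ?eqxx.
  - apply: measurable_chain => // i' h; apply: (measurableT_comp _ measurable_snd).
    by apply: measurable_other; apply: later h; rewrite ?eqxx ?orbT.
have nxtE y : \int[P]_w nxt (fun i => X i w) y = mean_chain N y.
  by rewrite /nxt; case: (_ == i); exact: IH.
rewrite -/i -/l -[LHS]/(\int[P]_w onestep (a i) s l (nxt (X^~ w)) x (X iW w) (X iJ w)).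
(* The inter-arrival time is integrated out first, then the jump. *)
rewrite (@freeze _ _ _ P _ _ indep iW (L i) (fun p : _ * others iW => onestep (a i) s l
   (nxt (fun i => X i p.2)) x p.1 (X iJ p.2)) C); last 3 first.
- exact: LX.
- apply: (@measurable_onestep_var _ s _ (measurableTypeR R * others iW)%type (a i) l
    (fun y p => nxt (fun i => X i p.2) y)) => //.
  + by move=> y my; apply: mnxt => //; rewrite eqxx.
  + apply: (measurableT_comp _ measurable_snd).
    by apply: measurable_other; apply/eqP => -[].
- by move=> p; exact: onestep_bound.
apply: eq_Rintegral => t _ /=.
rewrite (@freeze _ _ _ P _ _ indep iJ (F i) (fun p : _ * others iJ => onestep (a i) s l
   (nxt (fun i => X i p.2)) x t p.1) C); last 3 first.
- exact: FX.
- apply: (@measurable_onestep_var _ s _ (measurableTypeR R * others iJ)%type (a i) l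
    (fun y p => nxt (fun i => X i p.2) y)) => //.
  by move=> y my; apply: mnxt => //; rewrite eqxx orbT.
- by move=> p; exact: onestep_bound.
apply: eq_Rintegral => v _ /=.
have inx y : P.-integrable setT (EFin \o (fun w => nxt (X ^~ w) y)).
  apply: (integrable_bounded P (C := C)) => // .
  have me i' : measurable_fun setT (X i') by exact: measurable_funPT.
  rewrite /nxt; case: (_ == i);
    by apply: (@measurable_chain R a b B s f bf _ T (fun w => X^~ w) N _ _ (fun=> y)).
by rewrite /onestep; case: ifP => _; rewrite RintegralZl// nxtE.
Qed.
End mean_chain.

Section Qop_descent.
Context {R : realType}.
Variables (L F : probability (measurableTypeR R) R) (a l B p : R).

(** With probability at least p the inter-arrival time is so long that the path
    creeps from anywhere in [0, B] down to the floor, where g is at most c. *)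
Lemma Qop_descent (g : R -> R) (G c x : R) : bdd g ->
  p <= fine (L [set t | B < a * t]) -> (forall y, g y <= G) -> g l <= c -> c <= G ->
  x - l <= B -> Qop L F a 0 l g x <= G - p * (G - c).
Proof.
move=> bg pL gG glc cG xlB.
pose A : set (measurableTypeR R) := [set t | B < a * t].
have mA : measurable (A : set (measurableTypeR R)).
  have -> : A = [set t | (fun t : R => B < a * t) t = true] by apply/seteqP; split.
  have mf : measurable_fun setT (fun t : R => B < a * t).
    by apply: measurable_fun_ltr => //; exact: measurable_funM.
  by have := mf measurableT [set true]; rewrite setTI; apply.
have cst_int (k : R) : L.-integrable setT (EFin \o cst k).
  exact: finite_measure_integrable_cst.
have iA : L.-integrable setT (EFin \o (\1_A : _ -> R)) by exact: integrable_indic.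
have iAc : L.-integrable setT (EFin \o (fun t => (G - c) * \1_A t)).
  exact: integrable_scale.
have -> : G - p * (G - c) = G - (G - c) * p by ring.
apply: (@le_trans _ _ (\int[L]_t (G - (G - c) * \1_A t))); last first.
  have -> : \int[L]_t (G - (G - c) * \1_A t) = G - (G - c) * fine (L A).
    have EG : \int[L]_t (cst G t) = G := Rintegral_prob_cst L G.
    have EA : \int[L]_t (\1_A t) = fine (L A) :> R.
      by rewrite /Rintegral integral_indic// setIT.
    apply: (etrans (RintegralB measurableT (cst_int G) iAc)).
    by rewrite EG RintegralZl// EA.
  by rewrite lerD2l lerN2 ler_wpM2l ?subr_ge0.
have minner := measurable_inner_onestep F a 0 l x bg.1.
have [C gC] := bg.2.
apply: le_Rintegral => //.
- apply: (integrable_bounded L minner (C := C)) => t.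
  apply: Rintegral_prob_le => [|v].
    apply: (@measurable_onestep _ _ _ _ _ _ (fun y _ => g y)) => //.
    by apply: (measurableT_comp bg.1); exact: measurable_funD.
  by rewrite /onestep; case: ifP => _; rewrite mul0r oppr0 expR0 mul1r.
- exact: (integrable_sub measurableT (cst_int G) iAc).
move=> t _; rewrite (inner_onestep F a 0 l x t bg) !mul0r oppr0 expR0 !mul1r indicE.
have [At|At] := pselect (A t).
  rewrite mem_set// mulr1 ifF; last by move: At; rewrite /A/= => At; apply/negbTE; rewrite -ltNge; lra.
  by move: glc; lra.
rewrite memNset// mulr0 subr0; case: ifP => _; last exact: le_trans cG.
rewrite -[leRHS](Rintegral_prob_cst F); apply: le_Rintegral => //.
- exact: bdd_integrable (bdd_shift _ bg).
- exact: finite_measure_integrable_cst.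
Qed.
End Qop_descent.

Section mean_chain_properties.
Context d (T : measurableType d) {R : realType} (P : probability T R).
Variables (X : clock -> {RV P >-> R}).
Hypothesis indep : mutually_independent X.
Variables (L F : bool -> probability (measurableTypeR R) R).
Hypothesis LX : forall n m i, has_law (X ((n, m), (i, false))) (L i).
Hypothesis FX : forall n m i, has_law (X ((n, m), (i, true))) (F i).
Variables (a : bool -> R) (b B : R).
Hypotheses (a0 : forall i, 0 < a i) (b0 : 0 <= b).

Lemma bdd_mean_chain (s : R) f N : 0 <= s -> bdd f ->
  bdd (mean_chain L F a b B s f N).
Proof.
move=> s0 bf; have [C fC] := bf.2.
have E x : mean_chain L F a b B s f N x =
    \int[P]_w chain a b B s f (fun i => X i w) N 0%N 0%N x.
  by rewrite (Rintegral_chain indep LX FX).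
have mX i : measurable_fun setT (X i) by exact: measurable_funPT.
have mc : measurable_fun setT (fun p : R * T =>
    chain a b B s f (fun i => X i p.2) N 0%N 0%N p.1).
  apply: (@measurable_chain R a b B s f bf _ _ (fun p : R * T => X^~ p.2) N _ _ fst) => //.
  by move=> i _; exact: (measurableT_comp (mX i) measurable_snd).
split.
  apply: (eq_measurable_fun (fun x => \int[P]_w chain a b B s f (fun i => X i w) N 0%N 0%N x)).
    by move=> x _; rewrite E.
  exact: (measurable_Rintegral_param P mc).
exists C => x; rewrite E.
have ic : P.-integrable setT (EFin \o (fun w => chain a b B s f (fun i => X i w) N 0%N 0%N x)).
  apply: (integrable_bounded P (C := C)) => [|w]; last exact: chain_bounded.
  apply: (measurableT_comp (g := fun w => (x, w)) mc).
  by apply/measurable_fun_pair => //=.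
rewrite (le_trans (le_normr_Rintegral _ ic))//.
have -> : C = \int[P]_w C by rewrite Rintegral_cst// (congr1 fine (probability_setT P)) mulr1.
apply: le_Rintegral => //; [exact: integrable_norm ic | exact: finite_measure_integrable_cst|].
by move=> w _; exact: chain_bounded.
Qed.

Lemma mean_chain_harmonic s f N x :
  (forall x, 0 < x <= B ->
    Qop (L (b < x)) (F (b < x)) (a (b < x)) s (floor_level b (b < x)) f x = f x) ->
  mean_chain L F a b B s f N x = f x.
Proof.
move=> fh; elim: N x => [|N IH] x /=; first by case: ifP.
case: ifP => // x0B.
have -> : mean_chain L F a b B s f N = f by apply/funext.
exact: fh.
Qed.

Definition inside x : R := if 0 < x <= B then 1 else 0.

Lemma bdd_inside : bdd inside.
Proof.
split; last by exists 1 => x; rewrite /inside; case: ifP; rewrite ?normr1 ?normr0.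
by apply: measurable_fun_ifT => //; apply: measurable_and;
  [exact: measurable_fun_ltr | exact: measurable_fun_ler].
Qed.

(** The Lyapunov function 1 on ]0, b] and 1 + p on ]b, B]: a long inter-arrival
    time leads from the upper zone to b, and from the lower zone to absorption.
    In the lower zone one step gives at most (1 - p) (1 + p), in the upper zone
    at most 1 + p - p ^ 2. *)
Lemma mean_survival (p : R) N x : 0 <= p <= 1 ->
  (forall i, p <= fine (L i [set t | B < a i * t])) ->
  mean_chain L F a b B 0 inside N x <=
    (1 - p ^+ 2 / 2) ^+ N * (if b < x then 1 + p else 1).
Proof.
move=> /andP[p0 p1] pL.
have th0 : 0 <= 1 - p ^+ 2 / 2 by nra.
have out0 M (y : R) : ~~ (0 < y <= B) -> mean_chain L F a b B 0 inside M y = 0.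
  by move=> /negbTE h; case: M => [|M] /=; rewrite h /inside h.
elim: N x => [|N IH] x.
  by rewrite /= if_same expr0 mul1r /inside; case: ifP => _; case: ifP => _; lra.
have thN : 0 <= (1 - p ^+ 2 / 2) ^+ N by exact: exprn_ge0.
have all y : mean_chain L F a b B 0 inside N y <= (1 - p ^+ 2 / 2) ^+ N * (1 + p).
  by rewrite (le_trans (IH y))// ler_wpM2l//; case: ifP; lra.
have [x0B|x0B] := boolP (0 < x <= B); last first.
  by rewrite out0// mulr_ge0 ?exprn_ge0//; case: ifP; lra.
have bm := bdd_mean_chain N (lexx 0) bdd_inside.
move: (x0B) => /andP[x0 xB].
rewrite /= x0B exprSr; case: ifP => bx.
  apply: (le_trans (Qop_descent _ (c := (1 - p ^+ 2 / 2) ^+ N) bm (pL true) all _ _ _)).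
  - by rewrite /floor_level (le_trans (IH b))// ltxx mulr1.
  - by rewrite ler_peMr//; lra.
  - by rewrite /floor_level; move: b0; lra.
  - rewrite -subr_ge0; move: thN; set t := _ ^+ N => t0.
    rewrite (_ : _ - _ = t * (p ^+ 2 * (1 - p)) / 2); last by field.
    by rewrite divr_ge0// mulr_ge0// mulr_ge0 ?sqr_ge0// subr_ge0.
apply: (le_trans (Qop_descent _ (c := 0) bm (pL false) all _ _ _)).
- by rewrite /floor_level out0// ltxx.
- by rewrite mulr_ge0//; lra.
- by rewrite /floor_level subr0.
rewrite -subr_ge0; move: thN; set t := _ ^+ N => t0.
rewrite (_ : _ - _ = t * p ^+ 2 / 2); last by field.
by rewrite divr_ge0// mulr_ge0// sqr_ge0.
Qed.
End mean_chain_properties.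

(** * Paths *)

Section compound_poisson_path.
Context d (T : measurableType d) {R : realType}.
Variables (a : R) (W J : nat -> T -> R) (w : T).
Hypothesis W0 : 0 < W 0%N w.

Let W' k := W k.+1.
Let J' k := J k.+1.

Lemma compound_poisson_before (t : R) : t < W 0%N w ->
  compound_poisson a W J t w = - (a * t).
Proof.
move=> tW; rewrite /compound_poisson.
suff -> : poisson_process W t w = 0%N by rewrite big_ord0 sub0r.
apply: xget_unique => [|n /= [nt _]]; first by split=> //=; rewrite big_ord1.
by case: n nt => // n /(_ 0%N isT); rewrite big_ord1 leNgt tW.
Qed.

(** The inequalities that define the count at a given time determine it, and
    those of the shifted sequence are those of the original one with the count
    lowered by 1. *)
Lemma compound_poisson_after (t : R) : 0 <= t ->
  (exists n, t < \sum_(k < n.+1) W' k w) ->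
  compound_poisson a W J (W 0%N w + t) w =
  J 0%N w - a * W 0%N w + compound_poisson a W' J' t w.
Proof.
move=> t0 unb; rewrite /compound_poisson.
have [n tn nmin] := ex_minnP unb.
have uniq_count (V : nat -> T -> R) u k k' : ((forall m, (m < k)%N -> \sum_(i < m.+1) V i w <= u) /\
    u < \sum_(i < k.+1) V i w) -> ((forall m, (m < k')%N ->
    \sum_(i < m.+1) V i w <= u) /\ u < \sum_(i < k'.+1) V i w) -> k = k'.
  move=> [ku uk] [k'u uk']; apply/eqP; rewrite eqn_leq; apply/andP; split.
    by rewrite leqNgt; apply/negP => /ku; rewrite leNgt uk'.
  by rewrite leqNgt; apply/negP => /k'u; rewrite leNgt uk.
have n' : (forall m, (m < n)%N -> \sum_(i < m.+1) W' i w <= t) /\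
    t < \sum_(i < n.+1) W' i w.
  split=> // m mn; rewrite leNgt; apply/negP => /nmin; rewrite leqNgt mn//.
have -> : poisson_process W' t w = n.
  by apply: xget_unique => //= k hk; exact: uniq_count hk n'.
have -> : poisson_process W (W 0%N w + t) w = n.+1.
  have hn : (forall m, (m < n.+1)%N -> \sum_(i < m.+1) W i w <= W 0%N w + t) /\
      W 0%N w + t < \sum_(i < n.+2) W i w.
    split=> [m|]; last by rewrite big_ord_recl ltrD2l; exact: n'.2.
    case: m => [|m] mn; first by rewrite big_ord1 lerDl.
    by rewrite big_ord_recl lerD2l; exact: n'.1.
  by apply: xget_unique => //= k hk; exact: uniq_count hk hn.
by rewrite big_ord_recl /=; ring.
Qed.
End compound_poisson_path.

Section hitting_times.
Context {R : realType}.
Implicit Types (S : R -> Prop) (q : R -> R).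

(** The common form of the two passage times and of the exit time. *)
Definition hitting_time S : \bar R :=
  ereal_inf [set t%:E | t in [set t | 0 <= t /\ S t]].

Lemma hitting_time_ge S (D : R) : (forall t, 0 <= t -> t < D -> ~ S t) ->
  (D%:E <= hitting_time S)%E.
Proof.
move=> nS; apply: le_ereal_inf_tmp => _ [t [t0 St] <-]; rewrite lee_fin leNgt.
by apply/negP => tD; exact: nS tD St.
Qed.

Lemma hitting_time_le S (t : R) : 0 <= t -> S t -> (hitting_time S <= t%:E)%E.
Proof. by move=> t0 St; apply: ereal_inf_lbound; exists t. Qed.

Lemma hitting_time_ge0 S : (0 <= hitting_time S)%E.
Proof. by apply: hitting_time_ge => t t0; rewrite ltNge t0. Qed.

Lemma hitting_time_attained S (D : R) : 0 <= D -> S D ->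
  (forall t, 0 <= t -> t < D -> ~ S t) -> hitting_time S = D%:E.
Proof.
move=> D0 SD nS; apply/eqP; rewrite eq_le hitting_time_ge// andbT.
exact: hitting_time_le.
Qed.

Lemma hitting_time_shift S S' (D : R) : 0 <= D ->
  (forall t, 0 <= t -> t < D -> ~ S t) ->
  (forall t, 0 <= t -> (S (D + t) <-> S' t)) ->
  hitting_time S = (D%:E + hitting_time S')%E.
Proof.
move=> D0 nS SS'; apply/eqP; rewrite eq_le; apply/andP; split.
  rewrite -leeBlDl//; apply: le_ereal_inf_tmp => _ [t [t0 St] <-].
  rewrite leeBlDl// -EFinD; apply: hitting_time_le; first exact: addr_ge0.
  exact/SS'.
apply: le_ereal_inf_tmp => _ [t [t0 St] <-].
have Dt : D <= t by rewrite leNgt; apply/negP => tD; exact: nS tD St.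
rewrite -leeBrDl// -EFinB; apply: hitting_time_le; first by rewrite subr_ge0.
by apply/SS'; rewrite ?subr_ge0// subrKC.
Qed.

Lemma tau_minusE q (x : R) : tau_minus q x = hitting_time (fun t => q t <= - x).
Proof. by []. Qed.

Lemma tau_plusE q (x : R) : tau_plus q x = hitting_time (fun t => x < q t).
Proof. by []. Qed.

Lemma exit_timeE (B : R) q :
  exit_time B q = hitting_time (fun t => ~~ (0 <= q t <= B)).
Proof. by []. Qed.

Variables (b B s : R) (f : R -> R).

Definition payoff q : R :=
  if (exit_time B q < +oo)%E then
    expR (- (s * fine (exit_time B q))) * f (q (fine (exit_time B q)))
  else 0.

(** The path leaves [0, B] by creeping to 0 or by jumping above B. In the first
    case the exit time is the infimum of the times at which the path is
    negative, and the position at that time is 0. *)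
Definition clean_exit q : Prop := (exit_time B q < +oo)%E /\
  (q (fine (exit_time B q)) = 0 \/ B < q (fine (exit_time B q))).

(** What the recursion of the chain corresponds to for paths: an initial piece
    inside [0, B] of duration D contributes a discount factor only. *)
Lemma payoff_shift q q' (D : R) : 0 <= D ->
  (forall t, 0 <= t -> t < D -> 0 <= q t <= B) ->
  (forall t, 0 <= t -> q (D + t) = q' t) ->
  payoff q = expR (- (s * D)) * payoff q' /\ (clean_exit q' -> clean_exit q).
Proof.
move=> D0 qB qq'.
have E : exit_time B q = (D%:E + exit_time B q')%E.
  rewrite !exit_timeE; apply: hitting_time_shift => //.
  - by move=> t t0 tD; rewrite qB.
  - by move=> t t0; rewrite qq'.
have := hitting_time_ge0 (fun t => ~~ (0 <= q' t <= B)).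
rewrite -exit_timeE /payoff /clean_exit E => {E}.
case: (exit_time B q') => [e|_|] //=; last by rewrite mulr0; split=> // -[].
rewrite lee_fin => e0; rewrite -EFinD !ltry /= qq'//.
by split=> //; rewrite mulrDr opprD expRD mulrA.
Qed.

Lemma payoff_exit q (D : R) : exit_time B q = D%:E ->
  payoff q = expR (- (s * D)) * f (q D) /\
  (q D = 0 \/ B < q D -> clean_exit q).
Proof. by rewrite /payoff /clean_exit => ->; rewrite ltry. Qed.
End hitting_times.

Lemma osc_ext (R : realType) (b : R) (q1 q2 q1' q2' : nat -> R -> R) n (x t : R) :
  (forall k, (n <= k)%N -> q1 k = q1' k) -> (forall k, (n <= k)%N -> q2 k = q2' k) ->
  osc b q1 q2 n x t = osc b q1' q2' n x t.
Proof.
move=> e1 e2; rewrite /osc; congr (limn _); apply/funext => M.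
elim: M n x t e1 e2 => //= M IH n x t e1 e2; rewrite e1// e2//.
by case: ifP => _; case: ifP => _ //; apply: IH => k nk; rewrite ?e1 ?e2// ltnW.
Qed.

Section state_paths.
Context d (T : measurableType d) {R : realType}.
Variables (a : bool -> R) (b B : R) (X : clock -> T -> R) (w : T).
Hypotheses (a0 : forall i, 0 < a i) (b0 : 0 <= b) (bB : b <= B).
Hypothesis X0 : forall i, 0 < X i w.
Hypothesis unb : forall n m i (t : R),
  exists k, t < \sum_(j < k.+1) X ((n, (m + j)%N), (i, false)) w.

Definition stage_path n m i (t : R) : R :=
  compound_poisson (a i) (fun k => X ((n, (m + k)%N), (i, false)))
    (fun k => X ((n, (m + k)%N), (i, true))) t w.

Local Notation W n m i := (X ((n, m), (i, false)) w).
Local Notation J n m i := (X ((n, m), (i, true)) w).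

Lemma stage_path_before n m i (t : R) : t < W n m i ->
  stage_path n m i t = - (a i * t).
Proof. by move=> tW; apply: compound_poisson_before; rewrite ?addn0. Qed.

Lemma stage_path_after n m i (t : R) : 0 <= t ->
  stage_path n m i (W n m i + t) =
  J n m i - a i * W n m i + stage_path n m.+1 i t.
Proof.
move=> t0; have := @compound_poisson_after _ T R (a i)
  (fun k => X ((n, (m + k)%N), (i, false))) (fun k => X ((n, (m + k)%N), (i, true))) w.
rewrite /= !addn0 => /(_ t t0); rewrite -/(stage_path n m i _) => ->; last first.
  have [k tk] := unb n m.+1 i t; exists k; apply: (lt_le_trans tk).
  by rewrite le_eqVlt; apply/orP; left; apply/eqP; apply: eq_bigr => j _; rewrite addSnnS.
congr (_ + _); rewrite /stage_path; congr compound_poisson;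
  by apply/funext => k; rewrite addnS addSn.
Qed.

(** The oscillating path from the state (n, m, x) of the chain: the current
    stage has used m clocks of both its processes, while all the later ones
    are untouched. For m = 0 it is the path that the definition of the
    oscillating process uses after n switchings. *)
Definition state_path n m : R -> R -> R :=
  osc b (fun k => stage_path k (if k == n then m else 0%N) false)
        (fun k => stage_path k (if k == n then m else 0%N) true) n.

Lemma state_pathE n m (x t : R) : state_path n m x t =
  if (b < x)%R then
    let tau := tau_minus (stage_path n m true) (x - b)%R in
    if (t%:E < tau)%E then (x + stage_path n m true t)%R
    else state_path n.+1 0%N b (t - fine tau)%R
  else
    let tau := tau_plus (stage_path n m false) (b - x)%R in
    if (t%:E < tau)%E then (x + stage_path n m false t)%R
    else state_path n.+1 0%N (b + T_plus (stage_path n m false) (b - x))%R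
           (t - fine tau)%R.
Proof.
have E x' t' : osc b (fun k => stage_path k (if k == n then m else 0%N) false)
        (fun k => stage_path k (if k == n then m else 0%N) true) n.+1 x' t' =
    state_path n.+1 0%N x' t'.
  by apply: osc_ext => k nk; rewrite gtn_eqF// if_same.
by rewrite /state_path oscE eqxx /= !E.
Qed.

Lemma below_no_hit n m (x t : R) : x <= b -> t < W n m false -> 0 <= t ->
  ~ (b - x < stage_path n m false t).
Proof.
move=> xb tW t0; rewrite stage_path_before// => h.
have : 0 <= a false * t by rewrite mulr_ge0// ltW.
lra.
Qed.

Lemma above_no_hit n m (x t : R) : t < W n m true -> a true * t < x - b ->
  ~ (stage_path n m true t <= - (x - b)).
Proof. by move=> tW atx; rewrite stage_path_before// lerN2 => /le_lt_trans /(_ atx); rewrite ltxx. Qed.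

Lemma state_path_drift n m (x t : R) : 0 <= t -> t < W n m (b < x) ->
  (b < x -> a true * t < x - b) -> state_path n m x t = x - a (b < x) * t.
Proof.
move=> t0; rewrite state_pathE; case: (ltP b x) => [bx|xb] tW h.
  rewrite stage_path_before//= ifT// tau_minusE.
  have axb : t < (x - b) / a true by rewrite ltr_pdivlMr// mulrC h.
  apply: (@lt_le_trans _ _ (Num.min (W n m true) ((x - b) / a true))%:E).
    by rewrite lte_fin lt_min tW axb.
  apply: hitting_time_ge => u u0; rewrite lt_min ltr_pdivlMr// mulrC => /andP[uW ux].
  exact: above_no_hit.
rewrite stage_path_before//= ifT// tau_plusE.
apply: (@lt_le_trans _ _ (W n m false)%:E); first by rewrite lte_fin.
by apply: hitting_time_ge => u u0 uW; exact: below_no_hit.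
Qed.

(** The shift of a passage time by the first inter-arrival time, in the three
    cases: from above b to above b, from below b to above b, and from below b
    to below b. *)
Lemma state_path_jump n m (x t : R) : 0 <= t ->
  a (b < x) * W n m (b < x) <= x - floor_level b (b < x) ->
  let x' := x - a (b < x) * W n m (b < x) + J n m (b < x) in
  state_path n m x (W n m (b < x) + t) =
  if (b < x') == (b < x) then state_path n m.+1 x' t else state_path n.+1 0%N x' t.
Proof.
move=> t0; have := X0 ((n, m), (b < x, false)); have := X0 ((n, m), (b < x, true)).
rewrite (state_pathE n m).
case: (ltP b x) => [bx|xb] J0 W0 /= aW.
  set x' := x - _ + _; have bx' : b < x' by rewrite /x'; lra.
  rewrite bx' eqxx (state_pathE n m.+1) bx'.
  have E : tau_minus (stage_path n m true) (x - b) =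
      ((W n m true)%:E + tau_minus (stage_path n m.+1 true) (x' - b))%E.
    rewrite !tau_minusE; apply: hitting_time_shift; first exact: ltW.
    - move=> u u0 uW; apply: above_no_hit => //.
      by apply: lt_le_trans aW; rewrite ltr_pM2l.
    - by move=> u u0; rewrite stage_path_after// /x'; split; lra.
  have := hitting_time_ge0 (fun u => stage_path n m.+1 true u <= - (x' - b)).
  rewrite -tau_minusE E; case: (tau_minus _ (x' - b)) => [tau|_|] //=.
    rewrite -EFinD !lte_fin ltrD2l => tau0; case: ifP => _.
      by rewrite stage_path_after// /x'; ring.
    by congr (state_path _ _ _ _); ring.
  by rewrite !ltry stage_path_after// /x'; ring.
rewrite subr0 in aW; set x' := x - _ + _.
rewrite (state_pathE n m.+1); have [bx'|x'b] := ltP b x'.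
  have E : tau_plus (stage_path n m false) (b - x) = (W n m false)%:E.
    rewrite tau_plusE; apply: hitting_time_attained; first exact: ltW.
    - rewrite -[X in stage_path _ _ _ X]addr0 stage_path_after//.
      rewrite stage_path_before; last exact: X0.
      by move: bx'; rewrite /x'; lra.
    - by move=> u u0 uW; exact: below_no_hit.
  rewrite E lte_fin gtrDl ltNge t0 /= /T_plus E /=.
  congr (state_path _ _ _ _); last by ring.
  rewrite -[X in stage_path _ _ _ X]addr0 stage_path_after//.
  rewrite stage_path_before; last exact: X0.
  by rewrite /x'; ring.
have E : tau_plus (stage_path n m false) (b - x) =
      ((W n m false)%:E + tau_plus (stage_path n m.+1 false) (b - x'))%E.
  rewrite !tau_plusE; apply: hitting_time_shift; first exact: ltW.
  - by move=> u u0 uW; exact: below_no_hit.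
  - by move=> u u0; rewrite stage_path_after// /x'; split; lra.
have := hitting_time_ge0 (fun u => b - x' < stage_path n m.+1 false u).
rewrite /T_plus -tau_plusE E; case: (tau_plus _ (b - x')) => [tau|_|] //=.
  rewrite -EFinD !lte_fin ltrD2l => tau0; case: ifP => _.
    by rewrite stage_path_after// /x'; ring.
  rewrite lee_fin in tau0; congr (state_path _ _ _ _); last by ring.
  by rewrite /= stage_path_after// /x'; ring.
by rewrite !ltry stage_path_after// /x'; ring.
Qed.

(** The drift alone takes the path from x to b in the time (x - b) / a, which is
    shorter than the first inter-arrival time. *)
Lemma state_path_creep n m (x t : R) : 0 <= t -> b < x ->
  x - b < a true * W n m true ->
  state_path n m x ((x - b) / a true + t) = state_path n.+1 0%N b t.
Proof.
move=> t0 bx xbW; rewrite state_pathE bx.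
have atau : a true * ((x - b) / a true) = x - b.
  by rewrite mulrC divfK// gt_eqF.
have E : tau_minus (stage_path n m true) (x - b) = ((x - b) / a true)%:E.
  rewrite tau_minusE; apply: hitting_time_attained.
  - by rewrite divr_ge0// ?subr_ge0 ltW.
  - rewrite stage_path_before ?atau//.
    by rewrite ltr_pdivrMr// mulrC.
  - move=> u u0 ux; apply: above_no_hit.
      by apply: (lt_trans ux); rewrite ltr_pdivrMr// mulrC.
    by rewrite -atau ltr_pM2l.
rewrite /= E lte_fin gtrDl ltNge t0 /=.
by congr (state_path _ _ _ _); ring.
Qed.
End state_paths.

Section payoff_of_chain.
Context d (T : measurableType d) {R : realType}.
Variables (a : bool -> R) (b B : R) (X : clock -> T -> R) (w : T).
Hypotheses (a0 : forall i, 0 < a i) (b0 : 0 <= b) (bB : b <= B).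
Hypothesis X0 : forall i, 0 < X i w.
Hypothesis unb : forall n m i (t : R),
  exists k, t < \sum_(j < k.+1) X ((n, (m + j)%N), (i, false)) w.
Variables (s : R) (f : R -> R).

Local Notation W n m i := (X ((n, m), (i, false)) w).
Local Notation J n m i := (X ((n, m), (i, true)) w).
Local Notation state_path := (state_path a b X w).

(** At the time x / a the path is at 0 and has not yet left [0, B]; it is negative
    immediately afterwards, so the exit time is an infimum that is not
    attained. *)
Lemma exit_time_creep n m (x : R) : 0 <= x -> x <= b -> x < a false * W n m false ->
  exit_time B (state_path n m x) = (x / a false)%:E.
Proof.
move=> x0 xb xW; have af := a0 false.
have xaW : x / a false < W n m false by rewrite ltr_pdivrMr// mulrC.
have nbx : (b < x) = false by apply/negbTE; rewrite -leNgt.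
have drift t : 0 <= t -> t < W n m false -> state_path n m x t = x - a false * t.
  by move=> t0 tW; rewrite state_path_drift ?nbx.
rewrite exit_timeE; apply/eqP; rewrite eq_le; apply/andP; split; last first.
  apply: hitting_time_ge => t t0 tx; rewrite drift//; last exact: lt_trans xaW.
  have : a false * t < x by rewrite mulrC -ltr_pdivlMr.
  have : 0 <= a false * t by rewrite mulr_ge0// ltW.
  by move=> h1 h2; apply/negP; rewrite negbK; apply/andP; split; move: bB; lra.
apply/lee_addgt0Pr => e e0; pose t := Num.min (x / a false + e) ((x / a false + W n m false) / 2).
have xa0 : 0 <= x / a false by rewrite divr_ge0// ltW.
have tW : t < W n m false by rewrite /t gt_min; apply/orP; right; lra.
have xt : x / a false < t by rewrite /t lt_min; apply/andP; split; lra.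
apply: (@le_trans _ _ t%:E); last by rewrite -EFinD lee_fin /t ge_min lexx.
have t0 : 0 <= t by apply: le_trans xa0 (ltW xt).
apply: hitting_time_le => //; rewrite drift// negb_and -ltNge subr_lt0.
by rewrite mulrC -ltr_pdivrMr// xt.
Qed.

Lemma payoff_creep n m (x : R) : 0 <= x -> x <= b -> x < a false * W n m false ->
  payoff B s f (state_path n m x) = expR (- (s * (x / a false))) * f 0 /\
  clean_exit B (state_path n m x).
Proof.
move=> x0 xb xW; have af := a0 false.
have nbx : (b < x) = false by apply/negbTE; rewrite -leNgt.
have [-> h] := payoff_exit s f (exit_time_creep x0 xb xW).
have q0 : state_path n m x (x / a false) = 0.
  rewrite state_path_drift ?nbx//; first by rewrite mulrC divfK ?subrr// gt_eqF.
  - by rewrite divr_ge0// ltW.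
  - by rewrite ltr_pdivrMr// mulrC.
by rewrite q0; split=> //; apply: h; left.
Qed.

Lemma payoff_outside n m (x : R) : 0 <= x -> ~~ (0 < x <= B) ->
  payoff B s f (state_path n m x) = f x /\ clean_exit B (state_path n m x).
Proof.
move=> x0; rewrite negb_and -leNgt -ltNge => /orP[x0'|Bx].
  have -> : x = 0 by apply/eqP; rewrite eq_le x0' x0.
  have [|-> ?] := @payoff_creep n m 0 (lexx 0) b0; first by rewrite mulr_gt0.
  by rewrite mul0r mulr0 oppr0 expR0 mul1r.
have bx : b < x := le_lt_trans bB Bx.
have q0 : state_path n m x 0 = x.
  by rewrite state_path_drift ?mulr0 ?subr0 ?subr_gt0.
have E : exit_time B (state_path n m x) = 0%:E.
  rewrite exit_timeE; apply: hitting_time_attained => //.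
    by rewrite q0 negb_and -ltNge -ltNge Bx orbT.
  by move=> t t0; rewrite ltNge t0.
have [-> h] := payoff_exit s f E.
by rewrite q0 mulr0 oppr0 expR0 mul1r; split=> //; apply: h; right; rewrite q0.
Qed.

(** The chain is absorbed within N steps if the chain with payoff 1 inside
    ]0, B] and 0 elsewhere has the value 0. In this case the chain with payoff f
    is the discounted payoff at the exit of the path, which follows by
    induction on N with [payoff_shift]. *)
Lemma payoff_chain N n m (x : R) : 0 <= x ->
  chain a b B 0 (inside B) (fun i => X i w) N n m x = 0 ->
  payoff B s f (state_path n m x) = chain a b B s f (fun i => X i w) N n m x /\
  clean_exit B (state_path n m x).
Proof.
elim: N n m x => [|N IH] n m x x0 /=.
  case: ifPn => [x0B|x0B _]; last exact: payoff_outside.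
  by rewrite /inside x0B => /eqP; rewrite oner_eq0.
case: ifPn => [/andP[{}x0 xB]|x0B _]; last exact: payoff_outside.
have W0 : 0 < W n m (b < x) by exact: X0.
have J0 : 0 < J n m (b < x) by exact: X0.
have ai := a0 (b < x).
rewrite /onestep !mul0r oppr0 expR0 !mul1r; case: ifPn => [aW|]; last rewrite -ltNge => xaW.
  have fl0 : 0 <= floor_level b (b < x) by rewrite /floor_level; case: ifP.
  have bound t : 0 <= t -> t < W n m (b < x) -> 0 <= state_path n m x t <= B.
    move=> t0 tW.
    have at1 : a (b < x) * t < x - floor_level b (b < x).
      by apply: lt_le_trans aW; rewrite ltr_pM2l.
    have at0 : 0 <= a (b < x) * t by rewrite mulr_ge0// ltW.
    rewrite state_path_drift//.
      by apply/andP; split; move: at1 at0 fl0 xB; lra.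
    by move=> bx; move: at1; rewrite bx.
  set x' := x - _ + _.
  have x'0 : 0 <= x' by move: aW fl0 J0; rewrite /x'; lra.
  pose q' := if (b < x') == (b < x) then state_path n m.+1 x' else state_path n.+1 0%N x'.
  have jump t : 0 <= t -> state_path n m x (W n m (b < x) + t) = q' t.
    by move=> t0; rewrite state_path_jump// /q' -/x'; case: ifP.
  have [-> cl] := payoff_shift s f (ltW W0) bound jump.
  rewrite (ger0_norm (ltW W0)) /q' in cl *.
  case: (_ == _) cl => cl h; have [e c] := IH _ _ _ x'0 h.
    split; last exact: cl c.
    by congr (_ * _).
  split; last exact: cl c.
  by congr (_ * _).
have [bx|xb] := ltP b x; last first.
  have nbx : (b < x) = false by apply/negbTE; rewrite -leNgt.
  rewrite nbx /floor_level !subr0 in xaW * => _.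
  have nb0 : (b < 0) = false by apply/negbTE; rewrite -leNgt.
  have ch0 k : chain a b B s f (fun i => X i w) N n k 0 = f 0.
    by case: (N) => [|N'] /=; rewrite ltxx.
  rewrite nb0 /= ch0; apply: payoff_creep => //; exact: ltW.
rewrite bx /floor_level ltxx/= in xaW * => hb.
have bound t : 0 <= t -> t < (x - b) / a true -> 0 <= state_path n m x t <= B.
  rewrite ltr_pdivlMr// => t0 tx; rewrite mulrC in tx.
  have at0 : 0 <= a true * t by rewrite mulr_ge0// ltW.
  rewrite state_path_drift//; rewrite bx.
  - by apply/andP; split; move: xB b0 tx; lra.
  - by rewrite -(ltr_pM2l (a0 true)); apply: lt_trans xaW.
have creep t : 0 <= t -> state_path n m x ((x - b) / a true + t) = state_path n.+1 0%N b t.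
  by move=> t0; exact: state_path_creep.
have D0 : 0 <= (x - b) / a true by rewrite divr_ge0// ltW ?subr_gt0.
have [-> cl] := payoff_shift s f D0 bound creep.
have [e c] := IH _ _ _ b0 hb.
by split; [congr (_ * _) | exact: cl c].
Qed.
End payoff_of_chain.

(** * Almost sure properties of the clocks *)

Section exponential_law.
Context {R : realType}.
Variables (lam : R) (L : probability (measurableTypeR R) R).
Hypothesis LE : forall A, measurable A -> L A = exponential_prob lam A.

Lemma exponential_law_neg : L `]-oo, 0[%classic = 0%E.
Proof.
have m0 : measurable (`]-oo, 0[%classic : set (measurableTypeR R)) by exact: measurable_itv.
rewrite LE// /exponential_prob integral0_eq// => x /=; rewrite in_itv/= => x0.
by rewrite lt0_exponential_pdf.
Qed.

Lemma exponential_law_cdf (y : R) : 0 <= y ->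
  L `]-oo, y]%classic = (1 - expR (- (lam * y)))%:E.
Proof.
move=> y0.
have m0 : measurable (`]-oo, 0[%classic : set (measurableTypeR R)) by exact: measurable_itv.
have my : measurable (`[0, y]%classic : set (measurableTypeR R)) by exact: measurable_itv.
have -> : (`]-oo, y]%classic : set R) = `]-oo, 0[ `|` `[0, y].
  apply/seteqP; split => x /=; rewrite !in_itv/=; first by case: (ltP x 0); [left|right].
  by move=> [x0|/andP[]//]; rewrite (le_trans (ltW x0)).
rewrite measureU//; last first.
  by rewrite -subset0 => x [] /=; rewrite !in_itv/= ltNge => /negP + /andP[].
rewrite [X in (X + _)%E]exponential_law_neg add0e.
rewrite [LHS]LE//; move: y0; rewrite le_eqVlt => /orP[/eqP <-|y0].
  by rewrite mulr0 oppr0 expR0 subrr set_itv1 /exponential_prob integral_set1.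
by rewrite exponential_prob_itv0c// mulNr.
Qed.

Lemma exponential_law_tail (y : R) : 0 <= y ->
  L [set t | y < t] = (expR (- (lam * y)))%:E.
Proof.
move=> y0.
have my : measurable (`]-oo, y]%classic : set (measurableTypeR R)) by exact: measurable_itv.
have -> : [set t : R | y < t] = ~` `]-oo, y]%classic.
  apply/seteqP; split => x /=; rewrite in_itv/=; first by move=> yx; rewrite leNgt yx.
  by move=> /negP; rewrite -ltNge.
rewrite probability_setC// [X in (_ - X)%E]exponential_law_cdf// -EFinB.
by congr EFin; ring.
Qed.
End exponential_law.

Lemma le_geometric_le0 (R : realType) (x c q : R) : 0 <= q < 1 ->
  (forall N, x <= q ^+ N * c) -> x <= 0.
Proof.
move=> /andP[q0 q1] xq.
have qc : (fun N => q ^+ N * c) @ \oo --> 0 * c.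
  by apply: cvgM; [apply: cvg_expr; rewrite ger0_norm | exact: cvg_cst].
rewrite -(mul0r c) -(cvg_lim _ qc)//; apply: limr_ge.
  by apply/cvg_ex; exists (0 * c).
by near=> N; exact: xq.
Unshelve. all: by end_near. Qed.

Lemma ae_forall_bool d (T : measurableType d) (R : realType)
    (mu : {measure set T -> \bar R}) (Q : bool -> T -> Prop) :
  (forall i, {ae mu, forall w, Q i w}) -> {ae mu, forall w, forall i, Q i w}.
Proof. by move=> h; apply: filterS2 (h true) (h false) => w ht hf []. Qed.

Section almost_surely_good.
Context d (T : measurableType d) {R : realType} (P : probability T R).
Variables (X : clock -> {RV P >-> R}).
Hypothesis indep : mutually_independent X.
Variables (L F : bool -> probability (measurableTypeR R) R) (lam : bool -> R).
Hypothesis LX : forall n m i, has_law (X ((n, m), (i, false))) (L i).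
Hypothesis FX : forall n m i, has_law (X ((n, m), (i, true))) (F i).
Hypothesis lam0 : forall i, 0 < lam i.
Hypothesis LE : forall i A, measurable A -> L i A = exponential_prob (lam i) A.
Hypothesis Fpos : forall i, F i [set y | 0 < y] = 1%E.

Let mle (y : R) : measurable (`]-oo, y]%classic : set (measurableTypeR R)).
Proof. exact: measurable_itv. Qed.

Let mXle j (y : R) : measurable (X j @^-1` `]-oo, y]%classic).
Proof. by rewrite -[X in measurable X]setTI; apply: measurable_funPT => //; exact: mle. Qed.

Lemma ae_clock_pos : {ae P, forall w, forall j, 0 < X j w}.
Proof.
suff pos j : {ae P, forall w, 0 < X j w}.
  have posn n : {ae P, forall w, forall m i k, 0 < X ((n, m), (i, k)) w}.
    by apply/ae_foralln => m; do 2!(apply: ae_forall_bool => ?); exact: pos.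
  by apply: filterS (ae_foralln posn) => w h [[n m] [i k]]; exact: h.
exists (X j @^-1` `]-oo, 0]%classic); split; first exact: mXle.
- case: j => [[n m] [i []]].
    apply: (etrans (FX n m i (mle 0))).
    have -> : (`]-oo, 0]%classic : set R) = ~` [set y | 0 < y].
      apply/seteqP; split => x /=; rewrite in_itv/=; first by rewrite leNgt => /negP.
      by move=> /negP; rewrite -leNgt.
    have mpos : measurable ([set y | 0 < y] : set (measurableTypeR R)).
      have -> : [set y | 0 < y] = `]0, +oo[%classic :> set R.
        by apply/seteqP; split => x /=; rewrite in_itv/= andbT.
      exact: measurable_itv.
    by rewrite probability_setC// Fpos subee.
  apply: (etrans (LX n m i (mle 0))); rewrite (exponential_law_cdf (LE i))//.
  by rewrite mulr0 oppr0 expR0 subrr.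
- by move=> w /= /negP; rewrite -leNgt in_itv.
Qed.

(** The inter-arrival times of a process are at most 1 with a common probability
    q < 1, hence N of them are so together with probability q ^ N. *)
Lemma ae_clock_large n m i : {ae P, forall w, exists k, 1 < X ((n, (m + k)%N), (i, false)) w}.
Proof.
pose E k := X ((n, (m + k)%N), (i, false)) @^-1` `]-oo, 1]%classic.
have mE : measurable (\bigcap_k E k) by apply: bigcap_measurable => // k _; exact: mXle.
exists (\bigcap_k E k); split => //; last first.
  move=> w /= h k _; rewrite /E /preimage/= in_itv/= leNgt; apply/negP => kw.
  by apply: h; exists k.
pose q := 1 - expR (- lam i).
have q01 : 0 <= q < 1.
  rewrite /q subr_ge0 ltrBlDr ltrDl expR_gt0 andbT -expR0 ler_expR oppr_le0.
  exact: ltW.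
have PE N : (P (\bigcap_k E k) <= (q ^+ N)%:E)%E.
  pose s := [seq (((n, (m + k)%N), (i, false)) : clock) | k <- iota 0 N].
  have us : uniq s by rewrite map_inj_uniq ?iota_uniq// => k k' [/addnI].
  have := indep (A := fun=> `]-oo, 1]%classic) us (fun=> mle 1).
  rewrite /s !big_map => PN.
  apply: (@le_trans _ _ (P (\big[setI/setT]_(k <- iota 0 N) E k))).
    apply: le_measure; rewrite ?inE//.
      by apply: bigsetI_measurable => k _; exact: mXle.
    by rewrite -bigcap_seq => w h k _; exact: h.
  rewrite [X in (X <= _)%E]PN.
  rewrite (eq_bigr (fun=> q%:E)); last first.
    move=> k _; apply: (etrans (LX n (m + k)%N i (mle 1))).
    by rewrite (exponential_law_cdf (LE i))// mulr1.
  rewrite big_const_seq count_predT size_iota.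
  rewrite (_ : iter _ _ _ = (q ^+ N)%:E)//.
  by elim: (N) => //= M ->; rewrite exprS EFinM.
apply/eqP; rewrite eq_le measure_ge0 andbT.
have Pfin : P (\bigcap_k E k) \is a fin_num by exact: fin_num_measure.
rewrite -(fineK Pfin) lee_fin; apply: (le_geometric_le0 (c := 1) q01) => N.
by rewrite mulr1 -lee_fin fineK.
Qed.

(** Infinitely many inter-arrival times exceed 1, so their partial sums tend to
    infinity and the Poisson processes are finite at all times. *)
Lemma ae_clock_unbounded : {ae P, forall w, forall n m i (t : R),
  exists k, t < \sum_(j < k.+1) X ((n, (m + j)%N), (i, false)) w}.
Proof.
have large : {ae P, forall w, forall n m i, exists k, 1 < X ((n, (m + k)%N), (i, false)) w}.
  apply/ae_foralln => n; apply/ae_foralln => m.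
  by apply: ae_forall_bool => i; exact: ae_clock_large.
apply: filterS2 large ae_clock_pos => w lg pos n m i t.
have sumn (K : nat) : exists k, K%:R <= \sum_(j < k) X ((n, (m + j)%N), (i, false)) w.
  elim: K => [|K [k IH]]; first by exists 0%N; rewrite big_ord0.
  have [l kl] := lg n (m + k)%N i; exists (k + l).+1.
  rewrite big_ord_recr /= addnA -natr1 lerD//; last exact: ltW.
  rewrite (le_trans IH)// big_split_ord/= lerDl; apply: sumr_ge0 => j _.
  exact: ltW.
have [k Kk] := sumn (Num.truncn t).+1; exists k.
rewrite big_ord_recr/= ltr_wpDr//; first exact: ltW.
by apply: lt_le_trans Kk; exact: truncnS_gt.
Qed.
End almost_surely_good.

(** * Exit identities *)

Section exit_identity.
Context d (T : measurableType d) {R : realType} (P : probability T R).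
Variables (X : clock -> {RV P >-> R}).
Hypothesis indep : mutually_independent X.
Variables (L F : bool -> probability (measurableTypeR R) R) (lam : bool -> R).
Hypothesis LX : forall n m i, has_law (X ((n, m), (i, false))) (L i).
Hypothesis FX : forall n m i, has_law (X ((n, m), (i, true))) (F i).
Hypothesis lam0 : forall i, 0 < lam i.
Hypothesis LE : forall i A, measurable A -> L i A = exponential_prob (lam i) A.
Hypothesis Fpos : forall i, F i [set y | 0 < y] = 1%E.
Variables (a : bool -> R) (b B : R).
Hypotheses (a0 : forall i, 0 < a i) (b0 : 0 <= b) (bB : b <= B).

Local Notation alive N n m x w :=
  (chain a b B 0 (inside B) (fun i => X i w) N n m x).

Let alive0 n m x w : alive 0%N n m x w = inside B x.
Proof. by rewrite /= if_same. Qed.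

(* The state after one step does not depend on the number of steps that are
   left. *)
Let aliveS N n m x w : exists n' m' y,
  alive N.+1 n m x w = (if 0 < x <= B then alive N n' m' y w else 0) /\
  alive N.+2 n m x w = if 0 < x <= B then alive N.+1 n' m' y w else 0.
Proof.
have stepE M : alive M.+1 n m x w = if 0 < x <= B then
    onestep (a (b < x)) 0 (floor_level b (b < x))
      (fun y => if (b < y) == (b < x) then alive M n m.+1 y w else alive M n.+1 0%N y w)
      x (X ((n, m), (b < x, false)) w) (X ((n, m), (b < x, true)) w) else 0.
  by rewrite [LHS]/=; case: ifP => // x0B; rewrite /inside x0B.
rewrite !stepE /onestep !mul0r oppr0 expR0.
case: ifP => _; last by exists n, m, x.
case: ifP => _; case: (_ == _); rewrite !mul1r;
  by [exists n, m.+1; eexists | exists n.+1, 0%N; eexists].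
Qed.

Lemma alive01 N n m x w : alive N n m x w = 0 \/ alive N n m x w = 1.
Proof.
elim: N n m x => [|N IH] n m x.
  by rewrite alive0 /inside; case: ifP; [right|left].
by have [n' [m' [y [-> _]]]] := aliveS N n m x w; case: ifP => _; [exact: IH | left].
Qed.

Lemma alive_monotone N n m x w : alive N n m x w = 0 -> alive N.+1 n m x w = 0.
Proof.
elim: N n m x => [|N IH] n m x.
  have [n' [m' [y [-> _]]]] := aliveS 0%N n m x w.
  rewrite alive0 /inside; case: ifP => // _ /eqP.
  by rewrite oner_eq0.
by have [n' [m' [y [-> ->]]]] := aliveS N n m x w; case: ifP => // _; exact: IH.
Qed.

Lemma exists_survival_bound : exists2 p, 0 < p <= 1 &
  forall i, p <= fine (L i [set t | B < a i * t]).
Proof.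
have B0 : 0 <= B by exact: le_trans bB.
pose e i := expR (- (lam i * (B / a i))).
have e01 i : 0 < e i <= 1.
  by rewrite expR_gt0 -expR0 ler_expR oppr_le0 mulr_ge0 ?divr_ge0// ltW.
have LeE i : fine (L i [set t | B < a i * t]) = e i.
  have -> : [set t : R | B < a i * t] = [set t | B / a i < t].
    by apply/seteqP; split => t /=; rewrite ltr_pdivrMr// mulrC.
  by rewrite (congr1 fine (exponential_law_tail (LE i) _))// divr_ge0// ltW.
exists (Num.min (e true) (e false)).
  rewrite lt_min; have /andP[-> t1] := e01 true; have /andP[-> _] := e01 false.
  by rewrite /= ge_min t1.
by case; rewrite LeE ge_min lexx ?orbT.
Qed.

(** The chain stays inside ]0, B] for ever with a probability that is at most
    each of the means in [mean_survival], which decrease geometrically. *)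
Lemma ae_exit x : {ae P, forall w, exists N, alive N 0%N 0%N x w = 0}.
Proof.
have malive N : measurable_fun setT (fun w => alive N 0%N 0%N x w).
  exact: (@measurable_chain R a b B 0 _ (bdd_inside B) _ T (fun w => X^~ w) N _ _ (fun=> x)).
pose E N := [set w | alive N 0%N 0%N x w = 1].
have mE N : measurable (E N).
  rewrite -[X in measurable X]setTI.
  exact: (malive N measurableT [set 1] (measurable_set1 1)).
exists (\bigcap_N E N); split; first exact: bigcap_measurable.
- have [p /andP[p0 p1] pL] := exists_survival_bound.
  have PE : P (\bigcap_N E N) \is a fin_num.
    by apply: fin_num_measure; exact: bigcap_measurable.
  apply/eqP; rewrite eq_le measure_ge0 andbT -(fineK PE) lee_fin.
  apply: (le_geometric_le0 (c := 1 + p) (q := 1 - p ^+ 2 / 2)).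
    by apply/andP; split; nra.
  move=> N; apply: (@le_trans _ _ (mean_chain L F a b B 0 (inside B) N x)).
    rewrite -(Rintegral_chain indep LX FX b B a0 (lexx 0) (bdd_inside B) N 0%N 0%N).
    have -> : fine (P (\bigcap_N E N)) = \int[P]_w \1_(\bigcap_N E N) w.
      by rewrite /Rintegral integral_indic ?setIT//; exact: bigcap_measurable.
    apply: le_Rintegral => //.
    + by apply: integrable_indic; exact: bigcap_measurable.
    + apply: (integrable_bounded P (C := 1)) => // w.
      by apply: chain_bounded => // y; rewrite /inside; case: ifP; rewrite ?normr1 ?normr0.
    move=> w _; rewrite indicE; have [Ew|Ew] := pselect ((\bigcap_N E N) w).
      by rewrite mem_set// (Ew N I).
    by rewrite memNset//; case: (alive01 N 0%N 0%N x w) => ->.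
  rewrite (le_trans (mean_survival indep LX FX a0 b0 N x _ pL)) ?p1 ?(ltW p0)//.
  by rewrite ler_wpM2l//; [apply: exprn_ge0; nra | case: ifP; lra].
- move=> w /= nE N _; case: (alive01 N 0%N 0%N x w) => // h.
  by exfalso; apply: nE; exists N.
Qed.

Variables (x s : R).
Hypotheses (x0 : 0 <= x) (s0 : 0 <= s).
Local Notation path w := (state_path a b X w 0%N 0%N x).

Lemma ae_payoff_chain : {ae P, forall w, clean_exit B (path w) /\ forall f,
  \forall N \near \oo,
    chain a b B s f (fun i => X i w) N 0%N 0%N x = payoff B s f (path w)}.
Proof.
apply: filterS3 (ae_clock_pos LX FX LE Fpos)
  (ae_clock_unbounded indep LX FX lam0 LE Fpos) (ae_exit x) => w pos unb [N0 dead].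
have dead' N : (N0 <= N)%N -> alive N 0%N 0%N x w = 0.
  by move=> /subnK <-; elim: (N - N0)%N => //= k IH; exact: alive_monotone.
have pay f N : (N0 <= N)%N ->
    payoff B s f (path w) = chain a b B s f (fun i => X i w) N 0%N 0%N x /\
    clean_exit B (path w).
  by move=> NN; apply: payoff_chain => //; exact: dead'.
split; first by have [] := pay (fun=> 0) _ (leqnn N0).
by move=> f; exists N0 => // N /= NN; have [-> _] := pay f N NN.
Qed.

(** The mean of the chain is f x for every number of steps, because f is
    harmonic, and almost surely the chain finally equals the payoff of the
    path. *)
Lemma exit_identity f : bdd f ->
  (forall y, 0 < y <= B ->
    Qop (L (b < y)) (F (b < y)) (a (b < y)) s (floor_level b (b < y)) f y = f y) ->
  \int[P]_w payoff B s f (path w) = f x.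
Proof.
move=> bf fh; have [N [mN N0 subN]] := ae_payoff_chain.
have [C fC] := bf.2.
apply: (Rintegral_eventually_eq (f_ := fun n w => chain a b B s f (fun i => X i w) n 0%N 0%N x)
  (C := C) mN N0).
- move=> n.
  exact: (@measurable_chain R a b B s _ bf _ T (fun w => X^~ w) n _ _ (fun=> x)).
- by move=> n w; exact: chain_bounded.
- by move=> w Nw; have [_ /(_ f)] := contra_notP (subN w) Nw.
- rewrite (_ : (fun n => _) = cst (f x)); first exact: cvg_cst.
  apply/funext => n /=; rewrite (Rintegral_chain indep LX FX)//.
  exact: mean_chain_harmonic.
Qed.

Lemma exit_below_mean f : bdd f ->
  (forall y, 0 < y <= B ->
    Qop (L (b < y)) (F (b < y)) (a (b < y)) s (floor_level b (b < y)) f y = f y) ->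
  f 0 = 1 -> (forall y, B < y -> f y = 0) -> Vlower P B (fun w => path w) s = f x.
Proof.
move=> bf fh f0 fB; rewrite -(exit_identity bf fh) /Vlower Rintegral_mkcond.
have [N [mN N0 subN]] := ae_payoff_chain.
apply: (null_set_Rintegral mN N0) => w Nw.
have [[fin out] _] := contra_notP (subN w) Nw.
have B0 : 0 <= B by exact: le_trans bB.
rewrite patchE /payoff fin; case: out => [q0|Bq].
  by rewrite mem_set ?q0 ?f0 ?mulr1//; split => //=; rewrite q0.
rewrite memNset ?fB ?mulr0// => -[_]; rewrite leNgt => /negP; apply.
exact: le_lt_trans Bq.
Qed.

Lemma exit_above_mean f g : bdd f ->
  (forall y, 0 < y <= B ->
    Qop (L (b < y)) (F (b < y)) (a (b < y)) s (floor_level b (b < y)) f y = f y) ->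
  f 0 = 0 -> (forall y, B < y -> f y = g (y - B)) ->
  \int[P]_(w in exit_above B (fun w => path w))
    (expR (- (s * fine (exit_time B (path w)))) * g (exit_overshoot B (path w))) = f x.
Proof.
move=> bf fh f0 fB; rewrite -(exit_identity bf fh) Rintegral_mkcond.
have [N [mN N0 subN]] := ae_payoff_chain.
apply: (null_set_Rintegral mN N0) => w Nw.
have [[fin out] _] := contra_notP (subN w) Nw.
have B0 : 0 <= B by exact: le_trans bB.
rewrite patchE /payoff fin /exit_overshoot; case: out => [q0|Bq].
  rewrite memNset ?q0 ?f0 ?mulr0// => -[_]; rewrite q0.
  by rewrite ltNge B0.
by rewrite mem_set// Bq fB.
Qed.
End exit_identity.

(** The atom 1 / a of the renewal equation is the value at 0: between -1 and 0
    there is nothing else, since r vanishes below 0. *)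
Lemma resolvent_eq_at0 (R : realType) (a lam s : R)
    (F : probability (measurableTypeR R) R) (r : R -> R) :
  (forall y, y < 0 -> r y = 0) -> resolvent_eq a lam s F r -> r 0 = a^-1.
Proof.
move=> rneg [_ _ /(_ (-1) 0)].
rewrite oppr_le0 ler01 => /(_ isT); rewrite ltrN10 lexx rneg// mulr0 add0r div1r.
rewrite mulr0 oppr0 expR0 mul1r => ->.
rewrite (_ : \int[_]_(w in _) _ = 0) ?mulr0 ?addr0//.
rewrite (@eq_Rintegral _ _ _ _ _ (fun=> 0)) ?Rintegral_cst ?mul0r// => w.
rewrite inE/= in_itv/= => /andP[_ w0].
rewrite /jump_conv /conv (@eq_Rintegral _ _ _ _ _ (fun=> 0)) ?Rintegral_cst ?mul0r ?mulr0// => v _.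
rewrite /pos_jump indicE; case: (boolP (v \in _)); rewrite ?mul0r// inE/= in_itv/= andbT => v0.
by rewrite rneg ?mulr0//; lra.
Qed.

Section zero_transform.
Context {R : realType}.
Variables (a1 a2 lam1 lam2 s : R) (F1 F2 : probability (measurableTypeR R) R).
Variables (r1 : R -> R) (K : R -> R -> R).

Lemma cumulant0 (a lam : R) (F : probability (measurableTypeR R) R) :
  cumulant a lam F 0 = 0.
Proof.
rewrite /cumulant mulr0 add0r /Cintegral.
under eq_Rintegral do rewrite mulr0 oppr0 cexp0 subrr.
under [X in _ +i* X]eq_Rintegral do rewrite mulr0 oppr0 cexp0 subrr.
by rewrite !Rintegral_cst//= !mul0r mulr0.
Qed.

Lemma laplace_upto0 (y : R) (f : R -> R) :
  laplace_upto y f 0 = (\int[lebesgue_measure]_(v in `[0, y]) f v)%:C.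
Proof.
rewrite /laplace_upto /Cintegral.
under eq_Rintegral do rewrite mulr0 oppr0 cexp0 mul1r.
under [X in _ +i* X]eq_Rintegral do rewrite mulr0 oppr0 cexp0 mul1r.
by rewrite /= Rintegral_cst// mul0r.
Qed.

(** Both cumulants vanish at 0. Thus the transform of the time and overshoot at
    z = 0 contains the formula for the transform of the time alone. *)
Lemma frakKz0 (y u : R) :
  frakKz (cumulant a1 lam1 F1) (cumulant a2 lam2 F2) r1 K s y u 0 =
  (frakK r1 K s y u)%:C.
Proof.
rewrite /frakKz /C1 /frakK !mulr0 !mul0r !cexp0 !cumulant0 !mul1r !sub0r.
rewrite !laplace_upto0 !rmorphD !rmorphM !rmorph1 /=.
case: ifPn => [y0|_]; last by ring.
have -> : \int[lebesgue_measure]_(v in `[0, y]) r1 v = 0.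
  by rewrite set_itv_ge ?Rintegral_set0// bnd_simp -ltNge.
by rewrite rmorph0; ring.
Qed.
End zero_transform.

Lemma law_as_probability d (T : measurableType d) (R : realType) (P : probability T R)
    (Y : {RV P >-> R}) : exists Q : probability (measurableTypeR R) R, has_law Y Q.
Proof.
have mY : measurable_fun setT (Y : T -> measurableTypeR R).
  by move=> _ A mA; exact: measurable_funPT.
pose Z : {mfun T >-> measurableTypeR R} := HB.pack (Y : T -> measurableTypeR R)
  (isMeasurableFun.Build _ _ _ _ _ mY).
by exists (distribution P Z).
Qed.

Section passage_identity.
Context d (T : measurableType d) {R : realType} (P : probability T R).
Variables (a1 a2 lam1 lam2 : R) (F1 F2 : probability (measurableTypeR R) R).
Variables (W1 J1 W2 J2 : nat -> nat -> {RV P >-> R}).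
Variables (r1 : R -> R) (K : R -> R -> R) (c1s c2s B b s : R).
Hypotheses (a10 : 0 < a1) (a20 : 0 < a2) (lam10 : 0 < lam1) (lam20 : 0 < lam2).
Hypotheses (F1pos : F1 [set y | 0 < y] = 1%E) (F2pos : F2 [set y | 0 < y] = 1%E).
Hypothesis copies : driving_copies lam1 lam2 F1 F2 W1 J1 W2 J2.
Hypotheses (b0 : 0 <= b) (bB : b <= B) (s0 : 0 <= s).
Let k1 := cumulant a1 lam1 F1.
Let k2 := cumulant a2 lam2 F2.
Hypothesis Hr1 : is_resolvent k1 a1 c1s s r1.
Hypothesis HK : is_Kfun k1 k2 c1s c2s s r1 K.
Local Notation path x := (oscillating a1 a2 b W1 J1 W2 J2 x).

Let X (i : clock) := match i.2 with
  | (false, false) => W1 | (false, true) => J1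
  | (true, false) => W2 | (true, true) => J2
  end i.1.1 i.1.2.
Let a i := if i then a2 else a1.
Let lam i := if i then lam2 else lam1.
Let F i := if i then F2 else F1.

Let pathE x w : state_path a b X w 0%N 0%N x = path x w.
Proof.
rewrite /state_path /oscillating; congr (osc b _ _ _ _);
  by apply/funext => k; rewrite if_same.
Qed.

Let a0 i : 0 < a i. Proof. by case: i. Qed.
Let lam0 i : 0 < lam i. Proof. by case: i. Qed.
Let Fpos i : F i [set y | 0 < y] = 1%E. Proof. by case: i. Qed.
Let indep : mutually_independent X. Proof. by case: copies. Qed.

Let FX n m i : has_law (X ((n, m), (i, true))) (F i).
Proof. by case: copies => _ /(_ n m)[] + + _; case: i. Qed.

Let exists_L : exists L : bool -> probability (measurableTypeR R) R,
  (forall n m i, has_law (X ((n, m), (i, false))) (L i)) /\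
  (forall i A, measurable A -> L i A = exponential_prob (lam i) A).
Proof.
have [Q1 hQ1] := law_as_probability (W1 0%N 0%N).
have [Q2 hQ2] := law_as_probability (W2 0%N 0%N).
have [law _ _] := copies.
have E1 A : measurable A -> Q1 A = exponential_prob lam1 A.
  by move=> mA; rewrite -hQ1//; exact: (law 0%N 0%N).1.
have E2 A : measurable A -> Q2 A = exponential_prob lam2 A.
  by move=> mA; rewrite -hQ2//; exact: (law 0%N 0%N).2.
exists (fun i => if i then Q2 else Q1); split.
  by move=> n m [] A mA /=; rewrite ?E1 ?E2//; have [l1 l2] := law n m; [exact: l2|exact: l1].
by move=> [] A mA /=; rewrite ?E1 ?E2.
Qed.

Definition harmonic (L : bool -> probability (measurableTypeR R) R) f :=
  forall y, 0 < y <= B ->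
    Qop (L (b < y)) (F (b < y)) (a (b < y)) s (floor_level b (b < y)) f y = f y.

Lemma harmonic_lin L (f g : R -> R) (al be : R) : bdd f -> bdd g ->
  harmonic L f -> harmonic L g -> harmonic L (fun y => al * f y + be * g y).
Proof.
move=> bf bg hf hg y y0B; have /andP[y0 yB] := y0B.
by rewrite Qop_lin ?hf ?hg//; exact: floor_level_le.
Qed.

Local Notation h := (hit_fun b B K).
Local Notation E := (exit_fun a1 a2 lam1 lam2 s b B F1 F2 r1 K).

Let bh : bdd h.
Proof. exact: (bdd_hit_fun a10 a20 lam10 lam20 s0 F1pos F2pos bB Hr1 HK). Qed.

Let hharm (L : bool -> probability (measurableTypeR R) R) : (forall i A, measurable A -> L i A = exponential_prob (lam i) A) ->
  harmonic L h.
Proof.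
move=> LE y /andP[y0 yB]; rewrite /F /a; case: (ltP b y) => [by_|yb] /=.
  exact: (harmonic_hit_above a10 a20 lam10 lam20 s0 F1pos F2pos (LE true) b0 bB Hr1 HK (ltW by_)).
exact: (harmonic_hit_below a10 a20 lam10 lam20 s0 F1pos F2pos (LE false) bB Hr1 HK (ltW y0)).
Qed.

Let hE y : 0 <= y -> h y = K (b - y) (B - b).
Proof. by move=> y0; rewrite /hit_fun /killed y0. Qed.

Let hout y : B < y -> h y = 0.
Proof. exact: (hit_fun_out a10 a20 lam10 lam20 s0 F1pos F2pos b0 bB Hr1 HK). Qed.

Let B0 : 0 <= B. Proof. exact: le_trans bB. Qed.

(* If h vanished at 0, its boundary values would all be 0, hence it would be 0
   itself by the exit identity. But h B is the second resolvent at 0. *)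
Let h0 : h 0 != 0.
Proof.
apply/eqP => h00; have [L [LX LE]] := exists_L.
have := exit_above_mean indep LX FX lam0 LE Fpos a0 b0 bB B0 s0 (g := fun=> 0)
  bh (hharm LE) h00 hout.
rewrite Rintegral_mkcond (_ : _ \_ _ = cst 0); last first.
  by apply/funext => w; rewrite patchE; case: ifP => // _; rewrite mulr0.
rewrite Rintegral_cst// mul0r hE//.
rewrite (K_nonpos a10 a20 lam10 lam20 s0 F1pos F2pos Hr1 HK) ?subr_le0 ?subr_ge0//.
rewrite addrC subrKA subrr.
have E2 := resolvent2_eq a10 a20 lam10 lam20 s0 F1pos F2pos Hr1 HK.
rewrite (resolvent_eq_at0 _ E2) => [/esym/eqP|y y0].
  by rewrite invr_eq0 gt_eqF.
by rewrite /resolvent2 patchE memNset//= in_itv/= andbT leNgt y0.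
Qed.

Let bE z w : 0 <= complex.Re z -> bdd (E z w).
Proof. by move=> z0; exact: (bdd_exit_fun B a10 a20 lam10 lam20 s0 F1pos F2pos b0 Hr1 HK w z0). Qed.

Let Eharm (L : bool -> probability (measurableTypeR R) R) z w :
  (forall i A, measurable A -> L i A = exponential_prob (lam i) A) ->
  0 <= complex.Re z -> harmonic L (E z w).
Proof.
move=> LE z0 y /andP[y0 yB]; rewrite /F /a; case: (ltP b y) => [by_|yb] /=.
  exact: (harmonic_exit_above a10 a20 lam10 lam20 s0 F1pos F2pos (LE true) b0 bB Hr1 HK w z0 (ltW by_) yB).
exact: (harmonic_exit_below B a10 a20 lam10 lam20 s0 F1pos F2pos (LE false) b0 Hr1 HK w z0 (ltW y0) yb).
Qed.

Let EE z w y : 0 <= y -> E z w y = complex.Re (w * frakKz k1 k2 r1 K s (b - y) (B - b) z).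
Proof. by move=> y0; rewrite /exit_fun /killed y0. Qed.

Let Eout z w y : 0 <= complex.Re z -> B < y ->
  E z w y = complex.Re (w * cexp (- (z * (y - B)%:C))).
Proof. by move=> z0 By; exact: (exit_fun_out a10 a20 lam10 lam20 s0 F1pos F2pos b0 bB Hr1 HK w z0 By). Qed.

Variable x : R.
Hypothesis x0B : 0 <= x <= B.
Let x0 : 0 <= x. Proof. by case/andP: x0B. Qed.
Let ratio := K (b - x) (B - b) / K b (B - b).

Let ratioE : ratio = h x / h 0.
Proof. by rewrite !hE// subr0. Qed.

Let path_fun : (fun w => state_path a b X w 0%N 0%N x) = path x.
Proof. by apply/funext => w; exact: pathE. Qed.

(** The harmonic function h / h 0 has the boundary values 1 at 0 and 0 above
    B. *)
Lemma Vlower_identity : Vlower P B (path x) s = ratio.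
Proof.
have [L [LX LE]] := exists_L; rewrite -path_fun ratioE.
have [bf hf] : bdd (fun y => (h 0)^-1 * h y + 0 * h y) /\
    harmonic L (fun y => (h 0)^-1 * h y + 0 * h y).
  by split; [exact: bdd_lin | apply: harmonic_lin => //; exact: hharm].
rewrite (exit_below_mean indep LX FX lam0 LE Fpos a0 b0 bB x0 s0 bf hf).
- by rewrite mul0r addr0 mulrC.
- by rewrite mul0r addr0 mulVf.
- by move=> y By; rewrite (hout By) !mulr0 addr0.
Qed.

(** Subtracting the multiple of h that cancels the value at 0, one gets from the
    exit function a harmonic function that pays at the upper boundary only. *)
Lemma exit_above_identity (z w : R[i]) : 0 <= complex.Re z ->
  \int[P]_(t in exit_above B (path x)) (expR (- (s * fine (exit_time B (path x t))))
     * complex.Re (w * cexp (- (z * (exit_overshoot B (path x t))%:C)))) =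
  complex.Re (w * (frakKz k1 k2 r1 K s (b - x) (B - b) z -
    ratio%:C * frakKz k1 k2 r1 K s b (B - b) z)).
Proof.
move=> z0; have [L [LX LE]] := exists_L.
pose f y := 1 * E z w y + (- (E z w 0 / h 0)) * h y.
have bf : bdd f by apply: bdd_lin => //; exact: bE.
have hf : harmonic L f.
  by apply: harmonic_lin => //; [exact: bE | exact: Eharm | exact: hharm].
rewrite -path_fun.
rewrite (exit_above_mean indep LX FX lam0 LE Fpos a0 b0 bB x0 s0
  (g := fun v => complex.Re (w * cexp (- (z * v%:C)))) bf hf).
- rewrite /f ratioE mul1r !EE// subr0; move: h0; move: (h x) (h 0) => hx h_0 nz.
  move: (w) (frakKz _ _ _ _ _ (b - x) _ _) (frakKz _ _ _ _ _ b _ _) => [p q] [u v] [u' v'] /=.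
  by field.
- by rewrite /f mul1r mulNr divfK// subrr.
- by move=> y By; rewrite /f (hout By) mulr0 addr0 mul1r Eout.
Qed.
End passage_identity.

Theorem theorem2 (R : realType) (d : measure_display) (T : measurableType d)
    (P : probability T R)
    (a1 a2 lam1 lam2 : R) (F1 F2 : probability (measurableTypeR R) R)
    (W1 J1 W2 J2 : nat -> nat -> {RV P >-> R})
    (c1 c2 r1 : R -> R) (K : R -> R -> R) (B b x s : R) :
  let k1 := cumulant a1 lam1 F1 in
  let k2 := cumulant a2 lam2 F2 in
  let X := oscillating a1 a2 b W1 J1 W2 J2 x in
  0 < a1 -> 0 < a2 -> 0 < lam1 -> 0 < lam2 ->
  F1 [set y | 0 < y] = 1%E -> F2 [set y | 0 < y] = 1%E ->
  driving_copies lam1 lam2 F1 F2 W1 J1 W2 J2 ->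
  is_root_function k1 c1 -> is_root_function k2 c2 ->
  0 < B -> 0 <= x <= B -> 0 <= b <= B -> 0 <= s ->
  is_resolvent k1 a1 (c1 s) s r1 ->
  is_Kfun k1 k2 (c1 s) (c2 s) s r1 K ->
  [/\ Vlower P B X s = K (b - x) (B - b) / K b (B - b),
      Vupper P B X s =
        frakK r1 K s (b - x) (B - b)
        - K (b - x) (B - b) / K b (B - b) * frakK r1 K s b (B - b) &
      forall z : R[i], 0 <= complex.Re z ->
        Vupperz P B X s z =
          frakKz k1 k2 r1 K s (b - x) (B - b) z
          - (K (b - x) (B - b) / K b (B - b))%:C
            * frakKz k1 k2 r1 K s b (B - b) z].
Proof.
move=> k1 k2 X a10 a20 lam10 lam20 F1pos F2pos copies _ _ _ x0B /andP[b0 bB] s0 Hr1 HK.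
have above z w : 0 <= complex.Re z -> _ :=
  exit_above_identity a10 a20 lam10 lam20 F1pos F2pos copies b0 bB s0 Hr1 HK x0B w.
split.
- exact: (Vlower_identity a10 a20 lam10 lam20 F1pos F2pos copies b0 bB s0 Hr1 HK x0B).
- have E := above 0 1 (lexx 0); rewrite !frakKz0 -rmorphM -rmorphB mul1r in E.
  apply: (etrans _ E); apply: eq_Rintegral => t _.
  by rewrite mul0r oppr0 cexp0 mul1r mulr1.
move=> z z0; pose g t := cexp (- (s * fine (exit_time B (X t)))%:C - z * (exit_overshoot B (X t))%:C).
have gE t : g t =
    (expR (- (s * fine (exit_time B (X t)))))%:C * cexp (- (z * (exit_overshoot B (X t))%:C)).
  rewrite /g cexpD; congr (_ * _).
  by rewrite /cexp /= oppr0 cos0 sin0 mulr1 mulr0.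
have ReC (r : R) (c : R[i]) : complex.Re (r%:C * c) = r * complex.Re c.
  by case: c => p q /=; rewrite mul0r subr0.
have ImC (r : R) (c : R[i]) : complex.Im (r%:C * c) = r * complex.Im c.
  by case: c => p q /=; rewrite mul0r addr0.
have ImE (c : R[i]) : complex.Im c = complex.Re (- 'i * c).
  by case: c => p q /=; ring.
apply/eqP; rewrite eq_complex; apply/andP; split; apply/eqP.
  rewrite -[LHS]/(\int[P]_(t in exit_above B X) complex.Re (g t)).
  have E := above z 1 z0; rewrite !mul1r in E; apply: (etrans _ E).
  by apply: eq_Rintegral => t _; rewrite gE ReC mul1r.
rewrite -[LHS]/(\int[P]_(t in exit_above B X) complex.Im (g t)).
rewrite [RHS]ImE -(above z (- 'i) z0); apply: eq_Rintegral => t _.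
by rewrite gE ImC ImE.
Qed.
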